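(* Let $g:(0,\infty)\to(0,\infty)$ be a function such that $g(x)$ decreases to $0$ as $x\to\infty$ and $g(x^2)/g(x)$ is bounded below by a positive constant. Then there exists a compact composition operator $C_\varphi$ on $\mathcal{H}^2$ such that $a_n(C_\varphi)=e^{O(1)}g(n)$ as $n\to\infty$; that is, there are constants $0<c\le C<\infty$ with $c\,g(n)\le a_n(C_\varphi)\le C\,g(n)$ for all sufficiently large $n$.
   Context: $\mathcal{H}^2$ is the Hilbert space of Dirichlet series $f(s)=\sum_{n\ge1} b_n n^{-s}$ with $\|f\|_{\mathcal{H}^2}^2=\sum_n |b_n|^2<\infty$; its elements are analytic in $\mathbb{C}_{1/2}=\{\operatorname{Re}s>1/2\}$. A composition operator on $\mathcal{H}^2$ is an operator $C_\varphi f=f\circ\varphi$ with $\varphi:\mathbb{C}_{1/2}\to\mathbb{C}_{1/2}$ analytic such that $C_\varphi$ maps $\mathcal{H}^2$ boundedly into itself. The $n$th approximation number $a_n(T)$ of a bounded operator $T$ is the distance in operator norm from $T$ to the set of operators of rank $<n$. *)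

(* Defs.v *)
From Stdlib Require Import Reals Lra Lia.
From Stdlib Require Import ProofIrrelevance FunctionalExtensionality.
From Coquelicot Require Import Coquelicot.

Open Scope R_scope.

(* Dirichlet series sum b_n n^{-s} with square-summable coefficients, given by
   the sequence b. The coefficient b_n of n^{-s} (n >= 1) is [h2_coef f (n - 1)]: sequences are
   indexed from 0. *)
Record H2 : Type := mkH2 {
  h2_coef : nat -> C;
  h2_summable : ex_series (fun n => Cmod (h2_coef n) ^ 2)
}.

Lemma H2_ext (f g : H2) :
  (forall n, h2_coef f n = h2_coef g n) -> f = g.
Proof.
  destruct f as [a Ha], g as [b Hb]; simpl; intros E.
  assert (E' : a = b) by (apply functional_extensionality; exact E).
  subst b; f_equal; apply proof_irrelevance.
Qed.

Definition h2_norm (f : H2) : R := sqrt (Series (fun n => Cmod (h2_coef f n) ^ 2)).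

Lemma ex_series_R_le (a b : nat -> R) :
  (forall n, 0 <= a n <= b n) -> ex_series b -> ex_series a.
Proof.
  intros H Hb.
  apply (ex_series_le (K := R_AbsRing) (V := R_CompleteNormedModule) a b); [ | exact Hb].
  intros n; unfold norm; simpl; unfold abs; simpl.
  rewrite Rabs_pos_eq; apply H.
Qed.

Lemma ex_series_R_ext (a b : nat -> R) :
  (forall n, a n = b n) -> ex_series a -> ex_series b.
Proof. exact (ex_series_ext (K := R_AbsRing) (V := R_NormedModule) a b). Qed.

Lemma ex_series_R_scal (c : R) (a : nat -> R) :
  ex_series a -> ex_series (fun n => c * a n).
Proof. exact (ex_series_scal (K := R_AbsRing) (V := R_NormedModule) c a). Qed.

Lemma ex_series_R_plus (a b : nat -> R) :
  ex_series a -> ex_series b -> ex_series (fun n => a n + b n).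
Proof. exact (ex_series_plus (K := R_AbsRing) (V := R_NormedModule) a b). Qed.

Lemma ex_series_R_0 : ex_series (fun _ : nat => 0).
Proof.
  apply ex_series_R_ext with (fun n => 0 * (/ 2) ^ n); [intros; ring | ].
  apply ex_series_R_scal, ex_series_geom; rewrite Rabs_pos_eq; lra.
Qed.

Lemma h2_zero_summable : ex_series (fun _ : nat => Cmod (RtoC 0) ^ 2).
Proof.
  apply ex_series_R_ext with (2 := ex_series_R_0); intros _; rewrite Cmod_0; ring.
Qed.

Lemma h2_plus_summable (f g : H2) :
  ex_series (fun n => Cmod (h2_coef f n + h2_coef g n)%C ^ 2).
Proof.
  apply ex_series_R_le
    with (fun n => 2 * Cmod (h2_coef f n) ^ 2 + 2 * Cmod (h2_coef g n) ^ 2).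
  - intros n; split; [apply pow2_ge_0 | ].
    pose proof (Cmod_triangle (h2_coef f n) (h2_coef g n)).
    pose proof (Cmod_ge_0 (h2_coef f n + h2_coef g n)).
    pose proof (Cmod_ge_0 (h2_coef f n)).
    pose proof (Cmod_ge_0 (h2_coef g n)).
    pose proof (pow2_ge_0 (Cmod (h2_coef f n) - Cmod (h2_coef g n))).
    nra.
  - apply ex_series_R_plus; apply ex_series_R_scal, h2_summable.
Qed.

Lemma h2_opp_summable (f : H2) : ex_series (fun n => Cmod (- h2_coef f n)%C ^ 2).
Proof.
  apply ex_series_R_ext with (2 := h2_summable f); intros n; now rewrite Cmod_opp.
Qed.

Lemma h2_scal_summable (c : C) (f : H2) :
  ex_series (fun n => Cmod (c * h2_coef f n)%C ^ 2).
Proof.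
  apply ex_series_R_ext with (fun n => Cmod c ^ 2 * Cmod (h2_coef f n) ^ 2).
  - intros n; rewrite Cmod_mult; simpl; ring.
  - apply ex_series_R_scal, h2_summable.
Qed.

Definition h2_zero : H2 := mkH2 (fun _ => RtoC 0) h2_zero_summable.
Definition h2_plus (f g : H2) : H2 :=
  mkH2 (fun n => (h2_coef f n + h2_coef g n)%C) (h2_plus_summable f g).
Definition h2_opp (f : H2) : H2 := mkH2 (fun n => (- h2_coef f n)%C) (h2_opp_summable f).
Definition h2_scal (c : C) (f : H2) : H2 :=
  mkH2 (fun n => (c * h2_coef f n)%C) (h2_scal_summable c f).

Definition H2_AbelianMonoid_mixin : AbelianMonoid.mixin_of H2.
Proof.
  apply (AbelianMonoid.Mixin H2 h2_plus h2_zero);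
    intros; apply H2_ext; intros n; simpl; ring.
Defined.
Canonical H2_AbelianMonoid := AbelianMonoid.Pack H2 H2_AbelianMonoid_mixin H2.

Definition H2_AbelianGroup_mixin : AbelianGroup.mixin_of H2_AbelianMonoid.
Proof.
  apply (AbelianGroup.Mixin H2_AbelianMonoid h2_opp).
  intros f; apply H2_ext; intros n; simpl; ring.
Defined.
Canonical H2_AbelianGroup :=
  AbelianGroup.Pack H2 (AbelianGroup.Class H2 _ H2_AbelianGroup_mixin) H2.

Definition H2_ModuleSpace_mixin : ModuleSpace.mixin_of C_Ring H2_AbelianGroup.
Proof.
  apply (ModuleSpace.Mixin C_Ring H2_AbelianGroup h2_scal);
    intros; apply H2_ext; intros n;
    unfold plus, mult, one; simpl; ring.
Defined.
Canonical H2_ModuleSpace :=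
  ModuleSpace.Pack C_Ring H2 (ModuleSpace.Class C_Ring H2 _ H2_ModuleSpace_mixin) H2.

Lemma h2_sq_ge_0 (f : H2) : 0 <= Series (fun n => Cmod (h2_coef f n) ^ 2).
Proof.
  rewrite <- (Rmult_0_l (Series (fun n => Cmod (h2_coef f n) ^ 2))).
  rewrite <- Series_scal_l.
  apply Series_le; [ | apply h2_summable].
  intros n; pose proof (pow2_ge_0 (Cmod (h2_coef f n))); lra.
Qed.

Lemma h2_norm_ge_0 (f : H2) : 0 <= h2_norm f.
Proof. apply sqrt_pos. Qed.

Lemma h2_norm_sq (f : H2) :
  h2_norm f ^ 2 = Series (fun n => Cmod (h2_coef f n) ^ 2).
Proof. unfold h2_norm; rewrite pow2_sqrt; [reflexivity | apply h2_sq_ge_0]. Qed.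

Lemma sum_n_R_S (a : nat -> R) (n : nat) : sum_n a (S n) = sum_n a n + a (S n).
Proof. exact (sum_Sn (G := R_AbelianMonoid) a n). Qed.

Lemma h2_coef_le_norm (f : H2) (n : nat) : Cmod (h2_coef f n) <= h2_norm f.
Proof.
  apply Rsqr_incr_0_var; [ | apply h2_norm_ge_0].
  rewrite !Rsqr_pow2, h2_norm_sq.
  pose proof (Series_correct _ (h2_summable f)) as H.
  apply (is_lim_seq_incr_compare (sum_n (fun k => Cmod (h2_coef f k) ^ 2))) with (n := n) in H.
  - apply Rle_trans with (2 := H).
    destruct n as [ | n]; [rewrite sum_O; apply Rle_refl | ].
    rewrite sum_n_R_S.
    assert (0 <= sum_n (fun k => Cmod (h2_coef f k) ^ 2) n).
    { rewrite sum_n_Reals; apply cond_pos_sum; intros; apply pow2_ge_0. }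
    lra.
  - intros k; rewrite sum_n_R_S.
    pose proof (pow2_ge_0 (Cmod (h2_coef f (S k)))); lra.
Qed.

Lemma h2_norm_eq_0 (f : H2) : h2_norm f = 0 -> f = h2_zero.
Proof.
  intros H; apply H2_ext; intros n; simpl; apply Cmod_eq_0.
  pose proof (h2_coef_le_norm f n); pose proof (Cmod_ge_0 (h2_coef f n)); lra.
Qed.

Lemma h2_norm_zero : h2_norm h2_zero = 0.
Proof.
  unfold h2_norm; rewrite <- sqrt_0; f_equal; simpl.
  rewrite (Series_ext _ (fun n => 0 * 0)) by (intros; rewrite Cmod_0; ring).
  rewrite Series_scal_l; ring.
Qed.

Lemma h2_norm_scal (c : C) (f : H2) : h2_norm (h2_scal c f) = Cmod c * h2_norm f.
Proof.
  unfold h2_norm; simpl h2_coef.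
  rewrite (Series_ext _ (fun n => Cmod c ^ 2 * Cmod (h2_coef f n) ^ 2)).
  - rewrite Series_scal_l, sqrt_mult;
      [ | apply pow2_ge_0 | apply h2_sq_ge_0].
    now rewrite sqrt_pow2 by apply Cmod_ge_0.
  - intros n; rewrite Cmod_mult; ring.
Qed.

Lemma h2_norm_opp (f : H2) : h2_norm (h2_opp f) = h2_norm f.
Proof.
  unfold h2_norm; f_equal; apply Series_ext; intros n; simpl; now rewrite Cmod_opp.
Qed.

Lemma h2_norm_triangle (f g : H2) : h2_norm (h2_plus f g) <= h2_norm f + h2_norm g.
Proof.
  destruct (h2_norm_ge_0 f) as [Hf | Hf].
  2:{ symmetry in Hf; apply h2_norm_eq_0 in Hf; subst f; rewrite h2_norm_zero.
      replace (h2_plus h2_zero g) with g; [lra | ].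
      apply H2_ext; intros n; simpl; ring. }
  destruct (h2_norm_ge_0 g) as [Hg | Hg].
  2:{ symmetry in Hg; apply h2_norm_eq_0 in Hg; subst g; rewrite h2_norm_zero.
      replace (h2_plus f h2_zero) with f; [lra | ].
      apply H2_ext; intros n; simpl; ring. }
  set (x := h2_norm f) in *; set (y := h2_norm g) in *.
  apply Rsqr_incr_0_var; [ | lra].
  rewrite !Rsqr_pow2, h2_norm_sq.
  assert (Hx : 0 <= y / x) by (apply Rlt_le, Rdiv_lt_0_compat; assumption).
  assert (Hy : 0 <= x / y) by (apply Rlt_le, Rdiv_lt_0_compat; assumption).
  replace ((x + y) ^ 2) with ((1 + y / x) * x ^ 2 + (1 + x / y) * y ^ 2)
    by (field; lra).
  unfold x at 2, y at 3; rewrite !h2_norm_sq.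
  rewrite <- !Series_scal_l, <- Series_plus
    by (apply ex_series_R_scal, h2_summable).
  apply Series_le;
    [ | apply ex_series_R_plus; apply ex_series_R_scal, h2_summable].
  intros n; split; [apply pow2_ge_0 | ]; simpl h2_coef.
  set (a := Cmod (h2_coef f n)); set (b := Cmod (h2_coef g n)).
  apply Rle_trans with ((a + b) ^ 2).
  - apply pow_incr; split; [apply Cmod_ge_0 | apply Cmod_triangle].
  - assert (H : 0 <= (a * y - b * x) ^ 2 / (x * y)).
    { apply Rmult_le_pos; [apply pow2_ge_0 | ].
      apply Rlt_le, Rinv_0_lt_compat, Rmult_lt_0_compat; assumption. }
    replace ((1 + y / x) * a ^ 2 + (1 + x / y) * b ^ 2)
      with ((a + b) ^ 2 + (a * y - b * x) ^ 2 / (x * y)) by (field; lra).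
    lra.
Qed.

Definition h2_ball (f : H2) (e : R) (g : H2) : Prop := h2_norm (minus g f) < e.

Definition H2_UniformSpace_mixin : UniformSpace.mixin_of H2.
Proof.
  apply (UniformSpace.Mixin H2 h2_zero h2_ball); unfold h2_ball.
  - intros f e; rewrite minus_eq_zero.
    change (h2_norm h2_zero < e); rewrite h2_norm_zero; apply cond_pos.
  - intros f g e H; rewrite <- opp_minus.
    change (h2_norm (h2_opp (minus g f)) < e); now rewrite h2_norm_opp.
  - intros f g h e1 e2 Hfg Hgh.
    rewrite (minus_trans g h f).
    eapply Rle_lt_trans; [apply h2_norm_triangle | lra].
Defined.
Canonical H2_UniformSpace := UniformSpace.Pack H2 H2_UniformSpace_mixin H2.

Canonical H2_NormedModuleAux :=
  NormedModuleAux.Pack C_AbsRing H2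
    (NormedModuleAux.Class C_AbsRing H2
      (ModuleSpace.class C_Ring H2_ModuleSpace) H2_UniformSpace_mixin) H2.

Definition H2_NormedModule_mixin : NormedModule.mixin_of C_AbsRing H2_NormedModuleAux.
Proof.
  apply (NormedModule.Mixin C_AbsRing H2_NormedModuleAux h2_norm 1).
  - exact h2_norm_triangle.
  - intros c f; right; exact (h2_norm_scal c f).
  - intros f g e H; exact H.
  - intros f g e H; rewrite Rmult_1_l; exact H.
  - exact h2_norm_eq_0.
Defined.
Canonical H2_NormedModule :=
  NormedModule.Pack C_AbsRing H2
    (NormedModule.Class C_AbsRing H2 _ H2_NormedModule_mixin) H2.

Definition half_plane (s : C) : Prop := 1 / 2 < Re s.

(* n^{-s} = exp (- s ln n) for n >= 1, written in real and imaginary parts. *)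
Definition npow_opp (n : nat) (s : C) : C :=
  (exp (- (Re s * ln (INR n))) * cos (Im s * ln (INR n)),
   - (exp (- (Re s * ln (INR n))) * sin (Im s * ln (INR n)))).

Definition h2_term (f : H2) (s : C) (n : nat) : C :=
  (h2_coef f n * npow_opp (S n) s)%C.

(* Coquelicot's [Series] is real-valued, hence the two components; that this is
   the sum of the series in [C] on the half-plane is [h2_eval_correct]. *)
Definition h2_eval (f : H2) (s : C) : C :=
  (Series (fun n => Re (h2_term f s n)), Series (fun n => Im (h2_term f s n))).

Lemma ex_series_R_pos_bounded (a : nat -> R) (M : R) :
  (forall n, 0 <= a n) -> (forall n, sum_n a n <= M) -> ex_series a.
Proof.
  intros Ha HM.
  destruct (ex_finite_lim_seq_incr (sum_n a) M) as [l Hl].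
  - intros n; rewrite sum_n_R_S; specialize (Ha (S n)); lra.
  - exact HM.
  - exists l; exact Hl.
Qed.

Lemma ex_series_npow (p : R) :
  1 < p -> ex_series (fun n => exp (- (p * ln (INR (S n))))).
Proof.
  intros Hp.
  set (u := fun n => exp (- ((p - 1) * ln (INR (S n))))).
  assert (Hpos : forall n, 0 < INR (S n)) by (intros n; apply lt_0_INR; lia).
  assert (Hstep : forall n,
    (p - 1) * exp (- (p * ln (INR (S (S n))))) <= u n - u (S n)).
  { intros n; unfold u.
    set (l1 := ln (INR (S n))); set (l2 := ln (INR (S (S n)))).
    assert (Hinv : / INR (S (S n)) = exp (- l2)).
    { unfold l2; rewrite exp_Ropp, exp_ln; auto. }
    assert (Hl : exp (- l2) <= l2 - l1).
    { pose proof (exp_ineq1_le (l1 - l2)) as H.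
      unfold Rminus in H; rewrite exp_plus in H; unfold l1 at 2 in H.
      rewrite exp_ln in H by auto.
      rewrite <- Hinv in H |- *.
      assert (E : INR (S n) * / INR (S (S n)) = 1 - / INR (S (S n))).
      { rewrite (S_INR (S n)); specialize (Hpos n); field; lra. }
      lra. }
    replace (- (p * l2)) with (- ((p - 1) * l2) + - l2) by ring.
    replace (- ((p - 1) * l1)) with (- ((p - 1) * l2) + (p - 1) * (l2 - l1)) by ring.
    rewrite !exp_plus.
    pose proof (exp_ineq1_le ((p - 1) * (l2 - l1))) as H.
    pose proof (exp_pos (- ((p - 1) * l2))) as He.
    assert ((p - 1) * exp (- l2) <= exp ((p - 1) * (l2 - l1)) - 1).
    { apply Rle_trans with ((p - 1) * (l2 - l1)); [ | lra].
      apply Rmult_le_compat_l; lra. }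
    nra. }
  assert (Hsum : forall n,
    (p - 1) * sum_n (fun k => exp (- (p * ln (INR (S k))))) n <= p - u n).
  { induction n as [ | n IH].
    - rewrite sum_O; unfold u; simpl INR; rewrite ln_1, !Rmult_0_r, Ropp_0, exp_0; lra.
    - rewrite sum_n_R_S, Rmult_plus_distr_l; specialize (Hstep n); lra. }
  apply ex_series_R_pos_bounded with (p / (p - 1)).
  - intros n; apply Rlt_le, exp_pos.
  - intros n; apply Rmult_le_reg_l with (p - 1); [lra | ].
    apply Rle_trans with (1 := Hsum n).
    replace ((p - 1) * (p / (p - 1))) with p by (field; lra).
    pose proof (exp_pos (- ((p - 1) * ln (INR (S n))))); unfold u; lra.
Qed.

Lemma Cmod_npow_opp (n : nat) (s : C) :
  Cmod (npow_opp n s) = exp (- (Re s * ln (INR n))).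
Proof.
  unfold npow_opp, Cmod; simpl fst; simpl snd.
  set (r := exp _); set (t := Im s * _).
  replace ((r * cos t) ^ 2 + (- (r * sin t)) ^ 2) with (r ^ 2).
  - apply sqrt_pow2, Rlt_le, exp_pos.
  - pose proof (sin2_cos2 t) as H; unfold Rsqr in H.
    transitivity (r ^ 2 * (sin t * sin t + cos t * cos t)); [rewrite H | ]; ring.
Qed.

Lemma h2_term_abs_summable (f : H2) (s : C) :
  half_plane s -> ex_series (fun n => Cmod (h2_term f s n)).
Proof.
  unfold half_plane; intros Hs.
  apply ex_series_R_le
    with (fun n => Cmod (h2_coef f n) ^ 2 + exp (- (2 * Re s * ln (INR (S n))))).
  - intros n; split; [apply Cmod_ge_0 | ].
    unfold h2_term; rewrite Cmod_mult, Cmod_npow_opp.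
    replace (- (2 * Re s * ln (INR (S n))))
      with (- (Re s * ln (INR (S n))) + - (Re s * ln (INR (S n)))) by ring.
    rewrite exp_plus.
    set (a := Cmod _); set (b := exp _).
    pose proof (pow2_ge_0 (a - b)); pose proof (pow2_ge_0 (a + b)); nra.
  - apply ex_series_R_plus; [apply h2_summable | ].
    apply ex_series_npow; lra.
Qed.

Lemma is_series_C_pair (a : nat -> C) (x y : R) :
  is_series (fun n => Re (a n)) x -> is_series (fun n => Im (a n)) y ->
  is_series (V := C_NormedModule) a (x, y).
Proof.
  intros Hx Hy P [eps HP].
  assert (E : forall n, sum_n a n = (sum_n (fun k => Re (a k)) n, sum_n (fun k => Im (a k)) n)).
  { induction n as [ | n IH].
    - rewrite !sum_O; now destruct (a 0%nat).
    - rewrite !sum_Sn, IH; now destruct (a (S n)). }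
  assert (Fx := Hx _ (locally_ball x eps)).
  assert (Fy := Hy _ (locally_ball y eps)).
  unfold filtermap in *.
  generalize (filter_and _ _ Fx Fy); apply filter_imp; intros n [Hnx Hny].
  apply HP; rewrite E; split; assumption.
Qed.

Lemma h2_eval_correct (f : H2) (s : C) :
  half_plane s -> is_series (V := C_NormedModule) (h2_term f s) (h2_eval f s).
Proof.
  intros Hs; pose proof (h2_term_abs_summable f s Hs) as Habs.
  apply is_series_C_pair; apply Series_correct, ex_series_Rabs;
    apply ex_series_R_le with (2 := Habs); intros n; split; try apply Rabs_pos;
    pose proof (Rmax_Cmod (h2_term f s n)) as H;
    eapply Rle_trans; [ apply Rmax_l | exact H | apply Rmax_r | exact H ].
Qed.

(* Coquelicot's [is_linear] is "linear and bounded". *)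

(* The supremum is finite on bounded operators, the only ones it is applied to. *)
Definition op_norm {U V : NormedModule C_AbsRing} (T : U -> V) : R :=
  real (Lub_Rbar (fun r => exists x : U, norm x <= 1 /\ r = norm (T x))).

Definition rank_lt {U V : NormedModule C_AbsRing} (n : nat) (T : U -> V) : Prop :=
  exists (k : nat) (v : nat -> V), (k < n)%nat /\
    forall x : U, exists c : nat -> C,
      T x = sum_n_m (fun i => scal (c i : C_AbsRing) (v i)) 1 k.

(* The distance in operator norm from [T] to the bounded operators of rank < n,
   for bounded [T] and n >= 1 (no operator has rank < 0). *)
Definition approx_number {U V : NormedModule C_AbsRing} (n : nat) (T : U -> V) : R :=
  real (Glb_Rbar (fun r => exists S : U -> V,
    is_linear S /\ rank_lt n S /\ r = op_norm (fun x => minus (T x) (S x)))).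

Definition compact_operator {U V : NormedModule C_AbsRing} (T : U -> V) : Prop :=
  is_linear T /\
  forall x : nat -> U, (exists M : R, forall k, norm (x k) <= M) ->
    exists (sigma : nat -> nat) (y : V),
      (forall j k, (j < k)%nat -> (sigma j < sigma k)%nat) /\
      filterlim (fun k => T (x (sigma k))) eventually (locally y).

Definition analytic_on_half_plane (phi : C -> C) : Prop :=
  forall s : C, half_plane s -> ex_derive (K := C_AbsRing) (V := C_NormedModule) phi s.

(* [T] is the composition operator with symbol [phi]; only the restriction of
   [phi] to the half-plane matters. *)
Definition composition_operator (phi : C -> C) (T : H2 -> H2) : Prop :=
  (forall s, half_plane s -> half_plane (phi s)) /\
  analytic_on_half_plane phi /\
  is_linear T /\
  forall (f : H2) (s : C), half_plane s -> h2_eval (T f) s = h2_eval f (phi s).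

(* Main.v *)
Require Import Defs.
From Stdlib Require Import Reals Lra Lia Classical ClassicalEpsilon
  FunctionalExtensionality PropExtensionality.
From Coquelicot Require Import Coquelicot.
Open Scope R_scope.

(** The operator is [C_phi] with [phi(s) = s - log A(2^-s) / log 2], where [A] is the generating
    function of a probability law [a] on the nonnegative integers such that all powers [A^lam]
    have nonnegative coefficients. Since [n^(-phi(s)) = n^-s A(2^-s)^(log2 n)], the matrix of
    [C_phi] is lower triangular with nonnegative entries, the entry at [(n 2^k, n)] being the
    coefficient of [z^k] in [A^(log2 n)], and it is a direct sum over the odd parts of the
    indices. Its column sums are 1, so by Schur's test the square of its norm on the span of the
    [m^-s] with [m >= n] is at most a supremum of row sums, and these count the visits, after
    time [log2 n], of the renewal process whose step is [k + 1] with probability [a k]. With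
    [H j = const * g(2^(2^j))^2], the law [a] is a mixture of geometric laws of parameters
    [H j / 2^j] for which that number of visits is [O(H j)] when [log2 n >= 2^j]; truncating the Dirichlet series gives the upper
    bound. Complete monotonicity and Kaluza's theorem on log-convex sequences provide both the
    nonnegativity of the coefficients of [A^lam] and the monotonicity of the renewal sequence.

    For the lower bound, the vectors [sum_{k < 2^j} (m 2^k)^-s] with [m = 1, 3, ..., 2 n - 1]
    have disjoint supports, as do their images, and testing the image against [x^k],
    [x = 1 - H j / 2^j], shows that each norm shrinks at most by a constant times
    [sqrt (H j)]. *)

(** * Finite sums and convolutions *)

(** The law is tuned through one quantity, its mean step truncated at length [2^j / H j], which is
    made comparable with [/ H j]: a renewal process with that mean visits a given distant point with
    probability about [H j]. The square in [H] is there because row sums control squared norms.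
    Scales sit at [2^(2^j)] because time is [log2 n], so that squaring [n] doubles the time; the
    hypothesis on [g (x ^ 2) / g x] thus bounds by a constant factor [kap] what [H] loses between
    adjacent scales. The obstacle is that every single row must be bounded, not their average. For
    far points the monotonicity of the renewal sequence turns the average into a pointwise bound.
    Near points are too close for the truncated mean to have built up; there an exponential estimate
    shows that many steps rarely cover little ground, so that a doubling of the time gains at least
    the factor lost by [H], and an induction on [j] closes. Nonnegative coefficients of [A^lam] are
    indispensable because [log2 n] is seldom an integer: they give a meaning to a fractional number
    of steps. *)

Fixpoint rsum (f : nat -> R) (n : nat) : R :=
  match n with O => 0 | S n => rsum f n + f n end.

Lemma rsum_ext (f g : nat -> R) (n : nat) :
  (forall k, (k < n)%nat -> f k = g k) -> rsum f n = rsum g n.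
Proof.
  induction n as [ | n IH]; intros H; simpl; [reflexivity | ].
  rewrite IH, (H n) by (intros; try apply H; lia); reflexivity.
Qed.

Lemma rsum_le (f g : nat -> R) (n : nat) :
  (forall k, (k < n)%nat -> f k <= g k) -> rsum f n <= rsum g n.
Proof.
  induction n as [ | n IH]; intros H; simpl; [lra | ].
  apply Rplus_le_compat; [apply IH; intros | ]; apply H; lia.
Qed.

Lemma rsum_plus (f g : nat -> R) (n : nat) :
  rsum (fun k => f k + g k) n = rsum f n + rsum g n.
Proof. induction n as [ | n IH]; simpl; [lra | rewrite IH; ring]. Qed.

Lemma rsum_minus (f g : nat -> R) (n : nat) :
  rsum (fun k => f k - g k) n = rsum f n - rsum g n.
Proof. induction n as [ | n IH]; simpl; [lra | rewrite IH; ring]. Qed.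

Lemma rsum_scal (c : R) (f : nat -> R) (n : nat) :
  rsum (fun k => c * f k) n = c * rsum f n.
Proof. induction n as [ | n IH]; simpl; [lra | rewrite IH; ring]. Qed.

Lemma rsum_scal_r (c : R) (f : nat -> R) (n : nat) :
  rsum (fun k => f k * c) n = rsum f n * c.
Proof. induction n as [ | n IH]; simpl; [lra | rewrite IH; ring]. Qed.

Lemma rsum_const (c : R) (n : nat) : rsum (fun _ => c) n = INR n * c.
Proof. induction n as [ | n IH]; [simpl; lra | simpl rsum; rewrite IH, S_INR; ring]. Qed.

Lemma rsum_eq0 (f : nat -> R) (n : nat) :
  (forall k, (k < n)%nat -> f k = 0) -> rsum f n = 0.
Proof.
  intros H; rewrite (rsum_ext f (fun _ => 0) n H), rsum_const; ring.
Qed.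

Lemma rsum_ge0 (f : nat -> R) (n : nat) :
  (forall k, (k < n)%nat -> 0 <= f k) -> 0 <= rsum f n.
Proof.
  intros H; rewrite <- (rsum_eq0 (fun _ => 0) n) by reflexivity; now apply rsum_le.
Qed.

Lemma rsum_split (f : nat -> R) (n m : nat) :
  rsum f (n + m) = rsum f n + rsum (fun k => f (n + k)%nat) m.
Proof.
  induction m as [ | m IH]; [rewrite Nat.add_0_r; simpl; lra | ].
  rewrite Nat.add_succ_r; simpl; rewrite IH; ring.
Qed.

Lemma rsum_le_len (f : nat -> R) (n m : nat) :
  (forall k, 0 <= f k) -> (n <= m)%nat -> rsum f n <= rsum f m.
Proof.
  intros H Hnm; replace m with (n + (m - n))%nat by lia; rewrite rsum_split.
  pose proof (rsum_ge0 _ (m - n) (fun k _ => H (n + k)%nat)); lra.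
Qed.

Lemma rsum_term_le (f : nat -> R) (k n : nat) :
  (forall k, 0 <= f k) -> (k < n)%nat -> f k <= rsum f n.
Proof.
  intros H Hk; apply Rle_trans with (rsum f (S k)); [ | apply rsum_le_len; auto; lia].
  simpl; pose proof (rsum_ge0 _ k (fun i _ => H i)); lra.
Qed.

Lemma rsum_first (f : nat -> R) (n : nat) :
  rsum f (S n) = f O + rsum (fun k => f (S k)) n.
Proof. change (S n) with (1 + n)%nat; rewrite rsum_split; simpl; ring. Qed.

Lemma rsum_rev (f : nat -> R) (n : nat) :
  rsum (fun k => f (n - k)%nat) (S n) = rsum f (S n).
Proof.
  revert f; induction n as [ | n IH]; intros f; [reflexivity | ].
  change (rsum f (S (S n))) with (rsum f (S n) + f (S n)).
  rewrite rsum_first, <- (IH f), Nat.sub_0_r, Rplus_comm; reflexivity.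
Qed.

Lemma rsum_switch (F : nat -> nat -> R) (n m : nat) :
  rsum (fun i => rsum (F i) m) n = rsum (fun j => rsum (fun i => F i j) n) m.
Proof.
  induction n as [ | n IH]; simpl.
  - symmetry; now apply rsum_eq0.
  - now rewrite IH, rsum_plus.
Qed.

(** The same triangle of indices is summed by antidiagonals on one side and by rows on the other;
    convolution identities reduce to this. *)
Lemma rsum_triangle (F : nat -> nat -> R) (n : nat) :
  rsum (fun k => rsum (fun i => F i (k - i)%nat) (S k)) (S n) =
  rsum (fun i => rsum (F i) (S (n - i))) (S n).
Proof.
  induction n as [ | n IH]; [reflexivity | ].
  transitivity (rsum (fun i => rsum (F i) (S (n - i))) (S n) +
                rsum (fun i => F i (S n - i)%nat) (S (S n)));
    [rewrite <- IH; reflexivity | ].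
  transitivity (rsum (fun i => rsum (F i) (S n - i)) (S (S n)) +
                rsum (fun i => F i (S n - i)%nat) (S (S n)));
    [ | rewrite <- rsum_plus; reflexivity].
  f_equal.
  transitivity (rsum (fun i => rsum (F i) (S n - i)) (S n) + rsum (F (S n)) (S n - S n));
    [ | reflexivity].
  rewrite Nat.sub_diag; change (rsum (F (S n)) 0) with 0; rewrite Rplus_0_r.
  apply rsum_ext; intros k Hk; now replace (S n - k)%nat with (S (n - k)) by lia.
Qed.

Lemma rsum_triangle_sym (F : nat -> nat -> R) (n : nat) :
  rsum (fun i => rsum (F i) (S (n - i))) (S n) =
  rsum (fun j => rsum (fun i => F i j) (S (n - j))) (S n).
Proof.
  rewrite <- rsum_triangle, <- (rsum_triangle (fun j i => F i j)).
  apply rsum_ext; intros k Hk.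
  rewrite <- rsum_rev; apply rsum_ext; intros i Hi.
  now replace (k - (k - i))%nat with i by lia.
Qed.

Lemma cauchy_schwarz_rsum (f g : nat -> R) (n : nat) :
  rsum (fun k => f k * g k) n ^ 2 <=
  rsum (fun k => f k ^ 2) n * rsum (fun k => g k ^ 2) n.
Proof.
  induction n as [ | n IH]; cbn [rsum]; [lra | ].
  set (A := rsum (fun k => f k ^ 2) n) in *; set (B := rsum (fun k => g k ^ 2) n) in *.
  set (P := rsum (fun k => f k * g k) n) in *.
  assert (HA : 0 <= A) by (apply rsum_ge0; intros; apply pow2_ge_0).
  assert (HB : 0 <= B) by (apply rsum_ge0; intros; apply pow2_ge_0).
  cbv beta; set (x := f n); set (y := g n).
  (* The inductive inequality [P ^ 2 <= A * B] and [0 <= (A * y ^ 2 - B * x ^ 2) ^ 2] together bound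
     the square of the cross term. *)
  assert (H : 2 * P * (x * y) <= A * y ^ 2 + B * x ^ 2).
  { apply Rle_trans with (1 := Rle_abs _).
    apply Rsqr_incr_0_var; [ | pose proof (pow2_ge_0 x); pose proof (pow2_ge_0 y); nra].
    rewrite <- Rsqr_abs, !Rsqr_pow2.
    pose proof (pow2_ge_0 (A * y ^ 2 - B * x ^ 2)).
    pose proof (Rmult_le_compat_r _ _ _ (pow2_ge_0 (x * y)) IH).
    nra. }
  apply Rle_trans with (P ^ 2 + 2 * P * (x * y) + (x * y) ^ 2); [apply Req_le; ring | ].
  apply Rle_trans with (A * B + (A * y ^ 2 + B * x ^ 2) + (x * y) ^ 2); [lra | ].
  apply Req_le; ring.
Qed.

Lemma is_series_rsum (f : nat -> R) (l : R) :
  is_series f l <-> is_lim_seq (rsum f) l.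
Proof.
  assert (E : forall n, sum_n f n = rsum f (S n)).
  { induction n as [ | n IH]; [rewrite sum_O; simpl; ring | ].
    rewrite sum_n_R_S, IH; reflexivity. }
  rewrite is_lim_seq_incr_1; split; intros H.
  - apply is_lim_seq_ext with (2 := H); exact E.
  - change (is_lim_seq (sum_n f) l); apply is_lim_seq_ext with (2 := H); now intros.
Qed.

Lemma Series_rsum_le (f : nat -> R) (M : R) :
  (forall n, 0 <= f n) -> (forall n, rsum f n <= M) -> ex_series f /\ 0 <= Series f <= M.
Proof.
  intros Hf HM.
  destruct (ex_finite_lim_seq_incr (rsum f) M) as [l Hl]; auto.
  { intros n; simpl; specialize (Hf n); lra. }
  assert (Hs : is_series f l) by now apply is_series_rsum.
  split; [now exists l | ].
  rewrite (is_series_unique _ _ Hs); split.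
  - apply (is_lim_seq_le (fun _ => 0) (rsum f) 0 l); auto using is_lim_seq_const.
    intros n; now apply rsum_ge0.
  - apply (is_lim_seq_le (rsum f) (fun _ => M) l M); auto using is_lim_seq_const.
Qed.

Lemma rsum_le_series (f : nat -> R) (l : R) (n : nat) :
  (forall n, 0 <= f n) -> is_series f l -> rsum f n <= l.
Proof.
  intros Hf Hs; apply is_series_rsum in Hs.
  apply (is_lim_seq_incr_compare (rsum f) l Hs); intros k; simpl; specialize (Hf k); lra.
Qed.

(** * Convolution and course-of-values recursion *)

Definition conv (f g : nat -> R) (n : nat) : R :=
  rsum (fun k => f k * g (n - k)%nat) (S n).

Lemma conv_ext (f f' g g' : nat -> R) (n : nat) :
  (forall k, (k <= n)%nat -> f k = f' k) -> (forall k, (k <= n)%nat -> g k = g' k) ->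
  conv f g n = conv f' g' n.
Proof.
  intros Hf Hg; apply rsum_ext; intros k Hk; rewrite Hf, Hg by lia; reflexivity.
Qed.

Lemma conv_comm (f g : nat -> R) (n : nat) : conv f g n = conv g f n.
Proof.
  unfold conv; rewrite <- rsum_rev; apply rsum_ext; intros k Hk.
  replace (n - (n - k))%nat with k by lia; ring.
Qed.

Lemma conv_assoc (f g h : nat -> R) (n : nat) :
  conv (conv f g) h n = conv f (conv g h) n.
Proof.
  unfold conv.
  rewrite (rsum_ext _ (fun k => rsum (fun i =>
    (fun i j => f i * g j * h (n - i - j)%nat) i (k - i)%nat) (S k))).
  - rewrite (rsum_triangle (fun i j => f i * g j * h (n - i - j)%nat)).
    apply rsum_ext; intros k Hk; rewrite <- rsum_scal; apply rsum_ext; intros; ring.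
  - intros k Hk; rewrite <- rsum_scal_r; apply rsum_ext; intros i Hi.
    now replace (n - i - (k - i))%nat with (n - k)%nat by lia.
Qed.

Lemma conv_scal_l (c : R) (f g : nat -> R) (n : nat) :
  conv (fun k => c * f k) g n = c * conv f g n.
Proof. unfold conv; rewrite <- rsum_scal; apply rsum_ext; intros; ring. Qed.

Lemma conv_scal_r (c : R) (f g : nat -> R) (n : nat) :
  conv f (fun k => c * g k) n = c * conv f g n.
Proof. unfold conv; rewrite <- rsum_scal; apply rsum_ext; intros; ring. Qed.

(* The formal derivation [z d/dz] acts on coefficients as multiplication by the index. *)
Lemma conv_derivation (f g : nat -> R) (n : nat) :
  INR n * conv f g n =
  conv (fun k => INR k * f k) g n + conv f (fun k => INR k * g k) n.
Proof.
  unfold conv; rewrite <- rsum_scal, <- rsum_plus; apply rsum_ext; intros k Hk.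
  rewrite (minus_INR n k) by lia; ring.
Qed.

(** Course-of-values recursion made structural: the table of all values so far is carried along as a
    function, so that a step may consult every earlier value. *)
Fixpoint rec_tab (x0 : R) (step : (nat -> R) -> nat -> R) (n : nat) : nat -> R :=
  match n with
  | O => fun _ => x0
  | S m => fun k => if (k <=? m)%nat then rec_tab x0 step m k else step (rec_tab x0 step m) m
  end.

(* [step f m] is the value at [m + 1]; it may only use [f] on [0..m]. *)
Definition rec_seq (x0 : R) (step : (nat -> R) -> nat -> R) (n : nat) : R :=
  rec_tab x0 step n n.

Lemma rec_tab_seq x0 step n k : (k <= n)%nat -> rec_tab x0 step n k = rec_seq x0 step k.
Proof.
  induction n as [ | n IH]; intros Hk.
  - now replace k with O by lia.
  - destruct (Nat.eq_dec k (S n)) as [-> | Hne]; [reflexivity | ]; simpl.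
    replace (k <=? n)%nat with true by (symmetry; apply Nat.leb_le; lia); apply IH; lia.
Qed.

Lemma rec_seq_S x0 step n :
  (forall f f' : nat -> R, (forall k, (k <= n)%nat -> f k = f' k) -> step f n = step f' n) ->
  rec_seq x0 step (S n) = step (rec_seq x0 step) n.
Proof.
  intros H; unfold rec_seq at 1; cbn [rec_tab].
  replace (S n <=? n)%nat with false by (symmetry; apply Nat.leb_gt; lia).
  apply H; intros; now apply rec_tab_seq.
Qed.

(** * Real powers of a log-convex generating function *)

Lemma rsum_conv_le (f g : nat -> R) (n : nat) :
  (forall k, 0 <= f k) -> (forall k, 0 <= g k) ->
  rsum (conv f g) n <= rsum f n * rsum g n.
Proof.
  intros Hf Hg; destruct n as [ | n]; [simpl; lra | ].
  unfold conv; rewrite (rsum_triangle (fun i j => f i * g j)).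
  rewrite <- rsum_scal_r; apply rsum_le; intros k Hk.
  rewrite rsum_scal; apply Rmult_le_compat_l; auto.
  apply rsum_le_len; auto; lia.
Qed.

Lemma conv_shift_l (f g : nat -> R) (n : nat) :
  conv f g (S n) = f O * g (S n) + conv (fun k => f (S k)) g n.
Proof. unfold conv; rewrite rsum_first; reflexivity. Qed.

Lemma conv_shift_r (f g : nat -> R) (n : nat) :
  conv f g (S n) = f (S n) * g O + conv f (fun k => g (S k)) n.
Proof. rewrite conv_comm, conv_shift_l, conv_comm; ring. Qed.

(** Division-free form of the fact that log-convexity makes the ratios [t (S n) / t n] increase. *)
Lemma log_convex_ratio (t : nat -> R) :
  (forall n, 0 < t n) -> (forall n, t (S n) ^ 2 <= t n * t (S (S n))) ->
  forall m n, (m <= n)%nat -> t (S m) * t n <= t (S n) * t m.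
Proof.
  intros Hp Hc m n H; induction H as [ | n H IH]; [lra | ].
  pose proof (Hp n); pose proof (Hp (S n)); pose proof (Hp m).
  apply Rmult_le_reg_r with (t n); [auto | ].
  apply Rle_trans with (t (S n) * (t (S n) * t m)).
  - replace (t (S m) * t (S n) * t n) with (t (S n) * (t (S m) * t n)) by ring.
    apply Rmult_le_compat_l; lra.
  - specialize (Hc n); nra.
Qed.

(* Kaluza's argument. With [c = 1] it gives the signs of the coefficients of a reciprocal,
   with [c n = n + 1] those of a logarithmic derivative. *)
Lemma kaluza (t v c : nat -> R) :
  (forall n, 0 < t n) -> (forall n, t (S n) ^ 2 <= t n * t (S (S n))) ->
  (forall n, 0 <= c n <= c (S n)) ->
  (forall n, c n * t (S n) = conv v t n) -> forall n, 0 <= v n.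
Proof.
  intros Hp Hc Hw Hv n.
  induction n as [n IH] using (well_founded_induction Wf_nat.lt_wf).
  assert (Hlast : 0 <= v n * t O).
  { destruct n as [ | n].
    - specialize (Hv O); unfold conv in Hv; simpl in Hv.
      pose proof (Rmult_le_pos _ _ (proj1 (Hw O)) (Rlt_le _ _ (Hp 1%nat))); lra.
    - pose proof (Hv (S n)) as H; unfold conv in H; cbn [rsum] in H.
      rewrite Nat.sub_diag in H.
      change (rsum (fun k => v k * t (S n - k)%nat) n + v n * t (S n - n)%nat)
        with (rsum (fun k => v k * t (S n - k)%nat) (S n)) in H.
      (* The equation at [n], multiplied by the ratio [t (S (S n)) / t (S n)], dominates the
         equation at [S n] without its last term, because no earlier ratio exceeds this one. *)
      assert (Hr : rsum (fun k => v k * t (S n - k)%nat) (S n) * t (S n) <=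
                   c n * t (S (S n)) * t (S n)).
      { replace (c n * t (S (S n)) * t (S n)) with (t (S (S n)) * conv v t n)
          by (rewrite <- Hv; ring).
        rewrite <- rsum_scal_r; unfold conv; rewrite <- rsum_scal.
        apply rsum_le; intros k Hk.
        replace (v k * t (S n - k)%nat * t (S n)) with (v k * (t (S n - k)%nat * t (S n))) by ring.
        replace (t (S (S n)) * (v k * t (n - k)%nat)) with (v k * (t (S (S n)) * t (n - k)%nat))
          by ring.
        apply Rmult_le_compat_l; [apply IH; lia | ].
        replace (S n - k)%nat with (S (n - k)) by lia.
        apply log_convex_ratio; auto; lia. }
      apply Rmult_le_reg_r in Hr; [ | apply Hp].
      assert (c n * t (S (S n)) <= c (S n) * t (S (S n))).
      { apply Rmult_le_compat_r; [apply Rlt_le, Hp | apply Hw]. }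
      lra. }
  apply Rmult_le_reg_r with (t O); [apply Hp | lra].
Qed.

(* [logderiv a n] is the coefficient of [z^n] in [A'/A], where [A = sum a_n z^n]. *)
Definition logderiv (a : nat -> R) : nat -> R :=
  rec_seq (a 1%nat / a O)
    (fun f m => (INR (m + 2) * a (m + 2)%nat - rsum (fun k => f k * a (S m - k)%nat) (S m)) / a O).

Lemma logderiv_spec (a : nat -> R) (n : nat) :
  0 < a O -> INR (S n) * a (S n) = conv (logderiv a) a n.
Proof.
  intros Ha; destruct n as [ | n].
  - unfold conv, logderiv, rec_seq; simpl; field; lra.
  - unfold conv; cbn [rsum]; rewrite Nat.sub_diag.
    unfold logderiv at 3; rewrite rec_seq_S.
    + fold (logderiv a); cbn [rsum]; replace (n + 2)%nat with (S (S n)) by lia; field; lra.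
    + intros f f' H; do 2 f_equal; apply rsum_ext; intros k Hk; rewrite H by lia; reflexivity.
Qed.

(* The coefficients of [A^lam]. *)
Definition powcoef (a : nat -> R) (lam : R) : nat -> R :=
  rec_seq (exp (lam * ln (a O)))
    (fun f m => lam / INR (S m) * conv (logderiv a) f m).

Lemma INR_S_neq0 (n : nat) : INR (S n) <> 0.
Proof. apply not_0_INR; lia. Qed.

Lemma INR_S_pos (n : nat) : 0 < INR (S n).
Proof. apply lt_0_INR; lia. Qed.

Lemma powcoef_0 (a : nat -> R) (lam : R) : powcoef a lam O = exp (lam * ln (a O)).
Proof. reflexivity. Qed.

(** Coefficientwise form of the differential equation [F' = lam (A'/A) F], which together with the
    constant term characterizes [F = A^lam]. *)
Lemma powcoef_S (a : nat -> R) (lam : R) (n : nat) :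
  INR (S n) * powcoef a lam (S n) = lam * conv (logderiv a) (powcoef a lam) n.
Proof.
  unfold powcoef at 1; rewrite rec_seq_S.
  - fold (powcoef a lam); field; apply INR_S_neq0.
  - intros f f' H; f_equal; apply conv_ext; auto.
Qed.

Lemma powcoef_unique (a : nat -> R) (lam : R) (f : nat -> R) :
  f O = exp (lam * ln (a O)) ->
  (forall n, INR (S n) * f (S n) = lam * conv (logderiv a) f n) ->
  forall n, f n = powcoef a lam n.
Proof.
  intros H0 HS n; induction n as [n IH] using (well_founded_induction Wf_nat.lt_wf).
  destruct n as [ | n]; [exact H0 | ].
  apply Rmult_eq_reg_l with (INR (S n)); [ | apply INR_S_neq0].
  rewrite HS, powcoef_S; f_equal; apply conv_ext; auto; intros k Hk; apply IH; lia.
Qed.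

(** By the product rule the product of the two series satisfies the differential equation for the
    exponent [l + m], whose solution is determined by its constant term. *)
Lemma powcoef_add (a : nat -> R) (l m : R) (n : nat) :
  powcoef a (l + m) n = conv (powcoef a l) (powcoef a m) n.
Proof.
  symmetry; revert n; apply powcoef_unique.
  - unfold conv; cbn [rsum]; rewrite !powcoef_0, Rmult_plus_distr_r, exp_plus; simpl; ring.
  - intros n; rewrite conv_derivation.
    rewrite conv_shift_l, conv_shift_r; change (INR 0) with 0.
    rewrite (conv_ext (fun k => INR (S k) * powcoef a l (S k))
               (fun k => l * conv (logderiv a) (powcoef a l) k) (powcoef a m) (powcoef a m))
      by (auto; intros; apply powcoef_S).
    rewrite (conv_ext (powcoef a l) (powcoef a l) (fun k => INR (S k) * powcoef a m (S k))
               (fun k => m * conv (logderiv a) (powcoef a m) k))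
      by (auto; intros; apply powcoef_S).
    rewrite conv_scal_l, conv_scal_r.
    rewrite <- (conv_assoc (powcoef a l)).
    rewrite (conv_ext (conv (powcoef a l) (logderiv a)) (conv (logderiv a) (powcoef a l))
               (powcoef a m) (powcoef a m)) by (auto; intros; apply conv_comm).
    rewrite conv_assoc; ring.
Qed.

Lemma powcoef_zero_0 (a : nat -> R) : powcoef a 0 O = 1.
Proof. rewrite powcoef_0, Rmult_0_l; apply exp_0. Qed.

Lemma powcoef_zero_S (a : nat -> R) (n : nat) : powcoef a 0 (S n) = 0.
Proof.
  apply Rmult_eq_reg_l with (INR (S n)); [ | apply INR_S_neq0].
  rewrite powcoef_S; ring.
Qed.

Lemma powcoef_one (a : nat -> R) (n : nat) : 0 < a O -> powcoef a 1 n = a n.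
Proof.
  intros Ha; symmetry; revert n; apply powcoef_unique.
  - now rewrite Rmult_1_l, exp_ln.
  - intros n; now rewrite Rmult_1_l, logderiv_spec.
Qed.

Definition log_convex_law (a : nat -> R) : Prop :=
  (forall n, 0 < a n) /\ (forall n, a (S n) ^ 2 <= a n * a (S (S n))) /\ is_series a 1.

Lemma law_le1 (a : nat -> R) (n : nat) : log_convex_law a -> rsum a n <= 1.
Proof.
  intros [Hp [_ Hs]]; apply rsum_le_series with (2 := Hs); intros; apply Rlt_le, Hp.
Qed.

Lemma logderiv_ge0 (a : nat -> R) (n : nat) : log_convex_law a -> 0 <= logderiv a n.
Proof.
  intros [Hp [Hc _]]; apply (kaluza a (logderiv a) (fun n => INR (S n))); auto.
  - intros k; split; [apply pos_INR | apply le_INR; lia].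
  - intros k; now apply logderiv_spec.
Qed.

Lemma logderiv_le (a : nat -> R) (n : nat) :
  log_convex_law a -> logderiv a n <= INR (S n) / a O.
Proof.
  intros Ha; pose proof Ha as [Hp _].
  apply Rmult_le_reg_r with (a O); [apply Hp | ].
  unfold Rdiv; rewrite Rmult_assoc, Rinv_l by (pose proof (Hp O); lra).
  apply Rle_trans with (INR (S n) * a (S n)).
  - rewrite logderiv_spec by auto; unfold conv; cbn [rsum]; rewrite Nat.sub_diag.
    assert (0 <= rsum (fun k => logderiv a k * a (n - k)%nat) n); [ | lra].
    apply rsum_ge0; intros; apply Rmult_le_pos; [now apply logderiv_ge0 | apply Rlt_le, Hp].
  - apply Rmult_le_compat_l; [apply pos_INR | ].
    apply Rle_trans with (rsum a (S (S n))); [ | now apply law_le1].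
    apply rsum_term_le; [intros; apply Rlt_le, Hp | lia].
Qed.

Lemma powcoef_ge0 (a : nat -> R) (lam : R) (n : nat) :
  log_convex_law a -> 0 <= lam -> 0 <= powcoef a lam n.
Proof.
  intros Ha Hl; induction n as [n IH] using (well_founded_induction Wf_nat.lt_wf).
  destruct n as [ | n]; [rewrite powcoef_0; apply Rlt_le, exp_pos | ].
  apply Rmult_le_reg_l with (INR (S n)); [apply INR_S_pos | ].
  rewrite Rmult_0_r, powcoef_S; apply Rmult_le_pos; auto.
  apply rsum_ge0; intros k Hk; apply Rmult_le_pos; [now apply logderiv_ge0 | apply IH; lia].
Qed.

Lemma powcoef_INR_sum (a : nat -> R) (p n : nat) :
  log_convex_law a -> rsum (powcoef a (INR p)) n <= 1.
Proof.
  intros Ha; revert n; induction p as [ | p IH]; intros n.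
  - destruct n as [ | n]; [simpl; lra | ].
    rewrite rsum_first; simpl INR; rewrite powcoef_zero_0, rsum_eq0; [lra | ].
    intros; apply powcoef_zero_S.
  - rewrite (rsum_ext _ (conv (powcoef a (INR p)) a)).
    + eapply Rle_trans; [apply rsum_conv_le | ].
      * intros; apply powcoef_ge0; auto using pos_INR.
      * intros; apply Rlt_le, Ha.
      * specialize (IH n); pose proof (law_le1 a n Ha).
        assert (0 <= rsum (powcoef a (INR p)) n).
        { apply rsum_ge0; intros; apply powcoef_ge0; auto using pos_INR. }
        assert (0 <= rsum a n) by (apply rsum_ge0; intros; apply Rlt_le, Ha).
        nra.
    + intros k _; rewrite S_INR, powcoef_add; apply conv_ext; auto.
      intros; apply powcoef_one, Ha.
Qed.

(** In [A^p = A^lam A^(p - lam)] with an integer [p > lam] all coefficients are nonnegative, so a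
    coefficient of [A^lam] times the constant term of the last factor is at most a coefficient of
    [A^p], hence at most 1. This crude bound secures convergence in the unit disc before the sharp
    one is available. *)
Lemma powcoef_bounded (a : nat -> R) (lam : R) :
  log_convex_law a -> 0 <= lam -> exists M, forall n, powcoef a lam n <= M.
Proof.
  intros Ha Hl.
  destruct (INR_unbounded lam) as [p Hp].
  set (m := INR p - lam).
  exists (/ exp (m * ln (a O))); intros n.
  assert (He := exp_pos (m * ln (a O))).
  apply Rmult_le_reg_r with (1 := He); rewrite Rinv_l by lra.
  apply Rle_trans with (powcoef a (INR p) n).
  - replace (INR p) with (lam + m) by (unfold m; ring).
    rewrite powcoef_add; unfold conv; cbn [rsum]; rewrite Nat.sub_diag, powcoef_0.
    assert (0 <= rsum (fun k => powcoef a lam k * powcoef a m (n - k)%nat) n); [ | lra].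
    apply rsum_ge0; intros; apply Rmult_le_pos; apply powcoef_ge0; auto; unfold m; lra.
  - apply Rle_trans with (rsum (powcoef a (INR p)) (S n)); [ | now apply powcoef_INR_sum].
    apply rsum_term_le; [intros; apply powcoef_ge0; auto using pos_INR | lia].
Qed.

(** * Generating functions in the unit disc *)

Lemma sum_f_R0_rsum (f : nat -> R) (n : nat) : sum_f_R0 f n = rsum f (S n).
Proof. induction n as [ | n IH]; [simpl; ring | simpl in *; rewrite IH; reflexivity]. Qed.

Lemma Rabs_Re_le_Cmod (z : C) : Rabs (Re z) <= Cmod z.
Proof. eapply Rle_trans; [apply Rmax_l | apply Rmax_Cmod]. Qed.

Lemma Rabs_Im_le_Cmod (z : C) : Rabs (Im z) <= Cmod z.
Proof. eapply Rle_trans; [apply Rmax_r | apply Rmax_Cmod]. Qed.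

(** Meant for [w n] the real or imaginary part of [z ^ n] with [Cmod z < 1]: the power series in a
    real variable [t] then converges beyond [t = 1], so it can be differentiated along the whole
    segment from 0 to [z]. *)
Lemma CV_radius_geom_bound (c w : nat -> R) (M x t : R) :
  (forall n, Rabs (c n) <= M) -> 0 <= x < 1 -> (forall n, Rabs (w n) <= x ^ n) ->
  0 <= t <= 1 -> Rbar_lt (Rabs t) (CV_radius (fun n => c n * w n)).
Proof.
  intros Hc Hx Hw Ht.
  set (y := (1 + x) / 2).
  assert (Hy : 0 < y < 1) by (unfold y; lra).
  apply Rbar_lt_le_trans with (Finite (/ y)).
  - simpl; rewrite Rabs_pos_eq by lra.
    apply Rle_lt_trans with (/ 1); [rewrite Rinv_1; lra | ].
    apply Rinv_lt_contravar; lra.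
  - apply (proj1 (CV_radius_bounded (fun n => c n * w n))).
    exists M; intros n.
    rewrite !Rabs_mult, Rmult_assoc.
    rewrite <- (Rmult_1_r M); apply Rmult_le_compat; auto using Rabs_pos.
    + apply Rmult_le_pos; apply Rabs_pos.
    + rewrite (Rabs_pos_eq ((/ y) ^ n)) by (apply pow_le, Rlt_le, Rinv_0_lt_compat; lra).
      rewrite pow_inv.
      apply Rmult_le_reg_r with (y ^ n); [apply pow_lt; lra | ].
      rewrite Rmult_assoc, Rinv_l, Rmult_1_l, Rmult_1_r by (apply pow_nonzero; lra).
      eapply Rle_trans; [apply Hw | apply pow_incr; unfold y; lra].
Qed.

Definition logcoef (a : nat -> R) (n : nat) : R :=
  match n with O => ln (a O) | S m => logderiv a m / INR (S m) end.

Lemma logcoef_bounded (a : nat -> R) :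
  log_convex_law a -> exists M, forall n, Rabs (logcoef a n) <= M.
Proof.
  intros Ha; pose proof (proj1 Ha O) as H0.
  exists (Rmax (Rabs (ln (a O))) (/ a O)); intros [ | n].
  - apply Rmax_l.
  - eapply Rle_trans; [ | apply Rmax_r]; cbn [logcoef].
    pose proof (INR_S_pos n).
    rewrite Rabs_pos_eq.
    + apply Rmult_le_reg_r with (INR (S n)); [auto | ].
      unfold Rdiv; rewrite Rmult_assoc, Rinv_l by lra.
      pose proof (logderiv_le a n Ha); unfold Rdiv in *; lra.
    + apply Rmult_le_pos; [now apply logderiv_ge0 | apply Rlt_le, Rinv_0_lt_compat; auto].
Qed.

(* The branch of [log A] on the unit disc that is real at 0. *)
Definition logfun (a : nat -> R) (z : C) : C :=
  (Series (fun n => logcoef a n * Re (z ^ n)), Series (fun n => logcoef a n * Im (z ^ n))).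

Definition Cexp (z : C) : C := (exp (Re z) * cos (Im z), exp (Re z) * sin (Im z)).

Lemma Re_Cmult (z w : C) : Re (z * w) = Re z * Re w - Im z * Im w.
Proof. reflexivity. Qed.

Lemma Im_Cmult (z w : C) : Im (z * w) = Re z * Im w + Im z * Re w.
Proof. reflexivity. Qed.

Lemma rotation_invariant_eq (x y c s u v : R) :
  c * c + s * s = 1 -> x * c + y * s = u -> y * c - x * s = v ->
  x = u * c - v * s /\ y = u * s + v * c.
Proof.
  intros H <- <-; split.
  - transitivity (x * (c * c + s * s)); [rewrite H; ring | ring].
  - transitivity (y * (c * c + s * s)); [rewrite H; ring | ring].
Qed.

(** On the segment [t z] with [0 <= t <= 1], the series [F] of [A^lam] and [B] of [log A] become
    pairs of real power series in [t]. The recurrence for [powcoef] says [F' = lam B' F], so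
    [exp (- lam B) F] is constant there, and it equals 1 at [t = 0]. *)
Lemma powcoef_gf (a : nat -> R) (lam : R) (z : C) :
  log_convex_law a -> 0 <= lam -> Cmod z < 1 ->
  is_series (fun n => powcoef a lam n * Re (z ^ n)) (Re (Cexp (lam * logfun a z))) /\
  is_series (fun n => powcoef a lam n * Im (z ^ n)) (Im (Cexp (lam * logfun a z))).
Proof.
  intros Ha Hl Hz.
  destruct (powcoef_bounded a lam Ha Hl) as [Mq Hq].
  assert (Hq' : forall n, Rabs (powcoef a lam n) <= Mq)
    by (intros n; rewrite Rabs_pos_eq; auto; now apply powcoef_ge0).
  destruct (logcoef_bounded a Ha) as [Mb Hb].
  set (p := fun n => Re (z ^ n)); set (r := fun n => Im (z ^ n)).
  assert (Hp : forall n, Rabs (p n) <= Cmod z ^ n)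
    by (intros n; rewrite <- Cmod_pow; apply Rabs_Re_le_Cmod).
  assert (Hr : forall n, Rabs (r n) <= Cmod z ^ n)
    by (intros n; rewrite <- Cmod_pow; apply Rabs_Im_le_Cmod).
  assert (Hx : 0 <= Cmod z < 1) by (split; [apply Cmod_ge_0 | auto]).
  set (f1 := fun n => powcoef a lam n * p n); set (f2 := fun n => powcoef a lam n * r n).
  set (b1 := fun n => logcoef a n * p n); set (b2 := fun n => logcoef a n * r n).
  assert (Cf1 : forall t, 0 <= t <= 1 -> Rbar_lt (Rabs t) (CV_radius f1))
    by (intros; eapply CV_radius_geom_bound; eauto).
  assert (Cf2 : forall t, 0 <= t <= 1 -> Rbar_lt (Rabs t) (CV_radius f2))
    by (intros; eapply CV_radius_geom_bound; eauto).
  assert (Cb1 : forall t, 0 <= t <= 1 -> Rbar_lt (Rabs t) (CV_radius b1))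
    by (intros; eapply CV_radius_geom_bound; eauto).
  assert (Cb2 : forall t, 0 <= t <= 1 -> Rbar_lt (Rabs t) (CV_radius b2))
    by (intros; eapply CV_radius_geom_bound; eauto).
  assert (Hb' : forall (w : nat -> R) n,
    PS_derive (fun n => logcoef a n * w n) n = logderiv a n * w (S n)).
  { intros w n; unfold PS_derive; cbn [logcoef]; field; apply INR_S_neq0. }
  assert (Hadd : forall k n, (k <= n)%nat -> (z ^ S n = z ^ S k * z ^ (n - k))%C).
  { intros k n Hk; rewrite <- Cpow_add_r; f_equal; lia. }
  assert (Df1 : forall n, PS_derive f1 n =
    lam * (PS_mult (PS_derive b1) f1 n - PS_mult (PS_derive b2) f2 n)).
  { intros n; unfold PS_derive at 1, f1 at 1; rewrite <- Rmult_assoc, powcoef_S.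
    unfold PS_mult; rewrite !sum_f_R0_rsum, <- rsum_minus; unfold conv.
    rewrite Rmult_assoc; f_equal; rewrite <- rsum_scal_r; apply rsum_ext; intros k Hk.
    unfold b1, b2; rewrite !Hb'; unfold f1, f2, p, r.
    rewrite (Hadd k n), Re_Cmult by lia; ring. }
  assert (Df2 : forall n, PS_derive f2 n =
    lam * (PS_mult (PS_derive b1) f2 n + PS_mult (PS_derive b2) f1 n)).
  { intros n; unfold PS_derive at 1, f2 at 1; rewrite <- Rmult_assoc, powcoef_S.
    unfold PS_mult; rewrite !sum_f_R0_rsum, <- rsum_plus; unfold conv.
    rewrite Rmult_assoc; f_equal; rewrite <- rsum_scal_r; apply rsum_ext; intros k Hk.
    unfold b1, b2; rewrite !Hb'; unfold f1, f2, p, r.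
    rewrite (Hadd k n), Im_Cmult by lia; ring. }
  set (B1 := PSeries b1); set (B2 := PSeries b2).
  set (F1 := PSeries f1); set (F2 := PSeries f2).
  set (G1 := PSeries (PS_derive b1)); set (G2 := PSeries (PS_derive b2)).
  assert (dB1 : forall t, 0 <= t <= 1 -> is_derive B1 t (G1 t))
    by (intros; apply is_derive_PSeries; auto).
  assert (dB2 : forall t, 0 <= t <= 1 -> is_derive B2 t (G2 t))
    by (intros; apply is_derive_PSeries; auto).
  assert (dF1 : forall t, 0 <= t <= 1 ->
    is_derive F1 t (lam * (G1 t * F1 t - G2 t * F2 t))).
  { intros t Ht; replace (lam * (G1 t * F1 t - G2 t * F2 t)) with (PSeries (PS_derive f1) t);
      [apply is_derive_PSeries; auto | ].
    rewrite (PSeries_ext _ _ t Df1).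
    transitivity (PSeries (PS_scal lam (PS_minus (PS_mult (PS_derive b1) f1)
      (PS_mult (PS_derive b2) f2))) t); [apply PSeries_ext; reflexivity | ].
    rewrite PSeries_scal, PSeries_minus;
      [rewrite !PSeries_mult; try reflexivity | apply ex_pseries_mult | apply ex_pseries_mult];
      rewrite ?CV_radius_derive; auto. }
  assert (dF2 : forall t, 0 <= t <= 1 ->
    is_derive F2 t (lam * (G1 t * F2 t + G2 t * F1 t))).
  { intros t Ht; replace (lam * (G1 t * F2 t + G2 t * F1 t)) with (PSeries (PS_derive f2) t);
      [apply is_derive_PSeries; auto | ].
    rewrite (PSeries_ext _ _ t Df2).
    transitivity (PSeries (PS_scal lam (PS_plus (PS_mult (PS_derive b1) f2)
      (PS_mult (PS_derive b2) f1))) t); [apply PSeries_ext; reflexivity | ].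
    rewrite PSeries_scal, PSeries_plus;
      [rewrite !PSeries_mult; try reflexivity | apply ex_pseries_mult | apply ex_pseries_mult];
      rewrite ?CV_radius_derive; auto. }
  (* Real and imaginary parts of [exp (- lam B) F]. *)
  set (W1 := fun t => exp (- lam * B1 t) * (F1 t * cos (lam * B2 t) + F2 t * sin (lam * B2 t))).
  set (W2 := fun t => exp (- lam * B1 t) * (F2 t * cos (lam * B2 t) - F1 t * sin (lam * B2 t))).
  assert (ex : forall (f : R -> R) t l, is_derive f t l -> ex_derive f t)
    by (intros f t l H; now exists l).
  assert (E1 : W1 0 = W1 1).
  { apply eq_is_derive; [ | lra]; intros t Ht; unfold W1.
    auto_derive; [repeat split; eauto | ].
    rewrite (is_derive_unique (fun x : R => B1 x) _ _ (dB1 t Ht)),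
      (is_derive_unique (fun x : R => B2 x) _ _ (dB2 t Ht)),
      (is_derive_unique (fun x : R => F1 x) _ _ (dF1 t Ht)),
      (is_derive_unique (fun x : R => F2 x) _ _ (dF2 t Ht)).
    unfold zero; simpl; ring. }
  assert (E2 : W2 0 = W2 1).
  { apply eq_is_derive; [ | lra]; intros t Ht; unfold W2.
    auto_derive; [repeat split; eauto | ].
    rewrite (is_derive_unique (fun x : R => B1 x) _ _ (dB1 t Ht)),
      (is_derive_unique (fun x : R => B2 x) _ _ (dB2 t Ht)),
      (is_derive_unique (fun x : R => F1 x) _ _ (dF1 t Ht)),
      (is_derive_unique (fun x : R => F2 x) _ _ (dF2 t Ht)).
    unfold zero; simpl; ring. }
  assert (V : F1 0 = exp (lam * ln (a O)) /\ F2 0 = 0 /\ B1 0 = ln (a O) /\ B2 0 = 0).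
  { unfold F1, F2, B1, B2; rewrite !PSeries_0; unfold f1, f2, b1, b2, p, r; simpl.
    rewrite powcoef_0; repeat split; ring. }
  destruct V as (V1 & V2 & V3 & V4).
  assert (W10 : W1 0 = 1).
  { unfold W1; rewrite V1, V2, V3, V4, Rmult_0_r, cos_0, Rmult_1_r, Rmult_0_l, Rplus_0_r.
    rewrite <- exp_plus, <- exp_0; f_equal; ring. }
  assert (W20 : W2 0 = 0) by (unfold W2; rewrite V2, V4, Rmult_0_r, sin_0; ring).
  rewrite W10 in E1; rewrite W20 in E2; unfold W1 in E1; unfold W2 in E2.
  assert (Hexp : exp (lam * B1 1) * exp (- lam * B1 1) = 1).
  { rewrite <- exp_plus, <- exp_0; f_equal; ring. }
  assert (cancel : forall X u, exp (- lam * B1 1) * X = u -> exp (lam * B1 1) * u = X).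
  { intros X u <-; rewrite <- Rmult_assoc, Hexp; ring. }
  destruct (rotation_invariant_eq (F1 1) (F2 1) (cos (lam * B2 1)) (sin (lam * B2 1))
              (exp (lam * B1 1) * 1) (exp (lam * B1 1) * 0)) as [HF1 HF2].
  - pose proof (sin2_cos2 (lam * B2 1)) as H; unfold Rsqr in H; lra.
  - symmetry; apply cancel; symmetry; exact E1.
  - symmetry; apply cancel; symmetry; exact E2.
  - assert (HX : Re (lam * logfun a z) = lam * B1 1).
    { rewrite Re_Cmult; simpl; unfold B1; rewrite PSeries_1; unfold b1, p; ring. }
    assert (HY : Im (lam * logfun a z) = lam * B2 1).
    { rewrite Im_Cmult; simpl; unfold B2; rewrite PSeries_1; unfold b2, r; ring. }
    unfold Cexp; rewrite HX, HY; simpl.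
    assert (H1 : 0 <= 1 <= 1) by lra.
    split.
    + replace (exp _ * cos _) with (Series f1).
      * apply Series_correct, (ex_series_R_ext (fun n => f1 n * 1 ^ n)).
        { intros n; rewrite pow1; apply Rmult_1_r. }
        apply ex_pseries_R, CV_radius_inside; auto.
      * rewrite <- PSeries_1; fold F1; lra.
    + replace (exp _ * sin _) with (Series f2).
      * apply Series_correct, (ex_series_R_ext (fun n => f2 n * 1 ^ n)).
        { intros n; rewrite pow1; apply Rmult_1_r. }
        apply ex_pseries_R, CV_radius_inside; auto.
      * rewrite <- PSeries_1; fold F2; lra.
Qed.

(** * Renewal sequences *)

Lemma exp_le_compat (x y : R) : x <= y -> exp x <= exp y.
Proof. intros [H | ->]; [now apply Rlt_le, exp_increasing | apply Rle_refl]. Qed.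

Definition gf (a : nat -> R) (x : R) : R := Series (fun n => a n * x ^ n).

Lemma Cmod_RtoC_lt1 (x : R) : 0 <= x < 1 -> Cmod (RtoC x) < 1.
Proof. intros H; rewrite Cmod_R, Rabs_pos_eq; lra. Qed.

Lemma powcoef_gf_real (a : nat -> R) (lam x : R) :
  log_convex_law a -> 0 <= lam -> 0 <= x < 1 ->
  is_series (fun n => powcoef a lam n * x ^ n) (exp (lam * Re (logfun a x))) /\
  exp (Re (logfun a x)) = gf a x.
Proof.
  intros Ha Hl Hx; pose proof (Cmod_RtoC_lt1 x Hx) as Hx'.
  assert (HY : Im (logfun a x) = 0).
  { simpl; rewrite (Series_ext _ (fun _ => 0 * 0)).
    - rewrite Series_scal_l; ring.
    - intros n; rewrite <- RtoC_pow; simpl; ring. }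
  assert (Hgen : forall l, 0 <= l ->
    is_series (fun n => powcoef a l n * x ^ n) (exp (l * Re (logfun a x)))).
  { intros l Hl'.
    pose proof (proj1 (powcoef_gf a l x Ha Hl' Hx')) as H.
    replace (Re (Cexp (l * logfun a x))) with (exp (l * Re (logfun a x))) in H.
    - revert H; apply is_series_ext; intros n; rewrite <- RtoC_pow; reflexivity.
    - unfold Cexp; rewrite Im_Cmult, Re_Cmult, HY; simpl.
      replace (l * 0 + 0 * _) with 0 by ring; rewrite cos_0, Rmult_1_r; f_equal; ring. }
  split; [now apply Hgen | ].
  symmetry; apply is_series_unique.
  specialize (Hgen 1 Rle_0_1); rewrite Rmult_1_l in Hgen.
  revert Hgen; apply is_series_ext; intros n; rewrite powcoef_one; [reflexivity | apply Ha].
Qed.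

Lemma ex_series_law_gf (a : nat -> R) (x : R) :
  log_convex_law a -> 0 <= x < 1 -> is_series (fun n => a n * x ^ n) (gf a x).
Proof.
  intros Ha Hx; apply Series_correct.
  destruct (powcoef_gf_real a 1 x Ha Rle_0_1 Hx) as [H _].
  exists (exp (1 * Re (logfun a x))); revert H; apply is_series_ext; intros n.
  rewrite powcoef_one; [reflexivity | apply Ha].
Qed.

Lemma gf_bounds (a : nat -> R) (x : R) : log_convex_law a -> 0 <= x < 1 -> 0 < gf a x <= 1.
Proof.
  intros Ha Hx; split.
  - rewrite <- (proj2 (powcoef_gf_real a 0 x Ha (Rle_refl 0) Hx)); apply exp_pos.
  - pose proof (ex_series_law_gf a x Ha Hx) as H; apply is_series_rsum in H.
    apply (is_lim_seq_le _ (fun _ => 1) _ 1) with (2 := H); [ | apply is_lim_seq_const].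
    intros n; apply Rle_trans with (rsum a n); [ | now apply law_le1].
    apply rsum_le; intros k _.
    rewrite <- (Rmult_1_r (a k)) at 2; apply Rmult_le_compat_l; [apply Rlt_le, Ha | ].
    rewrite <- (pow1 k); apply pow_incr; lra.
Qed.

(** At [x = 1 - d] the partial sum weighted by [x ^ k] is at most [A(x)^lam], hence at most 1, and
    Bernoulli's inequality [1 - k d <= (1 - d)^k] removes the weights at a cost linear in [d].
    Letting [d] be small excludes a sum above 1. *)
Lemma powcoef_sum_le1 (a : nat -> R) (lam : R) (n : nat) :
  log_convex_law a -> 0 <= lam -> rsum (powcoef a lam) n <= 1.
Proof.
  intros Ha Hl; set (S := rsum (powcoef a lam) n).
  assert (HS : 0 <= S) by (apply rsum_ge0; intros; now apply powcoef_ge0).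
  assert (H : forall d, 0 < d <= 1 -> S <= 1 + d * (INR n * S)).
  { intros d Hd.
    assert (Hx : 0 <= 1 - d < 1) by lra.
    destruct (powcoef_gf_real a lam (1 - d) Ha Hl Hx) as [Hs Hg].
    pose proof (gf_bounds a (1 - d) Ha Hx) as [Hg0 Hg1].
    assert (Hle : exp (lam * Re (logfun a (RtoC (1 - d)))) <= 1).
    { apply Rle_trans with (exp 0); [apply exp_le_compat | rewrite exp_0; lra].
      set (L := Re (logfun a (RtoC (1 - d)))) in *.
      rewrite <- (Rmult_0_r lam); apply Rmult_le_compat_l; auto.
      destruct (Rle_or_lt L 0) as [ | Hc]; auto.
      apply exp_increasing in Hc; rewrite exp_0 in Hc; lra. }
    assert (H1 : rsum (fun k => powcoef a lam k * (1 - d) ^ k) n <= 1).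
    { eapply Rle_trans; [ | exact Hle].
      apply rsum_le_series; auto; intros k; apply Rmult_le_pos;
        [now apply powcoef_ge0 | apply pow_le; lra]. }
    assert (H2 : (1 - INR n * d) * S <= 1); [ | lra].
    apply Rle_trans with (2 := H1); unfold S; rewrite <- rsum_scal.
    apply rsum_le; intros k Hk; rewrite Rmult_comm.
    apply Rmult_le_compat_l; [now apply powcoef_ge0 | ].
    apply Rle_trans with (1 - INR k * d).
    - assert (INR k <= INR n) by (apply le_INR; lia); nra.
    - clear - Hd; induction k as [ | k IH]; [simpl; lra | ].
      rewrite S_INR; simpl pow; pose proof (pos_INR k).
      destruct (Rle_or_lt (1 - INR k * d) 0).
      + assert (0 <= (1 - d) * (1 - d) ^ k)
          by (apply Rmult_le_pos; [ | apply pow_le]; lra); nra.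
      + assert ((1 - d) * (1 - INR k * d) <= (1 - d) * (1 - d) ^ k)
          by (apply Rmult_le_compat_l; lra); nra. }
  apply Rnot_lt_le; intros Hlt.
  set (D := INR n * S) in *; assert (HD : 0 <= D) by (apply Rmult_le_pos; auto using pos_INR).
  (* Small enough that the cost [d * D] is at most half of [S - 1]. *)
  set (d := Rmin 1 ((S - 1) / (2 * (D + 1)))).
  assert (Hd0 : 0 < (S - 1) / (2 * (D + 1))) by (apply Rdiv_lt_0_compat; lra).
  assert (Hd : 0 < d <= 1) by (unfold d; split; [apply Rmin_glb_lt; lra | apply Rmin_l]).
  specialize (H d Hd).
  assert (d * (2 * (D + 1)) <= S - 1).
  { apply Rle_trans with ((S - 1) / (2 * (D + 1)) * (2 * (D + 1))).
    - apply Rmult_le_compat_r; [lra | apply Rmin_r].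
    - apply Req_le; field; lra. }
  nra.
Qed.

(* For integer [lam] and the random walk whose step is [n] with probability [a (n - 1)], the
   expected number of visits to [J + lam] at times [>= lam]. *)
Definition visits (a : nat -> R) (lam : R) (J : nat) : R :=
  rsum (fun j => powcoef a (lam + INR j) (J - j)) (S J).

Lemma visits_ge0 (a : nat -> R) (lam : R) (J : nat) :
  log_convex_law a -> 0 <= lam -> 0 <= visits a lam J.
Proof.
  intros; apply rsum_ge0; intros k _; apply powcoef_ge0; auto; pose proof (pos_INR k); lra.
Qed.

(** Conditioning on the displacement during the first [l] units of time. Since displacement
    probabilities sum to at most one, a uniform bound on [visits a m] persists at all later
    times. *)
Lemma visits_add (a : nat -> R) (l m : R) (J : nat) :
  visits a (l + m) J = conv (powcoef a l) (visits a m) J.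
Proof.
  unfold visits, conv.
  rewrite (rsum_ext _ (fun j => rsum (fun i =>
    (fun j i => powcoef a l i * powcoef a (m + INR j) (J - j - i)) j i) (S (J - j)))).
  - rewrite rsum_triangle_sym; apply rsum_ext; intros i Hi.
    rewrite <- rsum_scal; apply rsum_ext; intros j Hj.
    replace (J - j - i)%nat with (J - i - j)%nat by lia; reflexivity.
  - intros j Hj; rewrite Rplus_assoc, powcoef_add; reflexivity.
Qed.

Lemma visits_add_le (a : nat -> R) (l m M : R) (J : nat) :
  log_convex_law a -> 0 <= l -> 0 <= m -> (forall i, visits a m i <= M) ->
  visits a (l + m) J <= M.
Proof.
  intros Ha Hl Hm HM; rewrite visits_add; unfold conv.
  assert (0 <= M) by (eapply Rle_trans; [apply (visits_ge0 a m 0) | apply HM]; auto).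
  apply Rle_trans with (rsum (fun k => powcoef a l k * M) (S J)).
  - apply rsum_le; intros k _; apply Rmult_le_compat_l; auto; now apply powcoef_ge0.
  - rewrite rsum_scal_r; pose proof (powcoef_sum_le1 a l (S J) Ha Hl).
    nra.
Qed.

Lemma visits_step (a : nat -> R) (lam : R) (J : nat) :
  visits a lam (S J) = powcoef a lam (S J) + visits a (lam + 1) J.
Proof.
  unfold visits at 1; rewrite rsum_first; f_equal.
  - f_equal; simpl; ring.
  - apply rsum_ext; intros k _; rewrite S_INR; f_equal; ring.
Qed.

(** The classical renewal sequence for the step [k + 1] of probability [a k]: steps are positive, so
    the expected number of visits to a point is the probability of visiting it. *)
Definition renewal (a : nat -> R) : nat -> R := visits a 0.

Lemma renewal_0 (a : nat -> R) : renewal a 0 = 1.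
Proof. unfold renewal, visits; simpl; rewrite Rplus_0_r, powcoef_zero_0; ring. Qed.

Lemma renewal_S (a : nat -> R) (n : nat) :
  0 < a O -> renewal a (S n) = conv a (renewal a) n.
Proof.
  intros Ha; unfold renewal at 1; rewrite visits_step, powcoef_zero_S, Rplus_0_l, Rplus_comm.
  rewrite visits_add; apply conv_ext; auto; intros; now apply powcoef_one.
Qed.

(** The visits to [J + p] at times at least [p] are among all visits to [J + p]. *)
Lemma visits_INR_le (a : nat -> R) (p J : nat) :
  log_convex_law a -> visits a (INR p) J <= renewal a (J + p).
Proof.
  intros Ha; revert J; induction p as [ | p IH]; intros J.
  - rewrite Nat.add_0_r; apply Rle_refl.
  - rewrite S_INR.
    apply Rle_trans with (visits a (INR p) (S J)).
    + rewrite visits_step; pose proof (powcoef_ge0 a (INR p) (S J) Ha (pos_INR p)); lra.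
    + replace (J + S p)%nat with (S J + p)%nat by lia; apply IH.
Qed.

Definition tail (a : nat -> R) (n : nat) : R := 1 - rsum a n.

Definition log_convex_tail (a : nat -> R) : Prop :=
  (forall n, 0 < tail a n) /\ (forall n, tail a (S n) ^ 2 <= tail a n * tail a (S (S n))).

Lemma tail_0 (a : nat -> R) : tail a O = 1.
Proof. unfold tail; simpl; ring. Qed.

Lemma tail_S (a : nat -> R) (n : nat) : tail a (S n) = tail a n - a n.
Proof. unfold tail; simpl; ring. Qed.

Lemma conv_minus_l (f g h : nat -> R) (n : nat) :
  conv (fun k => f k - g k) h n = conv f h n - conv g h n.
Proof. unfold conv; rewrite <- rsum_minus; apply rsum_ext; intros; ring. Qed.

(** Exactly one visited point is the last one not beyond [n]. If it is [k], the next step exceeds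
    [n - k], an event of probability [tail a (n - k)]. *)
Lemma renewal_tail (a : nat -> R) (n : nat) :
  0 < a O -> conv (renewal a) (tail a) n = 1.
Proof.
  intros Ha; induction n as [ | n IH].
  - unfold conv; cbn [rsum]; rewrite renewal_0, tail_0; ring.
  - rewrite conv_shift_r, tail_0, conv_comm.
    rewrite (conv_ext _ (fun k => tail a k - a k) (renewal a) (renewal a))
      by (auto; intros; apply tail_S).
    rewrite conv_minus_l, <- renewal_S, (conv_comm (tail a)), IH by auto; ring.
Qed.

(** Comparing [renewal_tail] at [n] and [n + 1] shows that the successive differences [v] satisfy
    [tail a (S n) = conv v (tail a) n], which is the system of [kaluza] with [c = 1]. *)
Lemma renewal_decreasing (a : nat -> R) (n : nat) :
  0 < a O -> log_convex_tail a -> renewal a (S n) <= renewal a n.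
Proof.
  intros Ha [Ht Hc].
  enough (0 <= renewal a n - renewal a (S n)) by lra.
  apply (kaluza (tail a) (fun k => renewal a k - renewal a (S k)) (fun _ => 1)); auto.
  - intros; lra.
  - intros k; rewrite conv_minus_l, renewal_tail by auto.
    pose proof (renewal_tail a (S k) Ha) as H; rewrite conv_shift_l, renewal_0 in H; lra.
Qed.

Lemma renewal_antitone (a : nat -> R) (m n : nat) :
  0 < a O -> log_convex_tail a -> (m <= n)%nat -> renewal a n <= renewal a m.
Proof.
  intros Ha Ht H; induction H as [ | n H IH]; [lra | ].
  eapply Rle_trans; [now apply renewal_decreasing | exact IH].
Qed.

(** In [renewal_tail] every renewal term is at least the last one. The sum of tails is the mean step
    truncated at [n + 1]. *)
Lemma renewal_le (a : nat -> R) (n : nat) :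
  0 < a O -> log_convex_tail a -> renewal a n * rsum (tail a) (S n) <= 1.
Proof.
  intros Ha Ht; rewrite <- (renewal_tail a n Ha), <- rsum_scal; rewrite conv_comm.
  apply rsum_le; intros k Hk; rewrite (Rmult_comm (tail a k)).
  apply Rmult_le_compat_r; [apply Rlt_le, Ht | apply renewal_antitone; auto; lia].
Qed.

(** Exponential Markov inequality for small displacements: [x ^ J <= x ^ k] as long as [k <= J]. *)
Lemma powcoef_chernoff (a : nat -> R) (lam x : R) (J : nat) :
  log_convex_law a -> 0 <= lam -> 0 < x < 1 ->
  x ^ J * rsum (powcoef a lam) (S J) <= exp (lam * ln (gf a x)).
Proof.
  intros Ha Hl Hx; assert (Hx' : 0 <= x < 1) by lra.
  destruct (powcoef_gf_real a lam x Ha Hl Hx') as [Hs Hg].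
  rewrite <- Hg, ln_exp.
  eapply Rle_trans; [ | apply rsum_le_series with (n := S J) (2 := Hs)].
  - rewrite <- rsum_scal; apply rsum_le; intros k Hk; rewrite Rmult_comm.
    apply Rmult_le_compat_l; [now apply powcoef_ge0 | ].
    replace J with (k + (J - k))%nat by lia; rewrite pow_add.
    rewrite <- (Rmult_1_r (x ^ k)) at 2; apply Rmult_le_compat_l; [apply pow_le; lra | ].
    rewrite <- (pow1 (J - k)); apply pow_incr; lra.
  - intros n; apply Rmult_le_pos; [now apply powcoef_ge0 | apply pow_le; lra].
Qed.

(** * The law attached to a dyadic scale *)

Lemma INR_pow2 (j : nat) : INR (2 ^ j) = 2 ^ j.
Proof. rewrite pow_INR; f_equal; simpl; ring. Qed.

Lemma rsum_geom (x : R) (n : nat) : rsum (fun i => x ^ i) n * (1 - x) = 1 - x ^ n.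
Proof.
  induction n as [ | n IH]; [simpl; ring | simpl rsum; rewrite Rmult_plus_distr_r, IH; simpl; ring].
Qed.

Lemma pow_one_minus_le (s : R) (n : nat) :
  0 <= s <= 1 -> (1 - s) ^ n * (1 + INR n * s) <= 1.
Proof.
  intros Hs; induction n as [ | n IH]; [simpl; lra | ].
  apply Rle_trans with (2 := IH); rewrite S_INR; simpl pow.
  rewrite (Rmult_comm (1 - s)), Rmult_assoc; apply Rmult_le_compat_l; [apply pow_le; lra | ].
  pose proof (pos_INR n); nra.
Qed.

(** Within [/ s] terms the geometric series reaches half of its limit [/ s], since
    [(1 - s) ^ n <= / (1 + n s) <= / 2]. *)
Lemma rsum_geom_ge (s : R) (n : nat) :
  0 < s <= 1 -> 1 <= INR n * s -> / 2 / s <= rsum (fun i => (1 - s) ^ i) n.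
Proof.
  intros Hs Hn; assert (Hs' : 0 <= s <= 1) by lra.
  pose proof (pow_one_minus_le s n Hs'); pose proof (rsum_geom (1 - s) n) as HG.
  replace (1 - (1 - s)) with s in HG by ring.
  assert (0 <= (1 - s) ^ n) by (apply pow_le; lra).
  apply Rmult_le_reg_r with s; [lra | rewrite HG].
  unfold Rdiv; rewrite Rmult_assoc, Rinv_l by lra; nra.
Qed.

Lemma exp_le_one_minus (s : R) : 0 <= s <= 1 / 2 -> exp (- (2 * s)) <= 1 - s.
Proof.
  intros Hs; rewrite exp_Ropp.
  pose proof (exp_ineq1_le (2 * s)).
  apply Rle_trans with (/ (1 + 2 * s)); [apply Rinv_le_contravar; lra | ].
  apply Rmult_le_reg_r with (1 + 2 * s); [lra | ]; rewrite Rinv_l by lra; nra.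
Qed.

Lemma exp_le_pow_one_minus (s : R) (n : nat) :
  0 <= s <= 1 / 2 -> exp (- (2 * s * INR n)) <= (1 - s) ^ n.
Proof.
  intros Hs; induction n as [ | n IH].
  - simpl; rewrite Rmult_0_r, Ropp_0, exp_0; lra.
  - rewrite S_INR; simpl pow.
    replace (- (2 * s * (INR n + 1))) with (- (2 * s) + - (2 * s * INR n)) by ring.
    rewrite exp_plus; apply Rmult_le_compat; auto using exp_le_one_minus, Rlt_le, exp_pos.
Qed.

Lemma is_lim_seq_rsum (f : nat -> nat -> R) (l : nat -> R) (N : nat) :
  (forall i, is_lim_seq (f i) (l i)) ->
  is_lim_seq (fun K => rsum (fun i => f i K) N) (rsum l N).
Proof.
  intros H; induction N as [ | N IH]; simpl; [apply is_lim_seq_const | ].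
  apply is_lim_seq_plus'; auto.
Qed.

(** * Moment sequences of discrete measures *)

Definition moment (c rho : nat -> R) (n : nat) : R := Series (fun k => c k * rho k ^ n).

Lemma ex_series_moment (c rho : nat -> R) (n : nat) :
  (forall k, 0 <= c k) -> (forall k, 0 < rho k < 1) -> ex_series c ->
  ex_series (fun k => c k * rho k ^ n).
Proof.
  intros Hc Hr Hs; apply ex_series_R_le with (2 := Hs); intros k; split.
  - apply Rmult_le_pos; [auto | apply pow_le, Rlt_le, Hr].
  - rewrite <- (Rmult_1_r (c k)) at 2; apply Rmult_le_compat_l; auto.
    rewrite <- (pow1 n); apply pow_incr; specialize (Hr k); lra.
Qed.

Lemma moment_ge_rsum (c rho : nat -> R) (n m : nat) :
  (forall k, 0 <= c k) -> (forall k, 0 < rho k < 1) -> ex_series c ->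
  rsum (fun k => c k * rho k ^ n) m <= moment c rho n.
Proof.
  intros Hc Hr Hs; apply rsum_le_series.
  - intros k; apply Rmult_le_pos; [auto | apply pow_le, Rlt_le, Hr].
  - now apply Series_correct, ex_series_moment.
Qed.

Lemma moment_pos (c rho : nat -> R) (n : nat) :
  (forall k, 0 <= c k) -> (forall k, 0 < rho k < 1) -> ex_series c -> 0 < c O ->
  0 < moment c rho n.
Proof.
  intros Hc Hr Hs H0; eapply Rlt_le_trans; [ | apply (moment_ge_rsum c rho n 1); auto].
  simpl; rewrite Rplus_0_l; apply Rmult_lt_0_compat; auto; apply pow_lt, Hr.
Qed.

(** Cauchy-Schwarz for the weights [c k * rho k ^ n], in the form that the sum of
    [c k * rho k ^ n * (rho k - y) ^ 2] is nonnegative at its minimizer in [y], the ratio of the two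
    first moments. *)
Lemma moment_log_convex (c rho : nat -> R) (n : nat) :
  (forall k, 0 <= c k) -> (forall k, 0 < rho k < 1) -> ex_series c -> 0 < c O ->
  moment c rho (S n) ^ 2 <= moment c rho n * moment c rho (S (S n)).
Proof.
  intros Hc Hr Hs H0.
  assert (E : forall m, ex_series (fun k => c k * rho k ^ m))
    by (intros; now apply ex_series_moment).
  assert (H : forall y, 2 * y * moment c rho (S n) <=
                        moment c rho (S (S n)) + y ^ 2 * moment c rho n).
  { intros y; unfold moment; rewrite <- !Series_scal_l, <- Series_plus
      by (try apply ex_series_R_scal; auto).
    destruct (Rle_or_lt 0 y) as [Hy | Hy].
    - apply Series_le; [ | apply ex_series_R_plus; [auto | now apply ex_series_R_scal]].
      intros k; pose proof (pow_lt (rho k) n (proj1 (Hr k))).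
      pose proof (Rmult_le_pos _ _ (Hc k) (Rlt_le _ _ H)); simpl.
      split; [repeat apply Rmult_le_pos; auto; try lra; apply Rlt_le, Hr | ].
      pose proof (Rmult_le_pos _ _ H1 (pow2_ge_0 (rho k - y))); nra.
    - apply Rle_trans with 0.
      + rewrite Series_scal_l.
        pose proof (moment_pos c rho (S n) Hc Hr Hs H0); unfold moment in *; nra.
      + rewrite Series_plus, Series_scal_l by (try apply ex_series_R_scal; auto).
        pose proof (moment_pos c rho (S (S n)) Hc Hr Hs H0).
        pose proof (moment_pos c rho n Hc Hr Hs H0).
        pose proof (pow2_ge_0 y); unfold moment in *; nra. }
  pose proof (moment_pos c rho n Hc Hr Hs H0) as Hn.
  specialize (H (moment c rho (S n) / moment c rho n)).
  apply (Rmult_le_compat_l (moment c rho n)) in H; [ | lra].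
  set (A := moment c rho n) in *; set (B := moment c rho (S n)) in *.
  replace (A * (2 * (B / A) * B)) with (2 * B ^ 2) in H by (field; lra).
  replace (A * (moment c rho (S (S n)) + (B / A) ^ 2 * A))
    with (A * moment c rho (S (S n)) + B ^ 2) in H by (field; lra).
  lra.
Qed.

(* The smallness of [H 0] is what lets the Chernoff bound absorb the drift term. *)
Definition dyadic_scale (H : nat -> R) (kap : R) : Prop :=
  0 < kap /\ (forall j, 0 < H j) /\ (forall j, H (S j) <= H j) /\
  (forall j, kap * H j <= H (S j)) /\ H O <= kap * exp (-2) / 8.

Definition node (H : nat -> R) (k : nat) : R := H k / 2 ^ k.

(* With these weights [sum_{k <= j} wt k / node k] telescopes to [/ H j] up to a constant
   factor ([wt_node_sum]). *)
Definition wt_tail (H : nat -> R) (k : nat) : R := (1 - H (S k) / H k) / 2 ^ S k.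

Definition wt (H : nat -> R) (k : nat) : R :=
  match k with O => 1 - Series (wt_tail H) | S m => wt_tail H m end.

(** The geometric law of parameter [node H k] has tail [(1 - node H k) ^ n]. Starting from the tail
    of the mixture makes both the tail and its differences moment sequences, hence log-convex. *)
Definition law_tail (H : nat -> R) : nat -> R := moment (wt H) (fun k => 1 - node H k).

Definition law (H : nat -> R) (n : nat) : R := law_tail H n - law_tail H (S n).

Section Law.

Variables (H : nat -> R) (kap : R).
Hypothesis HH : dyadic_scale H kap.

Lemma scale_kap : 0 < kap.
Proof. apply HH. Qed.

Lemma scale_pos j : 0 < H j.
Proof. apply HH. Qed.

Lemma scale_antitone i j : (i <= j)%nat -> H j <= H i.
Proof.
  intros L; induction L as [ | j L IH]; [lra | ].
  eapply Rle_trans; [apply HH | exact IH].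
Qed.

Lemma scale_kap_le1 : kap <= 1.
Proof.
  destruct HH as (Hk & Hp & Hd & Hl & _).
  specialize (Hp O); specialize (Hd O); specialize (Hl O); nra.
Qed.

Lemma scale_le_eighth j : H j <= 1 / 8.
Proof.
  apply Rle_trans with (H O); [apply scale_antitone; lia | ].
  destruct HH as (Hk & _ & _ & _ & H0); pose proof scale_kap_le1.
  assert (exp (-2) <= 1) by (rewrite <- exp_0; apply exp_le_compat; lra).
  pose proof (exp_pos (-2)); nra.
Qed.

Lemma two_pow_pos k : 0 < 2 ^ k.
Proof. apply pow_lt; lra. Qed.

Lemma two_pow_ge1 k : 1 <= 2 ^ k.
Proof. apply pow_R1_Rle; lra. Qed.

Lemma node_pos k : 0 < node H k.
Proof. apply Rdiv_lt_0_compat; [apply scale_pos | apply two_pow_pos]. Qed.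

Lemma node_le_half k : node H k <= 1 / 2.
Proof.
  unfold node; pose proof (scale_le_eighth k); pose proof (scale_pos k).
  apply Rmult_le_reg_r with (2 ^ k); [apply two_pow_pos | ].
  unfold Rdiv at 1; rewrite Rmult_assoc, Rinv_l by (pose proof (two_pow_pos k); lra).
  pose proof (two_pow_ge1 k); lra.
Qed.

Lemma node_antitone i j : (i <= j)%nat -> node H j <= node H i.
Proof.
  intros L; unfold node; apply Rmult_le_compat.
  - apply Rlt_le, scale_pos.
  - apply Rlt_le, Rinv_0_lt_compat, two_pow_pos.
  - now apply scale_antitone.
  - apply Rinv_le_contravar; [apply two_pow_pos | apply Rle_pow; [lra | auto]].
Qed.

Lemma rho_bounds k : 0 < 1 - node H k < 1.
Proof. pose proof (node_pos k); pose proof (node_le_half k); lra. Qed.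

Lemma wt_tail_bounds k : 0 <= wt_tail H k <= (1 - kap) / 2 ^ S k.
Proof.
  unfold wt_tail; pose proof (scale_pos k) as Hp.
  assert (Hi : 0 <= / 2 ^ S k) by (apply Rlt_le, Rinv_0_lt_compat, two_pow_pos).
  assert (H1 : H (S k) / H k <= 1).
  { apply Rmult_le_reg_r with (H k); [auto | ].
    unfold Rdiv; rewrite Rmult_assoc, Rinv_l by lra.
    pose proof (scale_antitone k (S k) (Nat.le_succ_diag_r k)); lra. }
  assert (H2 : kap <= H (S k) / H k).
  { apply Rmult_le_reg_r with (H k); [auto | ].
    unfold Rdiv; rewrite Rmult_assoc, Rinv_l by lra.
    destruct HH as (_ & _ & _ & Hl & _); specialize (Hl k); lra. }
  split; [apply Rmult_le_pos; lra | apply Rmult_le_compat_r; lra].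
Qed.

Lemma rsum_inv_pow2 K : rsum (fun k => / 2 ^ S k) K = 1 - / 2 ^ K.
Proof.
  induction K as [ | K IH]; [simpl; field | ].
  cbn [rsum]; rewrite IH; simpl; field; pose proof (two_pow_pos K); lra.
Qed.

Lemma wt_tail_series : ex_series (wt_tail H) /\ 0 <= Series (wt_tail H) <= 1 - kap.
Proof.
  apply Series_rsum_le; [apply wt_tail_bounds | intros n].
  apply Rle_trans with ((1 - kap) * rsum (fun k => / 2 ^ S k) n).
  - rewrite <- rsum_scal; apply rsum_le; intros; apply wt_tail_bounds.
  - rewrite rsum_inv_pow2; pose proof (Rinv_0_lt_compat _ (two_pow_pos n)).
    pose proof scale_kap_le1; nra.
Qed.

Lemma wt_0 : kap <= wt H O <= 1.
Proof. pose proof wt_tail_series; simpl; lra. Qed.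

Lemma wt_ge0 k : 0 <= wt H k.
Proof.
  destruct k as [ | k]; [pose proof wt_0; pose proof scale_kap; lra | apply wt_tail_bounds].
Qed.

Lemma wt_S_le k : wt H (S k) <= / 2 ^ S k.
Proof.
  simpl wt; eapply Rle_trans; [apply wt_tail_bounds | ].
  pose proof (Rinv_0_lt_compat _ (two_pow_pos (S k))); pose proof scale_kap.
  unfold Rdiv; nra.
Qed.

Lemma wt_series : is_series (wt H) 1.
Proof.
  apply is_series_rsum, is_lim_seq_incr_1.
  apply is_lim_seq_ext with (fun n => wt H O + rsum (wt_tail H) n).
  - intros n; now rewrite rsum_first.
  - replace (Finite 1) with (Finite (wt H O + Series (wt_tail H))) by (f_equal; simpl; ring).
    apply is_lim_seq_plus'; [apply is_lim_seq_const | ].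
    apply is_series_rsum, Series_correct, wt_tail_series.
Qed.

Lemma wt_ex_series : ex_series (wt H).
Proof. exists 1; apply wt_series. Qed.

Lemma wt_node_sum j :
  kap / H j <= rsum (fun k => wt H k / node H k) (S j) <= / H j.
Proof.
  (* For [k >= 1] the powers of two in [wt] and [node] cancel and the quotient is
     [/ H k - / H (k - 1)]; only the term at 0 stays outside the telescope. *)
  assert (E : rsum (fun k => wt H k / node H k) (S j) = wt H O / H O + (/ H j - / H O)).
  { induction j as [ | j IH].
    - cbn [rsum]; unfold node; rewrite pow_O; field; pose proof (scale_pos O); lra.
    - cbn [rsum]; cbn [rsum] in IH; rewrite IH; cbn [wt]; unfold wt_tail, node.
      pose proof (scale_pos O); pose proof (scale_pos j); pose proof (scale_pos (S j)).
      pose proof (two_pow_pos (S j)); field; lra. }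
  rewrite E; pose proof wt_0; pose proof scale_kap_le1; pose proof scale_kap.
  pose proof (Rinv_0_lt_compat _ (scale_pos O)).
  pose proof (Rinv_le_contravar _ _ (scale_pos j) (scale_antitone O j (Nat.le_0_l j))).
  unfold Rdiv; split; nra.
Qed.

Lemma law_tail_0 : law_tail H O = 1.
Proof.
  unfold law_tail, moment; apply is_series_unique.
  apply (is_series_ext (wt H)); [intros; simpl; ring | apply wt_series].
Qed.

Lemma law_tail_pos n : 0 < law_tail H n.
Proof.
  apply moment_pos; auto using wt_ge0, rho_bounds, wt_ex_series.
  pose proof wt_0; pose proof scale_kap; lra.
Qed.

Lemma law_moment n :
  law H n = moment (fun k => wt H k * node H k) (fun k => 1 - node H k) n.
Proof.
  unfold law, law_tail, moment; rewrite <- Series_minus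
    by (apply ex_series_moment; auto using wt_ge0, rho_bounds, wt_ex_series).
  apply Series_ext; intros k; simpl; ring.
Qed.

Lemma wt_node_ge0 k : 0 <= wt H k * node H k.
Proof. apply Rmult_le_pos; [apply wt_ge0 | apply Rlt_le, node_pos]. Qed.

Lemma wt_node_ex_series : ex_series (fun k => wt H k * node H k).
Proof.
  apply ex_series_R_le with (2 := wt_ex_series); intros k; split; [apply wt_node_ge0 | ].
  rewrite <- (Rmult_1_r (wt H k)) at 2; apply Rmult_le_compat_l; [apply wt_ge0 | ].
  pose proof (node_le_half k); lra.
Qed.

Lemma wt_node_0 : 0 < wt H O * node H O.
Proof.
  apply Rmult_lt_0_compat; [ | apply node_pos]; pose proof wt_0; pose proof scale_kap; lra.
Qed.

Lemma law_pos n : 0 < law H n.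
Proof.
  rewrite law_moment; apply moment_pos;
    auto using wt_node_ge0, rho_bounds, wt_node_ex_series, wt_node_0.
Qed.

Lemma law_tail_antitone m n : (m <= n)%nat -> law_tail H n <= law_tail H m.
Proof.
  intros L; induction L as [ | n L IH]; [lra | ].
  pose proof (law_pos n); unfold law in *; lra.
Qed.

Lemma tail_law n : tail (law H) n = law_tail H n.
Proof.
  induction n as [ | n IH]; [now rewrite tail_0, law_tail_0 | ].
  rewrite tail_S, IH; unfold law; ring.
Qed.

(** The geometric series of component [k] has ratio at most [1 - node H k] and at most
    [1 - node H j], so it contributes at most [wt H k / node H (min k j)]. The terms [k <= j]
    telescope to at most [/ H j]; the later ones have total weight at most [/ 2 ^ j], and divided by
    [node H j] this is [/ H j] again. *)
Lemma law_tail_gf_le j N :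
  rsum (fun n => law_tail H n * (1 - node H j) ^ n) N <= 2 / H j.
Proof.
  set (x := 1 - node H j); pose proof (rho_bounds j) as Hx; fold x in Hx.
  (* The mixture is cut at [K] components, so that two finite sums are exchanged; [K] tends to
     infinity at the end. *)
  assert (Hsum : forall K, rsum (fun n => rsum (fun k => wt H k * (1 - node H k) ^ n) K * x ^ n) N
                           <= 2 / H j).
  { intros K.
    rewrite (rsum_ext _ (fun n => rsum (fun k => wt H k * ((1 - node H k) * x) ^ n) K)).
    2:{ intros n _; rewrite <- rsum_scal_r; apply rsum_ext; intros k _.
        rewrite Rpow_mult_distr; ring. }
    rewrite rsum_switch.
    assert (Hk : forall k, rsum (fun n => wt H k * ((1 - node H k) * x) ^ n) N
                           <= wt H k / node H (Nat.min k j)).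
    { intros k; rewrite rsum_scal; apply Rmult_le_compat_l; [apply wt_ge0 | ].
      pose proof (rho_bounds k) as Hr; pose proof (node_pos (Nat.min k j)) as Hm.
      apply Rmult_le_reg_r with (node H (Nat.min k j)); [auto | rewrite Rinv_l by lra].
      set (y := (1 - node H k) * x).
      assert (Hy : 0 <= y) by (unfold y; nra).
      apply Rle_trans with (rsum (fun n => y ^ n) N * (1 - y)).
      - apply Rmult_le_compat_l; [apply rsum_ge0; intros; now apply pow_le | ].
        destruct (Nat.min_spec k j) as [[_ ->] | [_ ->]]; unfold y; [nra | ].
        unfold x in *; nra.
      - rewrite rsum_geom; pose proof (pow_le y N Hy); lra. }
    apply Rle_trans with (rsum (fun k => wt H k / node H (Nat.min k j)) K);
      [now apply rsum_le | ].
    assert (Hpos : forall k, 0 <= wt H k / node H (Nat.min k j)).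
    { intros k; apply Rmult_le_pos; [apply wt_ge0 | apply Rlt_le, Rinv_0_lt_compat, node_pos]. }
    apply Rle_trans with (rsum (fun k => wt H k / node H (Nat.min k j)) (S j + K));
      [apply rsum_le_len; auto; lia | ].
    rewrite rsum_split.
    replace (2 / H j) with (/ H j + / H j) by (field; pose proof (scale_pos j); lra).
    apply Rplus_le_compat.
    - eapply Rle_trans; [ | apply wt_node_sum]; apply Req_le, rsum_ext; intros k L.
      now rewrite Nat.min_l by lia.
    - rewrite (rsum_ext _ (fun k => wt H (S (j + k)) * / node H j))
        by (intros k _; rewrite Nat.min_r by lia; reflexivity).
      rewrite rsum_scal_r.
      assert (Hw : rsum (fun k => wt H (S (j + k))) K <= / 2 ^ j).
      { apply Rle_trans with (rsum (fun k => / 2 ^ j * / 2 ^ S k) K).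
        - apply rsum_le; intros k _; eapply Rle_trans; [apply wt_S_le | ].
          replace (S (j + k)) with (j + S k)%nat by lia.
          rewrite pow_add, Rinv_mult; lra.
        - rewrite rsum_scal, rsum_inv_pow2.
          pose proof (Rinv_0_lt_compat _ (two_pow_pos j)).
          pose proof (Rinv_0_lt_compat _ (two_pow_pos K)); nra. }
      apply Rle_trans with (/ 2 ^ j * / node H j).
      + apply Rmult_le_compat_r; auto; apply Rlt_le, Rinv_0_lt_compat, node_pos.
      + unfold node; apply Req_le; field; pose proof (two_pow_pos j); pose proof (scale_pos j); lra. }
  assert (Hlim : is_lim_seq
    (fun K => rsum (fun n => rsum (fun k => wt H k * (1 - node H k) ^ n) K * x ^ n) N)
    (rsum (fun n => law_tail H n * x ^ n) N)).
  { apply (is_lim_seq_rsum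
      (fun n K => rsum (fun k => wt H k * (1 - node H k) ^ n) K * x ^ n)); intros n.
    apply (is_lim_seq_scal_r _ (x ^ n) (law_tail H n)), is_series_rsum, Series_correct.
    apply (ex_series_moment (wt H) (fun k => 1 - node H k));
      auto using wt_ge0, rho_bounds, wt_ex_series. }
  apply (is_lim_seq_le _ (fun _ => 2 / H j) (rsum (fun n => law_tail H n * x ^ n) N) (2 / H j)
           Hsum Hlim (is_lim_seq_const _)).
Qed.

(** Only the components [k <= j] are kept: their parameters are at least [node H j], so [/ node H j]
    terms already collect half of each sum [/ node H k]. *)
Lemma law_tail_sum_ge j N :
  1 <= INR (S N) * node H j -> kap / (2 * H j) <= rsum (law_tail H) (S N).
Proof.
  intros HN.
  apply Rle_trans with (rsum (fun n => rsum (fun k => wt H k * (1 - node H k) ^ n) (S j)) (S N)).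
  2:{ apply rsum_le; intros n _; apply moment_ge_rsum;
        auto using wt_ge0, rho_bounds, wt_ex_series. }
  rewrite rsum_switch.
  apply Rle_trans with (rsum (fun k => / 2 * (wt H k / node H k)) (S j)).
  - rewrite rsum_scal; pose proof (proj1 (wt_node_sum j)).
    replace (kap / (2 * H j)) with (/ 2 * (kap / H j)) by (field; pose proof (scale_pos j); lra).
    lra.
  - apply rsum_le; intros k Hk; rewrite rsum_scal.
    pose proof (node_pos k) as Hn; pose proof (node_le_half k).
    apply Rle_trans with (wt H k * (/ 2 / node H k));
      [apply Req_le; field; lra | apply Rmult_le_compat_l; [apply wt_ge0 | ]].
    apply rsum_geom_ge; [lra | ].
    apply Rle_trans with (1 := HN); apply Rmult_le_compat_l; [apply pos_INR | ].
    apply node_antitone; lia.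
Qed.

(** The tail is antitone, so its value at [n] is at most a weighted average over the first [n]
    indices, with weights of sum at least half of [/ node H j]. The bound shows that the tail tends
    to 0, so that [law] has total mass one. *)
Lemma law_tail_le j n : 1 <= INR n * node H j -> law_tail H n <= 4 / 2 ^ j.
Proof.
  intros Hn; pose proof (law_tail_gf_le j n) as Hg.
  pose proof (node_pos j) as Hs; pose proof (node_le_half j).
  pose proof (scale_pos j); pose proof (two_pow_pos j); pose proof (law_tail_pos n).
  assert (Hl : law_tail H n * rsum (fun i => (1 - node H j) ^ i) n <= 2 / H j).
  { eapply Rle_trans; [ | exact Hg]; rewrite <- rsum_scal; apply rsum_le; intros i Hi.
    apply Rmult_le_compat_r; [apply pow_le; lra | apply law_tail_antitone; lia]. }
  assert (Hs1 : 0 < node H j <= 1) by lra.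
  pose proof (rsum_geom_ge (node H j) n Hs1 Hn) as HG.
  apply (Rmult_le_compat_l (law_tail H n)) in HG; [ | lra].
  apply Rmult_le_reg_r with (/ 2 / node H j); [apply Rdiv_lt_0_compat; lra | ].
  replace (4 / 2 ^ j * (/ 2 / node H j)) with (2 / H j) by (unfold node; field; lra).
  lra.
Qed.

Lemma ex_INR_ge (y : R) : exists n : nat, y <= INR n.
Proof. destruct (INR_unbounded y) as [n Hn]; exists n; lra. Qed.

Lemma law_series : is_series (law H) 1.
Proof.
  apply is_series_rsum.
  apply is_lim_seq_ext with (fun n => 1 - law_tail H n).
  { intros n; rewrite <- tail_law; unfold tail; ring. }
  replace (Finite 1) with (Finite (1 - 0)) by (f_equal; ring).
  apply is_lim_seq_minus'; [apply is_lim_seq_const | ].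
  apply is_lim_seq_spec; intros eps; simpl.
  destruct (ex_INR_ge (4 / eps)) as [j Hj].
  destruct (ex_INR_ge (/ node H j)) as [N HN].
  exists N; intros n Hn; rewrite Rminus_0_r, Rabs_pos_eq by (apply Rlt_le, law_tail_pos).
  pose proof (cond_pos eps) as He; pose proof (node_pos j) as Hs.
  apply Rle_lt_trans with (4 / 2 ^ j).
  - apply law_tail_le; apply Rmult_le_reg_r with (/ node H j); [now apply Rinv_0_lt_compat | ].
    rewrite Rmult_assoc, Rinv_r, Rmult_1_l, Rmult_1_r by lra.
    apply Rle_trans with (1 := HN), le_INR, Hn.
  - assert (Hp : INR j < 2 ^ j) by (rewrite <- INR_pow2; apply lt_INR, Nat.pow_gt_lin_r; lia).
    apply Rmult_lt_reg_r with (2 ^ j); [apply two_pow_pos | ].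
    unfold Rdiv at 1; rewrite Rmult_assoc, Rinv_l by (pose proof (two_pow_pos j); lra).
    apply Rmult_lt_reg_r with (/ eps); [now apply Rinv_0_lt_compat | ].
    replace (eps * 2 ^ j * / eps) with (2 ^ j) by (field; lra).
    unfold Rdiv in Hj; lra.
Qed.

Lemma law_is_log_convex_law : log_convex_law (law H).
Proof.
  split; [exact law_pos | split; [ | exact law_series]].
  intros n; rewrite !law_moment; apply moment_log_convex;
    auto using wt_node_ge0, rho_bounds, wt_node_ex_series, wt_node_0.
Qed.

Lemma law_log_convex_tail : log_convex_tail (law H).
Proof.
  split; intros n; rewrite !tail_law; [apply law_tail_pos | ].
  apply moment_log_convex; auto using wt_ge0, rho_bounds, wt_ex_series.
  pose proof wt_0; pose proof scale_kap; lra.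
Qed.

(** Summation by parts. In the limit [1 - x A(x)] is [1 - x] times the generating function of the
    tail, where [x A(x)] is the generating function of the step [k + 1]. *)
Lemma one_minus_law_gf (x : R) (N : nat) :
  1 - rsum (fun n => law H n * x ^ S n) N =
  (1 - x) * rsum (fun n => law_tail H n * x ^ n) N + law_tail H N * x ^ N.
Proof.
  induction N as [ | N IH]; [simpl; rewrite law_tail_0; ring | ].
  cbn [rsum]; replace (1 - (rsum (fun n => law H n * x ^ S n) N + law H N * x ^ S N))
    with (1 - rsum (fun n => law H n * x ^ S n) N - law H N * x ^ S N) by ring.
  rewrite IH; unfold law; simpl; ring.
Qed.

Lemma law_gf_lim (x : R) :
  0 <= x < 1 -> is_lim_seq (rsum (fun n => law H n * x ^ S n)) (x * gf (law H) x).
Proof.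
  intros Hx.
  apply is_lim_seq_ext with (fun N => x * rsum (fun n => law H n * x ^ n) N).
  { intros N; rewrite <- rsum_scal; apply rsum_ext; intros; simpl; ring. }
  apply (is_lim_seq_scal_l _ x (gf (law H) x)), is_series_rsum.
  apply ex_series_law_gf; auto using law_is_log_convex_law.
Qed.

(** Together with [law_gf_le] this pins [1 - x A(x)] at [x = 1 - node H j] between two multiples of
    [/ 2 ^ j]: about [2 ^ j] steps change the generating function of the position by a constant
    factor. The lower bound for the operator uses one side, the Chernoff bound the other. *)
Lemma law_gf_ge j : 1 - 2 / 2 ^ j <= (1 - node H j) * gf (law H) (1 - node H j).
Proof.
  set (x := 1 - node H j); pose proof (rho_bounds j) as Hx; fold x in Hx.
  assert (Hx' : 0 <= x < 1) by lra.
  apply (is_lim_seq_le (fun N => 1 - 2 / 2 ^ j - x ^ N)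
           (rsum (fun n => law H n * x ^ S n)) (1 - 2 / 2 ^ j) (x * gf (law H) x)).
  - intros N; pose proof (one_minus_law_gf x N) as E.
    pose proof (law_tail_gf_le j N) as G; fold x in G.
    assert (L1 : law_tail H N <= 1)
      by (rewrite <- law_tail_0; apply law_tail_antitone; lia).
    pose proof (pow_le x N (proj1 Hx')).
    apply (Rmult_le_compat_l (1 - x)) in G; [ | lra].
    replace ((1 - x) * (2 / H j)) with (2 / 2 ^ j) in G
      by (unfold x, node; field; pose proof (two_pow_pos j); pose proof (scale_pos j); lra).
    nra.
  - replace (Finite (1 - 2 / 2 ^ j)) with (Finite (1 - 2 / 2 ^ j - 0)) by (f_equal; ring).
    apply is_lim_seq_minus'; [apply is_lim_seq_const | ].
    apply is_lim_seq_geom; rewrite Rabs_pos_eq; lra.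
  - now apply law_gf_lim.
Qed.

Lemma law_gf_le j :
  (1 - node H j) * gf (law H) (1 - node H j) <= 1 - kap * exp (-2) / 2 / 2 ^ j.
Proof.
  set (x := 1 - node H j); pose proof (rho_bounds j) as Hx; fold x in Hx.
  assert (Hx' : 0 <= x < 1) by lra.
  pose proof (node_pos j) as Hn; pose proof (node_le_half j) as Hn2.
  set (s := node H j) in *.
  (* The integer part of [/ s] is long enough, with one more term, for [law_tail_sum_ge], and short
     enough for [x ^ N] to stay above [exp (-2)]. *)
  destruct (nfloor_ex (/ s)) as [N [HN1 HN2]]; [apply Rlt_le, Rinv_0_lt_compat; auto | ].
  assert (Hs1 : 1 <= INR (S N) * s).
  { rewrite S_INR; apply Rmult_le_reg_r with (/ s); [now apply Rinv_0_lt_compat | ].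
    rewrite Rmult_assoc, Rinv_r by lra; lra. }
  assert (Hs2 : INR N * s <= 1).
  { apply Rmult_le_reg_r with (/ s); [now apply Rinv_0_lt_compat | ].
    rewrite Rmult_assoc, Rinv_r by lra; lra. }
  pose proof (law_tail_sum_ge j N Hs1) as HS.
  assert (Hpw : exp (-2) <= x ^ N).
  { eapply Rle_trans; [ | apply exp_le_pow_one_minus; lra].
    apply exp_le_compat; lra. }
  assert (HT : exp (-2) * (kap / (2 * H j)) <= rsum (fun n => law_tail H n * x ^ n) (S N)).
  { apply Rle_trans with (exp (-2) * rsum (law_tail H) (S N)).
    - apply Rmult_le_compat_l; [apply Rlt_le, exp_pos | auto].
    - rewrite <- rsum_scal; apply rsum_le; intros n Ln; rewrite Rmult_comm.
      apply Rmult_le_compat_l; [apply Rlt_le, law_tail_pos | ].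
      apply Rle_trans with (1 := Hpw).
      replace N with (n + (N - n))%nat by lia; rewrite pow_add.
      rewrite <- (Rmult_1_r (x ^ n)) at 2; apply Rmult_le_compat_l; [apply pow_le; lra | ].
      rewrite <- (pow1 (N - n)); apply pow_incr; lra. }
  apply (is_lim_seq_le_loc (rsum (fun n => law H n * x ^ S n))
           (fun _ => 1 - kap * exp (-2) / 2 / 2 ^ j) (x * gf (law H) x)
           (1 - kap * exp (-2) / 2 / 2 ^ j));
    [ | now apply law_gf_lim | apply is_lim_seq_const].
  exists (S N); intros M HM.
  pose proof (one_minus_law_gf x M) as E.
  assert (HM2 : rsum (fun n => law_tail H n * x ^ n) (S N) <=
                rsum (fun n => law_tail H n * x ^ n) M).
  { apply rsum_le_len; auto; intros; apply Rmult_le_pos;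
      [apply Rlt_le, law_tail_pos | apply pow_le; lra]. }
  assert (0 <= law_tail H M * x ^ M)
    by (apply Rmult_le_pos; [apply Rlt_le, law_tail_pos | apply pow_le; lra]).
  assert (HF : (1 - x) * (exp (-2) * (kap / (2 * H j))) <=
               (1 - x) * rsum (fun n => law_tail H n * x ^ n) M)
    by (apply Rmult_le_compat_l; lra).
  replace ((1 - x) * (exp (-2) * (kap / (2 * H j)))) with (kap * exp (-2) / 2 / 2 ^ j) in HF
    by (unfold x, s, node; field; pose proof (two_pow_pos j); pose proof (scale_pos j); lra).
  lra.
Qed.

End Law.

(** * Visits under the law: near and far points *)

Lemma renewal_le1 (a : nat -> R) (n : nat) :
  0 < a O -> log_convex_tail a -> renewal a n <= 1.
Proof. intros Ha Ht; rewrite <- (renewal_0 a); apply renewal_antitone; auto; lia. Qed.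

Lemma visits_pow2_le_renewal (a : nat -> R) (j J : nat) :
  log_convex_law a -> log_convex_tail a -> visits a (2 ^ j) J <= renewal a J.
Proof.
  intros Ha Ht; rewrite <- INR_pow2; eapply Rle_trans; [now apply visits_INR_le | ].
  apply renewal_antitone; auto; [apply Ha | lia].
Qed.

Lemma scale_le_shift (H : nat -> R) (kap : R) (i b : nat) :
  dyadic_scale H kap -> kap ^ b * H i <= H (i + b)%nat.
Proof.
  intros HH; pose proof (scale_kap H kap HH); induction b as [ | b IH].
  - rewrite Nat.add_0_r; simpl; lra.
  - rewrite Nat.add_succ_r; destruct HH as (_ & _ & _ & Hl & _); specialize (Hl (i + b)%nat).
    simpl; nra.
Qed.

(** To walk for [2 ^ (i + b)] units of time and move at most [/ node H i] beyond the unit drift is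
    improbable, doubly exponentially in [b]. Passing from [x A(x)] to [A(x)] costs
    [- ln x <= 2 * s], at most half of the gain [th / 2 ^ i] by the smallness of [H O]; the factor
    [exp 2] pays for [x ^ J]. *)
Lemma law_chernoff (H : nat -> R) (kap : R) (i b J : nat) :
  dyadic_scale H kap -> INR J * node H i <= 1 ->
  rsum (powcoef (law H) (2 ^ (i + b))) (S J) <= exp (2 - kap * exp (-2) / 4 * 2 ^ b).
Proof.
  intros HH HJ; pose proof (law_is_log_convex_law H kap HH) as Ha.
  pose proof (node_pos H kap HH i) as Hs; pose proof (node_le_half H kap HH i) as Hs2.
  set (s := node H i) in *; set (lam := 2 ^ (i + b)).
  assert (Hlam : 0 < lam) by apply two_pow_pos.
  assert (Hx : 0 < 1 - s < 1) by lra.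
  pose proof (powcoef_chernoff (law H) lam (1 - s) J Ha (Rlt_le _ _ Hlam) Hx) as Hc.
  assert (Hx' : 0 <= 1 - s < 1) by lra.
  pose proof (gf_bounds (law H) (1 - s) Ha Hx') as [Hg0 _].
  pose proof (law_gf_le H kap HH i) as Hg; fold s in Hg.
  set (th := kap * exp (-2) / 2) in *.
  assert (Hth : 4 * H i <= th).
  { pose proof (scale_antitone H kap HH 0 i (Nat.le_0_l i)).
    destruct HH as (_ & _ & _ & _ & Hini); unfold th; lra. }
  assert (Hln : ln (gf (law H) (1 - s)) <= - (th / 2) / 2 ^ i).
  { assert (Hl : ln ((1 - s) * gf (law H) (1 - s)) <= - (th / 2 ^ i)).
    { rewrite <- (ln_exp (- (th / 2 ^ i))); apply ln_le; [apply Rmult_lt_0_compat; lra | ].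
      pose proof (exp_ineq1_le (- (th / 2 ^ i))); lra. }
    rewrite ln_mult in Hl by lra.
    assert (Hl2 : - (2 * s) <= ln (1 - s)).
    { rewrite <- (ln_exp (- (2 * s))); apply ln_le; [apply exp_pos | ].
      apply exp_le_one_minus; lra. }
    assert (Hsd : 2 * s <= th / 2 / 2 ^ i).
    { unfold s, node; pose proof (Rinv_0_lt_compat _ (two_pow_pos i)); unfold Rdiv; nra. }
    unfold Rdiv in *; lra. }
  assert (He : exp (lam * ln (gf (law H) (1 - s))) <= exp (- (th / 2 * 2 ^ b))).
  { apply exp_le_compat.
    apply Rle_trans with (lam * (- (th / 2) / 2 ^ i)); [apply Rmult_le_compat_l; lra | ].
    unfold lam; rewrite pow_add; apply Req_le; field; pose proof (two_pow_pos i); lra. }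
  assert (Hpw : exp (-2) <= (1 - s) ^ J).
  { eapply Rle_trans; [ | apply exp_le_pow_one_minus; lra].
    apply exp_le_compat; lra. }
  assert (HP : 0 <= rsum (powcoef (law H) lam) (S J))
    by (apply rsum_ge0; intros; apply powcoef_ge0; auto; lra).
  apply (Rmult_le_compat_r _ _ _ HP) in Hpw.
  apply Rmult_le_reg_l with (exp (-2)); [apply exp_pos | ].
  rewrite <- exp_plus.
  replace (-2 + (2 - kap * exp (-2) / 4 * 2 ^ b)) with (- (th / 2 * 2 ^ b))
    by (unfold th; field).
  lra.
Qed.

(** Induction on [j]. If [J] is at most [/ node H (j - b)], splitting the time [2 ^ S j] into halves
    multiplies the inductive bound by a Chernoff factor of at most [kap], which is what [H] may
    lose. If [J] is larger, the renewal sequence is at most [2 / kap * H (j - b)], and returning to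
    the scale [S j] costs [kap ^ S b]. Up to the scale [b] the trivial bound 1 suffices. *)
Lemma visits_law_le (H : nat -> R) (kap : R) :
  dyadic_scale H kap -> exists C, 0 < C /\ forall j J, visits (law H) (2 ^ j) J <= C * H j.
Proof.
  intros HH; pose proof (law_is_log_convex_law H kap HH) as Ha.
  pose proof (law_log_convex_tail H kap HH) as Ht.
  pose proof (scale_kap H kap HH) as Hk.
  pose proof (proj1 Ha O) as Ha0.
  (* [b] is the lag between the scale of time and that of distance; it depends on [kap] alone, so
     [C] does not grow with [j]. *)
  assert (Hb : exists b : nat, exp (2 - kap * exp (-2) / 4 * 2 ^ b) <= kap).
  { set (th := kap * exp (-2) / 4).
    assert (Hth : 0 < th) by (unfold th; pose proof (exp_pos (-2)); nra).
    destruct (ex_INR_ge ((2 - ln kap) / th)) as [b Hb]; exists b.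
    apply Rle_trans with (exp (ln kap)); [apply exp_le_compat | rewrite exp_ln; lra].
    assert (INR b <= 2 ^ b)
      by (rewrite <- INR_pow2; apply le_INR, Nat.lt_le_incl, Nat.pow_gt_lin_r; lia).
    assert (Hb2 : (2 - ln kap) / th * th <= 2 ^ b * th) by (apply Rmult_le_compat_r; lra).
    replace ((2 - ln kap) / th * th) with (2 - ln kap) in Hb2 by (field; lra).
    lra. }
  destruct Hb as [b Hb].
  set (C := Rmax (/ H b) (2 / kap / kap ^ S b)).
  pose proof (scale_pos H kap HH b) as HHb.
  assert (Hkb : 0 < kap ^ S b) by now apply pow_lt.
  assert (HC : 0 < C).
  { eapply Rlt_le_trans; [ | apply Rmax_l]; now apply Rinv_0_lt_compat. }
  exists C; split; [exact HC | ].
  induction j as [ | j IH]; intros J; [ | destruct (Nat.le_gt_cases b j) as [Hj | Hj]].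
  1, 3: eapply Rle_trans; [apply visits_pow2_le_renewal; auto | ];
    eapply Rle_trans; [apply renewal_le1; auto | ];
    apply Rle_trans with (/ H b * H b); [rewrite Rinv_l; lra | ];
    apply Rmult_le_compat; [now apply Rlt_le, Rinv_0_lt_compat | lra | apply Rmax_l | ];
    apply (scale_antitone H kap HH); lia.
  set (i := (j - b)%nat).
  destruct (Rle_or_lt (INR J * node H i) 1) as [HJ | HJ].
  - replace (2 ^ S j) with (2 ^ j + 2 ^ j) by (simpl; ring).
    rewrite visits_add; unfold conv.
    pose proof (scale_pos H kap HH j) as HHj.
    pose proof (law_chernoff H kap i b J HH HJ) as Hc.
    replace (i + b)%nat with j in Hc by (unfold i; lia).
    apply Rle_trans with (rsum (powcoef (law H) (2 ^ j)) (S J) * (C * H j)).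
    + rewrite <- rsum_scal_r; apply rsum_le; intros k _.
      apply Rmult_le_compat_l; [apply powcoef_ge0; auto; apply Rlt_le, two_pow_pos | apply IH].
    + destruct HH as (_ & _ & _ & Hl & _); specialize (Hl j).
      apply Rle_trans with (kap * (C * H j)).
      * apply Rmult_le_compat_r; [apply Rlt_le, Rmult_lt_0_compat; auto | lra].
      * nra.
  - eapply Rle_trans; [apply visits_pow2_le_renewal; auto | ].
    assert (HJ' : 1 <= INR (S J) * node H i).
    { rewrite S_INR; pose proof (node_pos H kap HH i); lra. }
    pose proof (law_tail_sum_ge H kap HH i J HJ') as HS.
    assert (E : rsum (law_tail H) (S J) = rsum (tail (law H)) (S J)).
    { apply rsum_ext; intros; symmetry; now apply (tail_law H kap). }
    rewrite E in HS; pose proof (renewal_le (law H) J Ha0 Ht) as Hr.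
    pose proof (scale_pos H kap HH i) as HHi.
    assert (Hu : 0 <= renewal (law H) J) by (apply visits_ge0; auto; lra).
    assert (Hu2 : renewal (law H) J <= 2 / kap * H i).
    { apply (Rmult_le_compat_l _ _ _ Hu) in HS.
      apply Rmult_le_reg_r with (kap / (2 * H i)).
      - apply Rdiv_lt_0_compat; lra.
      - replace (2 / kap * H i * (kap / (2 * H i))) with 1 by (field; lra); lra. }
    apply Rle_trans with (1 := Hu2).
    pose proof (scale_le_shift H kap i (S b) HH) as Hsh.
    replace (i + S b)%nat with (S j) in Hsh by (unfold i; lia).
    apply Rle_trans with (2 / kap / kap ^ S b * H (S j)).
    + replace (2 / kap * H i) with (2 / kap / kap ^ S b * (kap ^ S b * H i)) by (field; lra).
      apply Rmult_le_compat_l; [ | exact Hsh].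
      apply Rlt_le; repeat apply Rdiv_lt_0_compat; lra.
    + apply Rmult_le_compat_r; [apply Rlt_le, (scale_pos H kap HH) | apply Rmax_r].
Qed.

(** * The matrix of the operator *)

(* The sequence carried by the indices of [(b + 1) 2^k] (indices are shifted by one, as in
   [h2_coef]), with value [G k] there. *)
Definition sparse (b : nat) (G : nat -> R) (i : nat) : R :=
  rsum (fun k => if (S i =? S b * 2 ^ k)%nat then G k else 0) (S i).

Lemma pow2_gt0 (k : nat) : (0 < 2 ^ k)%nat.
Proof. pose proof (Nat.pow_nonzero 2 k); lia. Qed.

Lemma mul_pow2_inj (b k l : nat) : (S b * 2 ^ k = S b * 2 ^ l -> k = l)%nat.
Proof. intros E; apply Nat.mul_cancel_l in E; [ | lia]; now apply Nat.pow_inj_r in E; [ | lia]. Qed.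

Lemma rsum_single (f : nat -> R) (k n : nat) :
  (k < n)%nat -> (forall i, (i < n)%nat -> i <> k -> f i = 0) -> rsum f n = f k.
Proof.
  intros Hk Hf; replace n with (k + (1 + (n - S k)))%nat by lia.
  rewrite !rsum_split, (rsum_eq0 f k), (rsum_eq0 (fun _ => f (_ + (_ + _))%nat)).
  - simpl; rewrite Nat.add_0_r; ring.
  - intros i Hi; apply Hf; lia.
  - intros i Hi; apply Hf; lia.
Qed.

Lemma sparse_at (b : nat) (G : nat -> R) (i k : nat) :
  (S i = S b * 2 ^ k)%nat -> sparse b G i = G k.
Proof.
  intros E; unfold sparse; rewrite (rsum_single _ k).
  - rewrite E, Nat.eqb_refl; reflexivity.
  - pose proof (Nat.pow_gt_lin_r 2 k ltac:(lia)); nia.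
  - intros l Hl Hne; destruct (Nat.eqb_spec (S i) (S b * 2 ^ l)) as [E' | ]; [ | reflexivity].
    exfalso; apply Hne, (mul_pow2_inj b); congruence.
Qed.

Lemma sparse_off (b : nat) (G : nat -> R) (i : nat) :
  (forall k, (S i <> S b * 2 ^ k)%nat) -> sparse b G i = 0.
Proof.
  intros E; apply rsum_eq0; intros k _.
  destruct (Nat.eqb_spec (S i) (S b * 2 ^ k)) as [E' | ]; [now apply E in E' | reflexivity].
Qed.

Lemma sparse_cases (b i : nat) :
  (exists k, (S i = S b * 2 ^ k)%nat) \/ (forall k, (S i <> S b * 2 ^ k)%nat).
Proof.
  destruct (classic (exists k, (S i = S b * 2 ^ k)%nat)) as [ | N]; [now left | right].
  intros k E; apply N; now exists k.
Qed.

Lemma sparse_ge0 (b : nat) (G : nat -> R) (i : nat) : (forall k, 0 <= G k) -> 0 <= sparse b G i.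
Proof.
  intros HG; apply rsum_ge0; intros k _; destruct (_ =? _)%nat; auto; lra.
Qed.

(** [m] counts the points of the orbit among the first [n] indices. It does not depend on [G], so a
    single [m] serves several sequences on the same orbit. *)
Lemma rsum_sparse (b n : nat) :
  exists m, (n < S b * 2 ^ m)%nat /\ (forall k, (k < m)%nat -> (S b * 2 ^ k <= n)%nat) /\
    forall G, rsum (sparse b G) n = rsum G m.
Proof.
  induction n as [ | n (m & Hm & Hk & HG)].
  - exists O; split; [simpl; lia | split; [lia | reflexivity]].
  - destruct (Nat.eq_dec (S n) (S b * 2 ^ m)) as [E | E].
    + exists (S m); split; [ | split].
      * rewrite Nat.pow_succ_r', E; pose proof (pow2_gt0 m); nia.
      * intros k L; destruct (Nat.eq_dec k m) as [-> | N]; [lia | ].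
        specialize (Hk k ltac:(lia)); lia.
      * intros G; cbn [rsum]; now rewrite HG, (sparse_at b G n m).
    + exists m; split; [lia | split].
      * intros k L; specialize (Hk k L); lia.
      * intros G; cbn [rsum]; rewrite HG, sparse_off; [ring | ].
        intros k E'; destruct (Nat.lt_ge_cases k m) as [L | L].
        -- specialize (Hk k L); lia.
        -- pose proof (Nat.pow_le_mono_r 2 m k ltac:(lia) L); nia.
Qed.

Lemma rsum_sparse_at (b i J : nat) (G : nat -> R) :
  (S i = S b * 2 ^ J)%nat -> rsum (sparse b G) (S i) = rsum G (S J).
Proof.
  intros E; destruct (rsum_sparse b (S i)) as (m & Hm & Hk & HG); rewrite HG; f_equal.
  rewrite E in Hm, Hk.
  assert (J < m)%nat.
  { apply Nat.nle_gt; intros L; pose proof (Nat.pow_le_mono_r 2 m J ltac:(lia) L); nia. }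
  destruct (Nat.eq_dec m (S J)) as [ | N]; [auto | ].
  specialize (Hk (S J) ltac:(lia)); rewrite Nat.pow_succ_r' in Hk; pose proof (pow2_gt0 J); nia.
Qed.

Definition log2n (j : nat) : R := ln (INR (S j)) / ln 2.

Lemma ln2_pos : 0 < ln 2.
Proof. rewrite <- ln_1; apply ln_increasing; lra. Qed.

Lemma log2n_ge0 (j : nat) : 0 <= log2n j.
Proof.
  apply Rmult_le_pos; [ | apply Rlt_le, Rinv_0_lt_compat, ln2_pos].
  rewrite <- ln_1; apply ln_le; [lra | rewrite S_INR; pose proof (pos_INR j); lra].
Qed.

Lemma log2n_mul (i b k : nat) :
  (S i = S b * 2 ^ k)%nat -> log2n i = log2n b + INR k.
Proof.
  intros E; unfold log2n; rewrite E, mult_INR, INR_pow2, ln_mult, ln_pow.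
  - field; apply Rgt_not_eq, ln2_pos.
  - lra.
  - apply INR_S_pos.
  - apply two_pow_pos.
Qed.

Lemma log2n_le (i j : nat) : (i <= j)%nat -> log2n i <= log2n j.
Proof.
  intros L; apply Rmult_le_compat_r; [apply Rlt_le, Rinv_0_lt_compat, ln2_pos | ].
  apply ln_le; [apply INR_S_pos | apply le_INR; lia].
Qed.

(* Column [j] holds the coefficients of [A^{log2 (j + 1)}] at the indices of [(j + 1) 2^k]. *)
Definition kernel (a : nat -> R) (i j : nat) : R := sparse j (powcoef a (log2n j)) i.

Lemma kernel_ge0 (a : nat -> R) (i j : nat) : log_convex_law a -> 0 <= kernel a i j.
Proof. intros Ha; apply sparse_ge0; intros; apply powcoef_ge0; auto using log2n_ge0. Qed.

Lemma kernel_col (a : nat -> R) (j n : nat) :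
  log_convex_law a -> rsum (fun i => kernel a i j) n <= 1.
Proof.
  intros Ha; destruct (rsum_sparse j n) as (m & _ & _ & E).
  change (rsum (sparse j (powcoef a (log2n j))) n <= 1); rewrite E.
  apply powcoef_sum_le1; auto using log2n_ge0.
Qed.

Lemma kernel_support (a : nat -> R) (i j : nat) :
  kernel a i j <> 0 -> exists k, (S i = S j * 2 ^ k)%nat.
Proof.
  intros N; destruct (sparse_cases j i) as [ | Hoff]; [auto | ].
  exfalso; apply N; now apply sparse_off.
Qed.

(** Along the orbit [(b + 1) 2^t] of columns, each doubling raises the exponent of [A] by one and
    lowers the index of the coefficient by one; for [G = 1] these are the summands of [visits]. *)
Lemma kernel_sparse (a : nat -> R) (b i j J : nat) (G : nat -> R) :
  (S i = S b * 2 ^ J)%nat -> (j <= i)%nat ->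
  kernel a i j * sparse b G j =
  sparse b (fun t => powcoef a (log2n b + INR t) (J - t) * G t) j.
Proof.
  intros Ei Lj; destruct (sparse_cases b j) as [[t Et] | Hoff].
  - assert (Ht : (t <= J)%nat).
    { apply Nat.nlt_ge; intros L; pose proof (Nat.pow_lt_mono_r 2 J t ltac:(lia) L); nia. }
    rewrite !(sparse_at b _ j t Et); f_equal.
    unfold kernel; rewrite (sparse_at j _ i (J - t)), (log2n_mul j b t Et); [reflexivity | ].
    rewrite Et, Ei, <- Nat.mul_assoc, <- Nat.pow_add_r; do 2 f_equal; lia.
  - rewrite !sparse_off by auto; ring.
Qed.

(** The columns meeting row [i] carry the integers of the form [(i + 1) / 2^k]. If some of them
    start at [n] or later, let [b] be the least such column: the others are the points of its orbit
    up to [i], and the entries along this orbit add up to [visits]. *)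
Lemma kernel_row (a : nat -> R) (n i : nat) :
  rsum (fun j => if (n <=? j)%nat then kernel a i j else 0) (S i) = 0 \/
  exists b J, (n <= b)%nat /\
    rsum (fun j => if (n <=? j)%nat then kernel a i j else 0) (S i) = visits a (log2n b) J.
Proof.
  set (P := fun j => (n <= j)%nat /\ exists k, (S i = S j * 2 ^ k)%nat).
  destruct (classic (exists j, P j)) as [[j0 Hj0] | N].
  - right.
    assert (Hmin : exists b, P b /\ forall j, P j -> (b <= j)%nat).
    { clear - Hj0; induction j0 as [j0 IH] using (well_founded_induction Wf_nat.lt_wf).
      destruct (classic (exists j, P j /\ (j < j0)%nat)) as [[j [Pj L]] | N].
      - exact (IH j L Pj).
      - exists j0; split; auto; intros j Pj; apply Nat.nlt_ge; intros L; apply N; eauto. }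
    destruct Hmin as [b [[Hnb [J EJ]] Hmin]]; exists b, J; split; auto.
    unfold visits; rewrite <- (rsum_sparse_at b i J) by exact EJ.
    apply rsum_ext; intros j Lj.
    destruct (Nat.leb_spec n j) as [Lnj | Lnj].
    + destruct (sparse_cases b j) as [[t Et] | Hoff].
      * pose proof (kernel_sparse a b i j J (fun _ => 1) EJ ltac:(lia)) as E.
        rewrite !(sparse_at b _ j t Et) in E; rewrite (sparse_at b _ j t Et); lra.
      * rewrite (sparse_off b) by auto.
        apply NNPP; intros N; apply kernel_support in N; destruct N as [k Ek].
        pose proof (Hmin j (conj Lnj (ex_intro _ k Ek))) as Lb.
        assert (Lk : (k <= J)%nat).
        { apply Nat.nlt_ge; intros L; pose proof (Nat.pow_lt_mono_r 2 J k ltac:(lia) L); nia. }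
        apply (Hoff (J - k)%nat), (Nat.mul_cancel_r _ _ (2 ^ k)); [pose proof (pow2_gt0 k); lia | ].
        rewrite <- Ek, EJ, <- Nat.mul_assoc, <- Nat.pow_add_r; do 2 f_equal; lia.
    + symmetry; apply sparse_off; intros k Ek; pose proof (pow2_gt0 k); nia.
  - left; apply rsum_eq0; intros j _; destruct (Nat.leb_spec n j) as [Lnj | Lnj]; [ | reflexivity].
    apply NNPP; intros Hne; apply kernel_support in Hne; apply N; exists j; split; auto.
Qed.

Definition apply_kernel (K : nat -> nat -> R) (x : nat -> R) (i : nat) : R :=
  rsum (fun j => K i j * x j) (S i).

(** Cauchy-Schwarz with each entry split into two square roots bounds a squared coordinate of the
    image by a row sum times the sum of [K i j * x j ^ 2]; the column sums then control the sum over
    rows. As [x] starts at [n], only row sums over the columns from [n] on enter. *)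
Lemma schur_test (K : nat -> nat -> R) (x : nat -> R) (rho : R) (n N : nat) :
  (forall i j, 0 <= K i j) -> (forall j m, rsum (fun i => K i j) m <= 1) ->
  (forall i, rsum (fun j => if (n <=? j)%nat then K i j else 0) (S i) <= rho) ->
  (forall j, (j < n)%nat -> x j = 0) ->
  rsum (fun i => apply_kernel K x i ^ 2) N <= rho * rsum (fun j => x j ^ 2) N.
Proof.
  intros Hpos Hcol Hrow Hx.
  set (K' := fun i j => if (n <=? j)%nat then K i j else 0).
  assert (HK' : forall i j, 0 <= K' i j) by (intros; unfold K'; destruct (_ <=? _)%nat; auto; lra).
  assert (Hrho : 0 <= rho).
  { eapply Rle_trans; [ | apply (Hrow O)]; apply rsum_ge0; intros; apply HK'. }
  assert (Hi : forall i, apply_kernel K x i ^ 2 <= rho * rsum (fun j => K i j * x j ^ 2) (S i)).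
  { intros i; unfold apply_kernel.
    rewrite (rsum_ext _ (fun j => sqrt (K' i j) * (sqrt (K' i j) * x j))).
    - eapply Rle_trans; [apply cauchy_schwarz_rsum | ].
      apply Rmult_le_compat; try (apply rsum_ge0; intros; apply pow2_ge_0).
      + eapply Rle_trans; [ | apply (Hrow i)]; apply rsum_le; intros j _.
        rewrite pow2_sqrt by apply HK'; apply Rle_refl.
      + apply rsum_le; intros j _; rewrite Rpow_mult_distr, pow2_sqrt by apply HK'.
        apply Rmult_le_compat_r; [apply pow2_ge_0 | ].
        unfold K'; destruct (_ <=? _)%nat; auto; apply Rle_refl.
    - intros j _; rewrite <- Rmult_assoc, sqrt_sqrt by apply HK'; unfold K'.
      destruct (Nat.leb_spec n j); [reflexivity | rewrite Hx by auto; ring]. }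
  apply Rle_trans with (rsum (fun i => rho * rsum (fun j => K i j * x j ^ 2) N) N).
  - apply rsum_le; intros i Li; eapply Rle_trans; [apply Hi | ].
    apply Rmult_le_compat_l; auto; apply rsum_le_len; [ | lia].
    intros; apply Rmult_le_pos; auto; apply pow2_ge_0.
  - rewrite rsum_scal; apply Rmult_le_compat_l; auto.
    rewrite rsum_switch; apply rsum_le; intros j _.
    rewrite rsum_scal_r; pose proof (Hcol j N); pose proof (pow2_ge_0 (x j)); nra.
Qed.

(** * Operators on the Hardy space and approximation numbers *)

Lemma Cmod_sq (z : C) : Cmod z ^ 2 = Re z ^ 2 + Im z ^ 2.
Proof.
  unfold Cmod; rewrite pow2_sqrt; [reflexivity | ].
  pose proof (pow2_ge_0 (fst z)); pose proof (pow2_ge_0 (snd z)); lra.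
Qed.

Lemma C_ext (z w : C) : Re z = Re w -> Im z = Im w -> z = w.
Proof. destruct z, w; simpl; congruence. Qed.

Lemma h2_norm_sq_le (f : H2) (B : R) :
  (forall N, rsum (fun n => Cmod (h2_coef f n) ^ 2) N <= B) -> h2_norm f ^ 2 <= B.
Proof.
  intros HB; rewrite h2_norm_sq.
  apply (Series_rsum_le _ B); auto; intros; apply pow2_ge_0.
Qed.

Lemma rsum_le_h2_norm_sq (f : H2) (N : nat) :
  rsum (fun n => Cmod (h2_coef f n) ^ 2) N <= h2_norm f ^ 2.
Proof.
  rewrite h2_norm_sq; apply rsum_le_series; [intros; apply pow2_ge_0 | ].
  apply Series_correct, h2_summable.
Qed.

Definition row_bound (K : nat -> nat -> R) (n : nat) (rho : R) : Prop :=
  forall i, rsum (fun j => if (n <=? j)%nat then K i j else 0) (S i) <= rho.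

Definition contractive_kernel (K : nat -> nat -> R) : Prop :=
  (forall i j, 0 <= K i j) /\ (forall j m, rsum (fun i => K i j) m <= 1) /\ row_bound K 0 1.

Definition kop_coef (K : nat -> nat -> R) (f : nat -> C) (i : nat) : C :=
  (apply_kernel K (fun j => Re (f j)) i, apply_kernel K (fun j => Im (f j)) i).

Lemma kop_coef_bound (K : nat -> nat -> R) (f : H2) (n : nat) (rho : R) (N : nat) :
  contractive_kernel K -> row_bound K n rho ->
  (forall j, (j < n)%nat -> h2_coef f j = RtoC 0) ->
  rsum (fun i => Cmod (kop_coef K (h2_coef f) i) ^ 2) N <= rho * h2_norm f ^ 2.
Proof.
  intros (Hp & Hc & _) Hr Hf.
  assert (Hrho : 0 <= rho).
  { eapply Rle_trans; [ | apply (Hr O)]; apply rsum_ge0; intros.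
    destruct (_ <=? _)%nat; auto; lra. }
  apply Rle_trans with (rho * rsum (fun j => Cmod (h2_coef f j) ^ 2) N);
    [ | apply Rmult_le_compat_l; auto using rsum_le_h2_norm_sq].
  rewrite (rsum_ext _ (fun i => apply_kernel K (fun j => Re (h2_coef f j)) i ^ 2 +
                                apply_kernel K (fun j => Im (h2_coef f j)) i ^ 2))
    by (intros; apply Cmod_sq).
  rewrite (rsum_ext (fun j => Cmod (h2_coef f j) ^ 2)
             (fun j => Re (h2_coef f j) ^ 2 + Im (h2_coef f j) ^ 2)) by (intros; apply Cmod_sq).
  rewrite !rsum_plus, Rmult_plus_distr_l; apply Rplus_le_compat;
    apply (schur_test K _ rho n); auto; intros j Lj; now rewrite Hf.
Qed.

Lemma kop_summable (K : nat -> nat -> R) (HK : contractive_kernel K) (f : H2) :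
  ex_series (fun i => Cmod (kop_coef K (h2_coef f) i) ^ 2).
Proof.
  eapply Series_rsum_le; [intros; apply pow2_ge_0 | intros N].
  apply (kop_coef_bound K f 0 1); auto; [apply HK | lia].
Qed.

Definition kop (K : nat -> nat -> R) (HK : contractive_kernel K) (f : H2) : H2 :=
  mkH2 (kop_coef K (h2_coef f)) (kop_summable K HK f).

Lemma kop_tail_norm (K : nat -> nat -> R) (HK : contractive_kernel K) (n : nat) (rho : R) (f : H2) :
  row_bound K n rho -> (forall j, (j < n)%nat -> h2_coef f j = RtoC 0) ->
  h2_norm (kop K HK f) ^ 2 <= rho * h2_norm f ^ 2.
Proof. intros Hr Hf; apply h2_norm_sq_le; intros N; now apply kop_coef_bound with n. Qed.

Lemma apply_kernel_lin (K : nat -> nat -> R) (c d : R) (x y : nat -> R) (i : nat) :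
  apply_kernel K (fun j => c * x j + d * y j) i = c * apply_kernel K x i + d * apply_kernel K y i.
Proof.
  unfold apply_kernel; rewrite <- !rsum_scal, <- rsum_plus; apply rsum_ext; intros; ring.
Qed.

Lemma apply_kernel_ext (K : nat -> nat -> R) (x y : nat -> R) (i : nat) :
  (forall j, x j = y j) -> apply_kernel K x i = apply_kernel K y i.
Proof. intros E; apply rsum_ext; intros; now rewrite E. Qed.

Lemma kop_plus (K : nat -> nat -> R) (HK : contractive_kernel K) (f g : H2) :
  kop K HK (h2_plus f g) = h2_plus (kop K HK f) (kop K HK g).
Proof.
  apply H2_ext; intros i; apply C_ext.
  - transitivity (1 * apply_kernel K (fun j => Re (h2_coef f j)) i +
                  1 * apply_kernel K (fun j => Re (h2_coef g j)) i);
      [ | rewrite !Rmult_1_l; reflexivity].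
    rewrite <- apply_kernel_lin; apply apply_kernel_ext; intros j; unfold Re, Im; simpl; ring.
  - transitivity (1 * apply_kernel K (fun j => Im (h2_coef f j)) i +
                  1 * apply_kernel K (fun j => Im (h2_coef g j)) i);
      [ | rewrite !Rmult_1_l; reflexivity].
    rewrite <- apply_kernel_lin; apply apply_kernel_ext; intros j; unfold Re, Im; simpl; ring.
Qed.

Lemma kop_scal (K : nat -> nat -> R) (HK : contractive_kernel K) (c : C) (f : H2) :
  kop K HK (h2_scal c f) = h2_scal c (kop K HK f).
Proof.
  apply H2_ext; intros i; apply C_ext.
  - transitivity (Re c * apply_kernel K (fun j => Re (h2_coef f j)) i +
                  - Im c * apply_kernel K (fun j => Im (h2_coef f j)) i);
      [ | rewrite <- Ropp_mult_distr_l; reflexivity].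
    rewrite <- apply_kernel_lin; apply apply_kernel_ext; intros j; unfold Re, Im; simpl; ring.
  - transitivity (Re c * apply_kernel K (fun j => Im (h2_coef f j)) i +
                  Im c * apply_kernel K (fun j => Re (h2_coef f j)) i); [ | reflexivity].
    rewrite <- apply_kernel_lin; apply apply_kernel_ext; intros j; unfold Re, Im; simpl; ring.
Qed.

Lemma pow2_le_inv (x y : R) : 0 <= y -> x ^ 2 <= y ^ 2 -> x <= y.
Proof. intros Hy L; apply Rsqr_incr_0_var; auto; rewrite !Rsqr_pow2; auto. Qed.

Lemma kop_linear (K : nat -> nat -> R) (HK : contractive_kernel K) :
  is_linear (K := C_AbsRing) (U := H2_NormedModule) (V := H2_NormedModule) (kop K HK).
Proof.
  split.
  - exact (kop_plus K HK).
  - exact (kop_scal K HK).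
  - exists 1; split; [lra | intros f].
    change (h2_norm (kop K HK f) <= 1 * h2_norm f); rewrite Rmult_1_l.
    apply pow2_le_inv; [apply h2_norm_ge_0 | ].
    rewrite <- (Rmult_1_l (h2_norm f ^ 2)); apply (kop_tail_norm K HK 0); [apply HK | lia].
Qed.

Lemma minus_plus_plus {G : AbelianGroup} (a b c d : G) :
  minus (plus a b) (plus c d) = plus (minus a c) (minus b d).
Proof.
  unfold minus; rewrite opp_plus, <- !plus_assoc; f_equal.
  rewrite !plus_assoc; f_equal; apply plus_comm.
Qed.

Section ApproximationNumbers.

Context {U V : NormedModule C_AbsRing}.

Lemma op_norm_le (T : U -> V) (M : R) :
  0 <= M -> (forall x, norm x <= 1 -> norm (T x) <= M) -> op_norm T <= M.
Proof.
  intros HM H; unfold op_norm; set (E := fun r => _).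
  destruct (Lub_Rbar_correct E) as [_ Hl].
  specialize (Hl (Finite M)); destruct (Lub_Rbar E) as [r | | ]; simpl in *; auto.
  apply Hl; intros y [x [Hx ->]]; simpl; now apply H.
Qed.

(** The bound [M] keeps the supremum finite; [real] would send an infinite one to 0. *)
Lemma op_norm_ge (T : U -> V) (M : R) (x : U) :
  (forall x, norm x <= 1 -> norm (T x) <= M) -> norm x <= 1 -> norm (T x) <= op_norm T.
Proof.
  intros HM Hx; unfold op_norm; set (E := fun r => _).
  destruct (Lub_Rbar_correct E) as [Hu Hl].
  specialize (Hl (Finite M)).
  assert (L : Rbar_le (Lub_Rbar E) M) by (apply Hl; intros y [z [Hz ->]]; simpl; now apply HM).
  assert (G : Rbar_le (norm (T x)) (Lub_Rbar E)) by (apply Hu; now exists x).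
  destruct (Lub_Rbar E); simpl in *; auto; contradiction.
Qed.

Lemma op_norm_ge0 (T : U -> V) : 0 <= op_norm T.
Proof.
  unfold op_norm; set (E := fun r => _).
  destruct (Lub_Rbar_correct E) as [Hu _].
  assert (G : Rbar_le (norm (T zero)) (Lub_Rbar E)).
  { apply Hu; exists zero; split; [rewrite norm_zero; lra | reflexivity]. }
  pose proof (norm_ge_0 (T zero)).
  destruct (Lub_Rbar E); simpl in *; lra.
Qed.

Lemma is_linear_minus (S T : U -> V) :
  is_linear S -> is_linear T -> is_linear (fun x => minus (S x) (T x)).
Proof.
  intros HS HT; split.
  - intros x y; rewrite (linear_plus S HS), (linear_plus T HT).
    exact (minus_plus_plus (G := V) (S x) (S y) (T x) (T y)).
  - intros k x; rewrite (linear_scal S HS), (linear_scal T HT).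
    symmetry; exact (scal_minus_distr_l (V := NormedModule.ModuleSpace C_AbsRing V) k (S x) (T x)).
  - destruct (linear_norm S HS) as [A [HA HA']], (linear_norm T HT) as [B [HB HB']].
    exists (A + B); split; [lra | intros x].
    eapply Rle_trans; [apply norm_triangle | rewrite norm_opp].
    specialize (HA' x); specialize (HB' x); lra.
Qed.

Lemma linear_unit_ball_bound (T : U -> V) :
  is_linear T -> exists M, forall x, norm x <= 1 -> norm (T x) <= M.
Proof.
  intros HT; destruct (linear_norm T HT) as [M [HM HT']]; exists M; intros x Hx.
  eapply Rle_trans; [apply HT' | nra].
Qed.

Lemma approx_number_le (T S : U -> V) (n : nat) (M : R) :
  is_linear S -> rank_lt n S -> 0 <= M ->
  (forall x, norm x <= 1 -> norm (minus (T x) (S x)) <= M) -> approx_number n T <= M.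
Proof.
  intros HS Hr HM H; apply Rle_trans with (op_norm (fun x => minus (T x) (S x)));
    [ | now apply op_norm_le].
  unfold approx_number; set (E := fun r => _).
  destruct (Glb_Rbar_correct E) as [Hl Hg].
  assert (L : Rbar_le (Glb_Rbar E) (op_norm (fun x => minus (T x) (S x))))
    by (apply Hl; now exists S).
  assert (G : Rbar_le 0 (Glb_Rbar E)).
  { apply Hg; intros r [S' [_ [_ ->]]]; apply op_norm_ge0. }
  destruct (Glb_Rbar E); simpl in *; auto; contradiction.
Qed.

Lemma is_linear_zero_fun : is_linear (fun _ : U => (zero : V)).
Proof.
  split.
  - intros; now rewrite plus_zero_l.
  - intros k x; symmetry; exact (scal_zero_r (V := NormedModule.ModuleSpace C_AbsRing V) k).
  - exists 1; split; [lra | intros x].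
    rewrite norm_zero; pose proof (norm_ge_0 x); lra.
Qed.

(** For [n > 0] the zero operator competes, which makes the infimum finite; over an empty set it
    would be [p_infty], and [real] would return 0. *)
Lemma approx_number_ge (T : U -> V) (n : nat) (M : R) :
  (0 < n)%nat ->
  (forall S, is_linear S -> rank_lt n S -> M <= op_norm (fun x => minus (T x) (S x))) ->
  M <= approx_number n T.
Proof.
  intros Hn H; unfold approx_number; set (E := fun r => _).
  destruct (Glb_Rbar_correct E) as [Hl Hg].
  assert (L : Rbar_le (Glb_Rbar E) (op_norm (fun x => minus (T x) (zero : V)))).
  { apply Hl; exists (fun _ => zero); split; [apply is_linear_zero_fun | split; [ | reflexivity]].
    exists O, (fun _ => zero); split; auto; intros x; exists (fun _ => RtoC 0).
    now rewrite sum_n_m_zero by lia. }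
  assert (G : Rbar_le M (Glb_Rbar E)) by (apply Hg; intros r [S [HS [Hr ->]]]; simpl; auto).
  destruct (Glb_Rbar E); simpl in *; auto; contradiction.
Qed.

Fixpoint msum (u : nat -> U) (n : nat) : U :=
  match n with O => zero | S n => plus (msum u n) (u n) end.

Lemma msum_ext (u v : nat -> U) (n : nat) :
  (forall i, (i < n)%nat -> u i = v i) -> msum u n = msum v n.
Proof.
  induction n as [ | n IH]; intros E; simpl; [reflexivity | ].
  rewrite IH, E by (intros; try apply E; lia); reflexivity.
Qed.

Lemma msum_plus (u v : nat -> U) (n : nat) :
  msum (fun i => plus (u i) (v i)) n = plus (msum u n) (msum v n).
Proof.
  induction n as [ | n IH]; simpl; [now rewrite plus_zero_l | ].
  rewrite IH, <- !plus_assoc; f_equal; rewrite !plus_assoc; f_equal; apply plus_comm.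
Qed.

End ApproximationNumbers.

Lemma linear_msum {U V : NormedModule C_AbsRing} (T : U -> V) (u : nat -> U) (n : nat) :
  is_linear T -> T (msum u n) = msum (fun i => T (u i)) n.
Proof.
  intros HT; induction n as [ | n IH]; simpl; [apply linear_zero; auto | ].
  now rewrite (linear_plus T HT), IH.
Qed.

(** * Homogeneous linear systems and kernels of operators of small rank *)

Fixpoint csum (f : nat -> C) (n : nat) : C :=
  match n with O => RtoC 0 | S n => (csum f n + f n)%C end.

Lemma csum_ext (f g : nat -> C) (n : nat) :
  (forall k, (k < n)%nat -> f k = g k) -> csum f n = csum g n.
Proof.
  induction n as [ | n IH]; intros H; simpl; [reflexivity | ].
  rewrite IH, (H n) by (intros; try apply H; lia); reflexivity.
Qed.

Lemma csum_eq0 (f : nat -> C) (n : nat) :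
  (forall k, (k < n)%nat -> f k = RtoC 0) -> csum f n = RtoC 0.
Proof.
  induction n as [ | n IH]; intros H; simpl; [reflexivity | ].
  rewrite IH, (H n) by (intros; try apply H; lia); ring.
Qed.

Lemma csum_minus_scal (f g : nat -> C) (c : C) (n : nat) :
  csum (fun k => f k - g k * c)%C n = (csum f n - csum g n * c)%C.
Proof. induction n as [ | n IH]; simpl; [ring | rewrite IH; ring]. Qed.

(** Enumeration of the indices other than [p], for removing the pivot unknown. *)
Definition skip (p i : nat) : nat := if (i <? p)%nat then i else S i.

Definition unskip (p j : nat) : nat := if (j <? p)%nat then j else pred j.

Lemma unskip_skip (p i : nat) : unskip p (skip p i) = i.
Proof.
  unfold unskip, skip; destruct (Nat.ltb_spec i p) as [L | L].
  - now apply Nat.ltb_lt in L; rewrite L.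
  - destruct (Nat.ltb_spec (S i) p); [lia | reflexivity].
Qed.

Lemma skip_neq (p i : nat) : skip p i <> p.
Proof. unfold skip; destruct (Nat.ltb_spec i p); lia. Qed.

Lemma skip_lt (p i n : nat) : (i < n)%nat -> (skip p i < S n)%nat.
Proof. unfold skip; destruct (Nat.ltb_spec i p); lia. Qed.

Lemma csum_skip (f : nat -> C) (p n : nat) :
  (p <= n)%nat -> csum f (S n) = (f p + csum (fun i => f (skip p i)) n)%C.
Proof.
  induction n as [ | n IH]; intros L.
  - replace p with O by lia; simpl; ring.
  - destruct (Nat.eq_dec p (S n)) as [-> | N].
    + rewrite (csum_ext (fun i => f (skip (S n) i)) f); [simpl; ring | ].
      intros k Lk; unfold skip; apply Nat.ltb_lt in Lk; now rewrite Lk.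
    + change (csum f (S (S n))) with (csum f (S n) + f (S n))%C; rewrite IH by lia.
      cbn [csum]; replace (skip p n) with (S n); [ring | ].
      unfold skip; destruct (Nat.ltb_spec n p); [lia | reflexivity].
Qed.

(** Gaussian elimination on the last equation: a pivot unknown is substituted into the other
    equations, leaving one equation and one unknown less. Without a pivot the last equation holds
    trivially. *)
Lemma homogeneous_system (k n : nat) (m : nat -> nat -> C) :
  (k < n)%nat -> exists al : nat -> C, (exists i, (i < n)%nat /\ al i <> RtoC 0) /\
    forall l, (l < k)%nat -> csum (fun i => al i * m i l)%C n = RtoC 0.
Proof.
  revert n m; induction k as [ | k IH]; intros n m L.
  - exists (fun _ => RtoC 1); split; [exists O; split; [lia | ] | lia].
    intros E; apply RtoC_inj in E; lra.
  - destruct (classic (exists p, (p < n)%nat /\ m p k <> RtoC 0)) as [[p [Lp Hp]] | N].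
    + destruct n as [ | n]; [lia | ].
      destruct (IH n (fun i l => m (skip p i) l - m (skip p i) k / m p k * m p l)%C ltac:(lia))
        as (al & (i0 & Li0 & Hi0) & Hal).
      set (piv := (- (csum (fun i => al i * m (skip p i) k) n / m p k))%C).
      exists (fun j => if (j =? p)%nat then piv else al (unskip p j)); split.
      * exists (skip p i0); split; [now apply skip_lt | ].
        pose proof (skip_neq p i0) as Hs; apply Nat.eqb_neq in Hs; rewrite Hs.
        now rewrite unskip_skip.
      * intros l Ll; rewrite (csum_skip _ p n), Nat.eqb_refl by lia.
        rewrite (csum_ext _ (fun i => al i * m (skip p i) l)%C).
        2:{ intros i _; pose proof (skip_neq p i) as Hs; apply Nat.eqb_neq in Hs; rewrite Hs.
            now rewrite unskip_skip. }
        destruct (Nat.eq_dec l k) as [-> | Nl]; [unfold piv; field; auto | ].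
        specialize (Hal l ltac:(lia)).
        rewrite (csum_ext _ (fun i => al i * m (skip p i) l -
                   (al i * m (skip p i) k) * (m p l / m p k))%C) in Hal
          by (intros; field; auto).
        rewrite csum_minus_scal in Hal; rewrite <- Hal; unfold piv; field; auto.
    + destruct (IH n m ltac:(lia)) as (al & Hnz & Hal); exists al; split; auto.
      intros l Ll; destruct (Nat.eq_dec l k) as [-> | Nl]; [ | apply Hal; lia].
      apply csum_eq0; intros i Li; replace (m i k) with (RtoC 0); [ring | ].
      symmetry; apply NNPP; intros Hne; apply N; eauto.
Qed.

Lemma msum_scal_vec {V : NormedModule C_AbsRing} (c : nat -> C) (v : V) (n : nat) :
  msum (fun i => scal (c i : C_AbsRing) v) n = scal (csum c n : C_AbsRing) v.
Proof.
  induction n as [ | n IH]; simpl.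
  - symmetry; exact (scal_zero_l (V := NormedModule.ModuleSpace C_AbsRing V) v).
  - rewrite IH; symmetry.
    exact (scal_distr_r (V := NormedModule.ModuleSpace C_AbsRing V) (csum c n) (c n) v).
Qed.

Lemma msum_zero {V : NormedModule C_AbsRing} (n : nat) : msum (fun _ => (zero : V)) n = zero.
Proof. induction n as [ | n IH]; simpl; [reflexivity | rewrite IH; exact (plus_zero_l (G := V) zero)].
Qed.

Lemma msum_sum_n_m {V : NormedModule C_AbsRing} (al : nat -> C) (c : nat -> nat -> C)
    (v : nat -> V) (n k : nat) :
  msum (fun i => scal (al i : C_AbsRing)
                   (sum_n_m (fun l => scal (c i l : C_AbsRing) (v l)) 1 k)) n =
  sum_n_m (fun l => scal (csum (fun i => al i * c i l)%C n : C_AbsRing) (v l)) 1 k.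
Proof.
  induction k as [ | k IH].
  - rewrite sum_n_m_zero by lia.
    transitivity (msum (fun _ => (zero : V)) n); [ | apply msum_zero].
    apply msum_ext; intros i _; rewrite sum_n_m_zero by lia.
    exact (scal_zero_r (V := NormedModule.ModuleSpace C_AbsRing V) (al i)).
  - transitivity (plus
      (msum (fun i => scal (al i : C_AbsRing)
                        (sum_n_m (fun l => scal (c i l : C_AbsRing) (v l)) 1 k)) n)
      (msum (fun i => scal ((al i * c i (S k))%C : C_AbsRing) (v (S k))) n)).
    + etransitivity; [ | apply msum_plus]; apply msum_ext; intros i _.
      rewrite sum_n_Sm by lia.
      etransitivity; [exact (scal_distr_l (V := NormedModule.ModuleSpace C_AbsRing V) _ _ _) | ].
      f_equal.
      exact (scal_assoc (V := NormedModule.ModuleSpace C_AbsRing V) (al i) (c i (S k)) (v (S k))).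
    + rewrite IH, msum_scal_vec, sum_n_Sm by lia; reflexivity.
Qed.

(** In [rank_lt] the coordinates are not given as linear functions of the vector, so they are chosen
    for each [u i] separately; linearity of [S] then leaves fewer equations than unknowns. *)
Lemma rank_lt_kernel {U V : NormedModule C_AbsRing} (S : U -> V) (u : nat -> U) (n : nat) :
  is_linear S -> rank_lt n S ->
  exists al : nat -> C, (exists i, (i < n)%nat /\ al i <> RtoC 0) /\
    S (msum (fun i => scal (al i : C_AbsRing) (u i)) n) = zero.
Proof.
  intros HS (k & v & Lk & Hv).
  set (c := fun i => proj1_sig (constructive_indefinite_description _ (Hv (u i)))).
  assert (Hc : forall i, S (u i) = sum_n_m (fun l => scal (c i l : C_AbsRing) (v l)) 1 k)
    by (intros i; unfold c; now destruct (constructive_indefinite_description _ _)).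
  destruct (homogeneous_system k n (fun i l => c i (Datatypes.S l)) Lk) as (al & Hnz & Hal).
  exists al; split; auto.
  rewrite linear_msum by auto.
  rewrite (msum_ext _ (fun i => scal (al i : C_AbsRing)
    (sum_n_m (fun l => scal (c i l : C_AbsRing) (v l)) 1 k))).
  - rewrite msum_sum_n_m.
    rewrite (sum_n_m_ext_loc _ (fun _ => zero)); [apply sum_n_m_const_zero | ].
    intros [ | l] Ll; [lia | ]; rewrite Hal by lia.
    exact (scal_zero_l (V := NormedModule.ModuleSpace C_AbsRing V) (v (Datatypes.S l))).
  - intros i _; rewrite (linear_scal S HS), Hc; reflexivity.
Qed.

(** * Disjoint supports and the lower bound for approximation numbers *)

Definition disjoint_support (f g : H2) : Prop :=
  forall i, h2_coef f i = RtoC 0 \/ h2_coef g i = RtoC 0.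

Lemma h2_pythagoras (f g : H2) :
  disjoint_support f g -> h2_norm (h2_plus f g) ^ 2 = h2_norm f ^ 2 + h2_norm g ^ 2.
Proof.
  intros D; rewrite !h2_norm_sq, <- Series_plus by apply h2_summable.
  apply Series_ext; intros i; simpl h2_coef.
  destruct (D i) as [E | E]; rewrite E, Cmod_0.
  - rewrite Cplus_0_l; ring.
  - rewrite Cplus_0_r; ring.
Qed.

Definition h2_comb (al : nat -> C) (u : nat -> H2) (n : nat) : H2 :=
  msum (U := H2_NormedModule) (fun l => scal (al l : C_AbsRing) (u l : H2_NormedModule)) n.

Lemma h2_comb_S (al : nat -> C) (u : nat -> H2) (n : nat) :
  h2_comb al u (S n) = h2_plus (h2_comb al u n) (h2_scal (al n) (u n)).
Proof. reflexivity. Qed.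

Lemma h2_comb_coef0 (al : nat -> C) (u : nat -> H2) (n i : nat) :
  (forall l, (l < n)%nat -> h2_coef (u l) i = RtoC 0) -> h2_coef (h2_comb al u n) i = RtoC 0.
Proof.
  induction n as [ | n IH]; intros H; [reflexivity | ].
  rewrite h2_comb_S; simpl h2_coef; rewrite IH, (H n) by (intros; try apply H; lia); ring.
Qed.

Lemma h2_comb_norm (al : nat -> C) (u : nat -> H2) (n : nat) :
  (forall l l', (l < n)%nat -> (l' < n)%nat -> l <> l' -> disjoint_support (u l) (u l')) ->
  h2_norm (h2_comb al u n) ^ 2 = rsum (fun l => Cmod (al l) ^ 2 * h2_norm (u l) ^ 2) n.
Proof.
  induction n as [ | n IH]; intros D.
  - change (h2_norm h2_zero ^ 2 = 0); rewrite h2_norm_zero; ring.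
  - rewrite h2_comb_S, h2_pythagoras, h2_norm_scal, Rpow_mult_distr, IH; [reflexivity | | ].
    + intros; apply D; lia.
    + intros i; destruct (classic (h2_coef (u n) i = RtoC 0)) as [E | N].
      * right; simpl; rewrite E; ring.
      * left; apply h2_comb_coef0; intros l L.
        destruct (D l n ltac:(lia) ltac:(lia) ltac:(lia) i); tauto.
Qed.

(** By Pythagoras before and after [T], norms shrink at most by [sqrt gam] on the whole span of the
    [u l]. The span has dimension [n], so every [S] of smaller rank kills some unit vector in it,
    where the difference of the operators is [T] itself. *)
Lemma approx_number_lower (T : H2 -> H2) (u : nat -> H2) (n : nat) (gam : R) :
  is_linear (K := C_AbsRing) (U := H2_NormedModule) (V := H2_NormedModule) T ->
  (0 < n)%nat -> 0 <= gam ->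
  (forall l l', (l < n)%nat -> (l' < n)%nat -> l <> l' -> disjoint_support (u l) (u l')) ->
  (forall l l', (l < n)%nat -> (l' < n)%nat -> l <> l' ->
     disjoint_support (T (u l)) (T (u l'))) ->
  (forall l, (l < n)%nat -> 0 < h2_norm (u l)) ->
  (forall l, (l < n)%nat -> gam * h2_norm (u l) ^ 2 <= h2_norm (T (u l)) ^ 2) ->
  sqrt gam <= approx_number (U := H2_NormedModule) (V := H2_NormedModule) n T.
Proof.
  intros HT Hn Hg Du DTu Hpos Hlow; apply approx_number_ge; auto; intros S HS HrS.
  destruct (rank_lt_kernel S u n HS HrS) as (al & (i0 & Li0 & Hi0) & Hker).
  set (w := h2_comb al u n); change (S w = zero) in Hker.
  assert (HTw : T w = h2_comb al (fun l => T (u l)) n).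
  { unfold w, h2_comb; rewrite (linear_msum (U := H2_NormedModule) (V := H2_NormedModule) T) by auto.
    apply msum_ext; intros l _; apply (linear_scal T HT). }
  assert (Hw : 0 < h2_norm w ^ 2).
  { unfold w; rewrite h2_comb_norm by auto.
    apply Rlt_le_trans with (rsum (fun l => Cmod (al l) ^ 2 * h2_norm (u l) ^ 2) (Datatypes.S i0)).
    - simpl rsum; set (r := rsum _ i0).
      assert (0 <= r) by (apply rsum_ge0; intros; apply Rmult_le_pos; apply pow2_ge_0).
      assert (0 < Cmod (al i0) ^ 2 * h2_norm (u i0) ^ 2)
        by (apply Rmult_lt_0_compat; apply pow_lt; [now apply Cmod_gt_0 | auto]).
      simpl in *; lra.
    - apply rsum_le_len; [intros; apply Rmult_le_pos; apply pow2_ge_0 | lia]. }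
  assert (Hw0 : 0 < h2_norm w).
  { destruct (h2_norm_ge_0 w) as [ | E]; auto; rewrite <- E in Hw; simpl in Hw; lra. }
  assert (HTwn : gam * h2_norm w ^ 2 <= h2_norm (T w) ^ 2).
  { rewrite HTw; unfold w; rewrite !h2_comb_norm, <- rsum_scal by auto.
    apply rsum_le; intros l Ll.
    replace (gam * (Cmod (al l) ^ 2 * h2_norm (u l) ^ 2))
      with (Cmod (al l) ^ 2 * (gam * h2_norm (u l) ^ 2)) by ring.
    apply Rmult_le_compat_l; [apply pow2_ge_0 | auto]. }
  assert (Hs : sqrt gam * h2_norm w <= h2_norm (T w)).
  { apply pow2_le_inv; [apply h2_norm_ge_0 | ].
    rewrite Rpow_mult_distr, pow2_sqrt by auto; exact HTwn. }
  pose proof (is_linear_minus T S HT HS) as HD.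
  destruct (linear_unit_ball_bound _ HD) as [M HM].
  set (x := h2_scal (RtoC (/ h2_norm w)) w).
  assert (Hinv : 0 < / h2_norm w) by now apply Rinv_0_lt_compat.
  assert (Hc : Cmod (RtoC (/ h2_norm w)) = / h2_norm w) by (rewrite Cmod_R, Rabs_pos_eq; lra).
  assert (Hx : h2_norm x = 1).
  { unfold x; rewrite h2_norm_scal, Hc; field; lra. }
  assert (Hx1 : @norm C_AbsRing H2_NormedModule x <= 1) by (change (h2_norm x <= 1); lra).
  assert (E : minus (T x) (S x) = T x :> H2_NormedModule).
  { assert (HSx : S x = zero).
    { unfold x; etransitivity; [exact (linear_scal S HS (RtoC (/ h2_norm w)) w) | ].
      rewrite Hker; exact (scal_zero_r (V := H2_ModuleSpace) _). }
    rewrite HSx; exact (minus_zero_r (G := H2_AbelianGroup) (T x)). }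
  eapply Rle_trans; [ | exact (op_norm_ge _ M x HM Hx1)].
  eapply Rle_trans; [ | exact (Req_le _ _ (eq_sym (f_equal h2_norm E)))].
  replace (T x) with (h2_scal (RtoC (/ h2_norm w)) (T w))
    by (symmetry; exact (linear_scal T HT (RtoC (/ h2_norm w)) w)).
  rewrite h2_norm_scal, Hc.
  apply Rmult_le_reg_r with (h2_norm w); auto.
  replace (/ h2_norm w * h2_norm (T w) * h2_norm w) with (h2_norm (T w)) by (field; lra); auto.
Qed.

(** * The symbol *)

Lemma is_derive_C_intro (f : C -> C) (x l : C) :
  (forall eps, 0 < eps -> exists d, 0 < d /\ forall y, Cmod (y - x) < d ->
     Cmod (f y - f x - (y - x) * l) <= eps * Cmod (y - x)) ->
  is_derive (K := C_AbsRing) (V := C_NormedModule) f x l.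
Proof.
  intros H; split; [apply is_linear_scal_l | ].
  intros x' Hx' eps.
  assert (E : x = x') by (apply (is_filter_lim_locally_unique (K := C_AbsRing)
                            (V := AbsRing_NormedModule C_AbsRing)); exact Hx').
  subst x'.
  destruct (H eps (cond_pos eps)) as [d [Hd HH]].
  exists (mkposreal d Hd); intros y Hy; exact (HH y Hy).
Qed.

Definition cser (t : nat -> C) : C :=
  (Series (fun n => Re (t n)), Series (fun n => Im (t n))).

Lemma ex_series_Re (t : nat -> C) :
  ex_series (fun n => Cmod (t n)) -> ex_series (fun n => Re (t n)).
Proof.
  intros H; apply ex_series_Rabs, ex_series_R_le with (2 := H).
  intros n; split; [apply Rabs_pos | apply Rabs_Re_le_Cmod].
Qed.

Lemma ex_series_Im (t : nat -> C) :
  ex_series (fun n => Cmod (t n)) -> ex_series (fun n => Im (t n)).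
Proof.
  intros H; apply ex_series_Rabs, ex_series_R_le with (2 := H).
  intros n; split; [apply Rabs_pos | apply Rabs_Im_le_Cmod].
Qed.

Lemma Cmod_le_Rabs (z : C) : Cmod z <= Rabs (Re z) + Rabs (Im z).
Proof.
  apply pow2_le_inv; [pose proof (Rabs_pos (Re z)); pose proof (Rabs_pos (Im z)); lra | ].
  rewrite Cmod_sq, <- (pow2_abs (Re z)), <- (pow2_abs (Im z)).
  pose proof (Rabs_pos (Re z)); pose proof (Rabs_pos (Im z)); nra.
Qed.

(** The factor 2 comes from bounding the real and imaginary parts separately. *)
Lemma Cmod_cser_le (t : nat -> C) (b : nat -> R) :
  (forall n, Cmod (t n) <= b n) -> ex_series b -> Cmod (cser t) <= 2 * Series b.
Proof.
  intros Ht Hb.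
  assert (H : forall u : nat -> R, (forall n, Rabs (u n) <= Cmod (t n)) ->
                Rabs (Series u) <= Series b).
  { intros u Hu.
    assert (Hub : forall n, 0 <= Rabs (u n) <= b n)
      by (intros n; split; [apply Rabs_pos | eapply Rle_trans; [apply Hu | apply Ht]]).
    eapply Rle_trans; [apply Series_Rabs, ex_series_R_le with (2 := Hb); auto | ].
    now apply Series_le. }
  eapply Rle_trans; [apply Cmod_le_Rabs | ].
  pose proof (H _ (fun n => Rabs_Re_le_Cmod (t n))).
  pose proof (H _ (fun n => Rabs_Im_le_Cmod (t n))); simpl in *; lra.
Qed.

Lemma cser_plus (t u : nat -> C) :
  ex_series (fun n => Cmod (t n)) -> ex_series (fun n => Cmod (u n)) ->
  cser (fun n => t n + u n)%C = (cser t + cser u)%C.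
Proof.
  intros Ht Hu; apply C_ext.
  - change (Series (fun n => Re (t n + u n)) =
            Series (fun n => Re (t n)) + Series (fun n => Re (u n))).
    rewrite <- Series_plus by now apply ex_series_Re.
    now apply Series_ext.
  - change (Series (fun n => Im (t n + u n)) =
            Series (fun n => Im (t n)) + Series (fun n => Im (u n))).
    rewrite <- Series_plus by now apply ex_series_Im.
    now apply Series_ext.
Qed.

Lemma cser_scal (c : C) (t : nat -> C) :
  ex_series (fun n => Cmod (t n)) -> cser (fun n => c * t n)%C = (c * cser t)%C.
Proof.
  intros Ht; apply C_ext.
  - change (Series (fun n => Re (c * t n)) =
            Re c * Series (fun n => Re (t n)) - Im c * Series (fun n => Im (t n))).
    rewrite <- !Series_scal_l, <- Series_minus
      by (apply ex_series_R_scal; auto using ex_series_Re, ex_series_Im).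
    now apply Series_ext.
  - change (Series (fun n => Im (c * t n)) =
            Re c * Series (fun n => Im (t n)) + Im c * Series (fun n => Re (t n))).
    rewrite <- !Series_scal_l, <- Series_plus
      by (apply ex_series_R_scal; auto using ex_series_Re, ex_series_Im).
    now apply Series_ext.
Qed.

Lemma cser_ext (t u : nat -> C) : (forall n, t n = u n) -> cser t = cser u.
Proof. intros E; unfold cser; f_equal; apply Series_ext; intros; now rewrite E. Qed.

(** * The complex exponential to second order *)

Lemma Cexp_plus (z w : C) : Cexp (z + w) = (Cexp z * Cexp w)%C.
Proof.
  apply C_ext; unfold Cexp, Re, Im; simpl; rewrite exp_plus; [rewrite cos_plus | rewrite sin_plus]; ring.
Qed.

Lemma Cexp_0 : Cexp (RtoC 0) = RtoC 1.
Proof. unfold Cexp; simpl; rewrite exp_0, cos_0, sin_0; apply C_ext; simpl; ring. Qed.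

Lemma Cexp_pow (z : C) (k : nat) : (Cexp z ^ k)%C = Cexp (INR k * z).
Proof.
  induction k as [ | k IH].
  - simpl INR; replace (RtoC 0 * z)%C with (RtoC 0) by ring; now rewrite Cexp_0.
  - rewrite Cpow_S, IH, <- Cexp_plus; f_equal; rewrite S_INR, RtoC_plus; ring.
Qed.

Lemma Cmod_Cexp (z : C) : Cmod (Cexp z) = exp (Re z).
Proof.
  rewrite <- (Rabs_pos_eq (Cmod _)) by apply Cmod_ge_0.
  rewrite <- (Rabs_pos_eq (exp _)) by (apply Rlt_le, exp_pos).
  apply Rsqr_eq_abs_0; rewrite !Rsqr_pow2, Cmod_sq; unfold Cexp; simpl.
  pose proof (sin2_cos2 (Im z)) as H; unfold Rsqr in H.
  transitivity (exp (Re z) * exp (Re z) * (sin (Im z) * sin (Im z) + cos (Im z) * cos (Im z)));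
    [ | rewrite H]; unfold Re, Im; ring.
Qed.

Lemma npow_opp_Cexp (n : nat) (s : C) : npow_opp n s = Cexp (- s * ln (INR n)).
Proof.
  unfold npow_opp, Cexp; apply C_ext; simpl.
  - rewrite <- (cos_neg (snd s * _)); f_equal; [f_equal; unfold Re; ring | f_equal; ring].
  - rewrite Ropp_mult_distr_r, <- sin_neg; f_equal; [f_equal; unfold Re; ring | f_equal; unfold Im; ring].
Qed.

Lemma Rabs_exp_minus_1 (x : R) : Rabs (exp x - 1) <= Rabs x * exp (Rabs x).
Proof.
  destruct (Rle_or_lt 0 x) as [Hx | Hx].
  - rewrite !Rabs_pos_eq; auto; [ | pose proof (exp_ineq1_le x); lra].
    pose proof (exp_ineq1_le (- x)) as H; pose proof (exp_pos x).
    assert (E : exp x * exp (- x) = 1) by (rewrite <- exp_plus, Rplus_opp_r; apply exp_0).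
    nra.
  - rewrite (Rabs_left x), Rabs_left1 by
      (auto; rewrite <- exp_0; apply Rle_minus, exp_le_compat; lra).
    pose proof (exp_ineq1_le x); pose proof (exp_ineq1_le (- x)); nra.
Qed.

Lemma Rabs_exp_minus_1_minus (x : R) : Rabs (exp x - 1 - x) <= x ^ 2 * exp (Rabs x).
Proof.
  pose proof (exp_ineq1_le x); rewrite Rabs_pos_eq by lra.
  apply Rle_trans with (x * (exp x - 1)).
  - pose proof (exp_ineq1_le (- x)) as H1; pose proof (exp_pos x).
    assert (E : exp x * exp (- x) = 1) by (rewrite <- exp_plus, Rplus_opp_r; apply exp_0).
    nra.
  - apply Rle_trans with (1 := Rle_abs _); rewrite Rabs_mult.
    pose proof (Rabs_exp_minus_1 x); pose proof (Rabs_pos x).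
    replace (x ^ 2) with (Rabs x * Rabs x) by (rewrite <- Rabs_mult, Rabs_pos_eq; nra).
    nra.
Qed.

Lemma Rabs_sin_le (x : R) : Rabs (sin x) <= Rabs x.
Proof.
  assert (Hpos : forall y, 0 <= y -> Rabs (sin y) <= y).
  { intros y [Hy | <-]; [ | rewrite sin_0, Rabs_R0; lra].
    pose proof (sin_lt_x y Hy); pose proof (SIN_bound y).
    destruct (Rle_or_lt y 1) as [H1 | H1].
    - rewrite Rabs_pos_eq; [lra | ]; apply sin_ge_0; [lra | pose proof PI2_1; lra].
    - apply Rabs_le; lra. }
  destruct (Rle_or_lt 0 x) as [Hx | Hx].
  - rewrite (Rabs_pos_eq x) by auto; auto.
  - rewrite (Rabs_left x), <- Rabs_Ropp, <- sin_neg by auto; apply Hpos; lra.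
Qed.

Lemma Rabs_cos_minus_1 (x : R) : Rabs (cos x - 1) <= x ^ 2.
Proof.
  replace (cos x - 1) with (- (2 * (sin (x / 2) * sin (x / 2)))).
  - pose proof (Rabs_sin_le (x / 2)) as H; rewrite Rabs_Ropp, !Rabs_mult, (Rabs_pos_eq 2) by lra.
    pose proof (Rabs_pos (sin (x / 2))).
    assert (Rabs (x / 2) * Rabs (x / 2) = x ^ 2 / 4).
    { rewrite <- Rabs_mult, Rabs_pos_eq; [field | ].
      replace (x / 2 * (x / 2)) with ((x / 2) ^ 2) by ring; apply pow2_ge_0. }
    pose proof (pow2_ge_0 x); nra.
  - replace (cos x) with (cos (2 * (x / 2))) by (f_equal; field); rewrite cos_2a_sin; ring.
Qed.

Lemma Rabs_sin_minus (x : R) : Rabs (sin x - x) <= 2 * x ^ 2.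
Proof.
  pose proof (Rabs_pos x); rewrite <- (pow2_abs x).
  destruct (Rle_or_lt 2 (Rabs x)) as [Hx | Hx].
  - apply Rle_trans with (Rabs (sin x) + Rabs x).
    + unfold Rminus; eapply Rle_trans; [apply Rabs_triang | rewrite Rabs_Ropp; lra].
    + pose proof (Rabs_sin_le x); nra.
  - destruct (MVT_gen (fun t => sin t - t) 0 x (fun t => cos t - 1)) as [c [Hc E]].
    + intros t _; auto_derive; [auto | ring].
    + intros t _; apply continuity_pt_minus; [apply continuity_sin | apply continuity_pt_id].
    + rewrite sin_0, !Rminus_0_r in E; rewrite E, Rabs_mult.
      assert (Hcx : Rabs c <= Rabs x).
      { destruct (Rle_or_lt 0 x) as [H0 | H0].
        - rewrite Rmin_left, Rmax_right in Hc by lra; rewrite !Rabs_pos_eq; lra.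
        - rewrite Rmin_right, Rmax_left in Hc by lra; rewrite !Rabs_left1; lra. }
      pose proof (Rabs_cos_minus_1 c) as Hcos; rewrite <- (pow2_abs c) in Hcos.
      pose proof (Rabs_pos c).
      assert (Rabs (cos c - 1) <= 2 * Rabs x) by nra; nra.
Qed.

(** The real part is [(exp x - 1 - x) + exp x * (cos y - 1)], the imaginary part
    [exp x * (sin y - y) + y * (exp x - 1)]; the four terms account for 1 + 1 + 2 + 1 = 5. The
    factor [exp (Cmod u)] is explicit because the bound is applied to [n u] for all [n] and then
    summed. *)
Lemma Cexp_second_order (u : C) :
  Cmod (Cexp u - 1 - u) <= 5 * (Cmod u ^ 2 * exp (Cmod u)).
Proof.
  set (x := Re u); set (y := Im u).
  assert (Hx : Rabs x <= Cmod u) by apply Rabs_Re_le_Cmod.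
  assert (Hy : Rabs y <= Cmod u) by apply Rabs_Im_le_Cmod.
  pose proof (Cmod_ge_0 u) as H0; pose proof (Rabs_pos x); pose proof (Rabs_pos y).
  assert (Ex : exp (Rabs x) <= exp (Cmod u)) by now apply exp_le_compat.
  assert (Ex' : exp x <= exp (Cmod u))
    by (apply exp_le_compat; pose proof (Rle_abs x); lra).
  pose proof (exp_pos x); pose proof (exp_pos (Rabs x)); pose proof (exp_pos (Cmod u)).
  set (E := exp (Cmod u)) in *; set (m := Cmod u) in *.
  assert (Hx2 : x ^ 2 <= m ^ 2) by (apply pow_maj_Rabs; lra).
  assert (Hy2 : y ^ 2 <= m ^ 2) by (apply pow_maj_Rabs; lra).
  assert (R1 : Rabs (exp x - 1 - x) <= m ^ 2 * E).
  { eapply Rle_trans; [apply Rabs_exp_minus_1_minus | ].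
    apply Rmult_le_compat; auto; [apply pow2_ge_0 | lra]. }
  assert (R2 : Rabs (exp x * (cos y - 1)) <= m ^ 2 * E).
  { rewrite Rabs_mult, (Rabs_pos_eq (exp x)), Rmult_comm by lra.
    apply Rmult_le_compat; auto using Rabs_pos; [lra | ].
    eapply Rle_trans; [apply Rabs_cos_minus_1 | auto]. }
  assert (R3 : Rabs (exp x * (sin y - y)) <= 2 * m ^ 2 * E).
  { rewrite Rabs_mult, (Rabs_pos_eq (exp x)), Rmult_comm by lra.
    apply Rmult_le_compat; auto using Rabs_pos; [lra | ].
    eapply Rle_trans; [apply Rabs_sin_minus | lra]. }
  assert (R4 : Rabs (y * (exp x - 1)) <= m ^ 2 * E).
  { rewrite Rabs_mult; pose proof (Rabs_exp_minus_1 x); pose proof (Rabs_pos (exp x - 1)).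
    apply Rle_trans with (m * (m * E)); [ | apply Req_le; ring].
    apply Rmult_le_compat; auto.
    eapply Rle_trans; [eassumption | apply Rmult_le_compat; lra]. }
  eapply Rle_trans; [apply Cmod_le_Rabs | ].
  replace (Re (Cexp u - 1 - u)) with ((exp x - 1 - x) + exp x * (cos y - 1))
    by (unfold x, y, Cexp; simpl; unfold Re, Im; ring).
  replace (Im (Cexp u - 1 - u)) with (exp x * (sin y - y) + y * (exp x - 1))
    by (unfold x, y, Cexp; simpl; unfold Re, Im; ring).
  pose proof (Rabs_triang (exp x - 1 - x) (exp x * (cos y - 1))).
  pose proof (Rabs_triang (exp x * (sin y - y)) (y * (exp x - 1))).
  lra.
Qed.

Lemma ex_series_sq_geom (x : R) : 0 <= x < 1 -> ex_series (fun n => INR n ^ 2 * x ^ n).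
Proof.
  intros Hx.
  assert (H : Rbar_lt (Rabs 1) (CV_radius (fun n => 1 * x ^ n))).
  { apply (CV_radius_geom_bound (fun _ => 1) (fun n => x ^ n) 1 x 1); auto; try lra.
    - intros; rewrite Rabs_pos_eq; lra.
    - intros n; rewrite Rabs_pos_eq; [apply Rle_refl | apply pow_le; lra]. }
  rewrite <- CV_radius_derive, <- CV_radius_derive in H.
  apply CV_disk_inside in H.
  apply (ex_series_incr_n (fun n => INR n ^ 2 * x ^ n) 2).
  apply ex_series_R_le with (2 := ex_series_R_scal 2 _ H); intros n.
  replace (2 + n)%nat with (S (S n)) by lia.
  assert (Hp : 0 <= x ^ S (S n)) by (apply pow_le; lra).
  split; [apply Rmult_le_pos; auto; apply pow2_ge_0 | ].
  unfold PS_derive; rewrite pow1, !Rmult_1_r, Rmult_1_l.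
  pose proof (pos_INR n).
  rewrite Rabs_pos_eq;
    [ | rewrite !S_INR; apply Rmult_le_pos; [lra | apply Rmult_le_pos; [lra | exact Hp]]].
  replace (2 * (INR (S n) * (INR (S (S n)) * x ^ S (S n))))
    with (2 * (INR (S n) * INR (S (S n))) * x ^ S (S n)) by ring.
  apply Rmult_le_compat_r; auto; rewrite !S_INR; nra.
Qed.

Definition symbol (a : nat -> R) (s : C) : C := (s - logfun a (npow_opp 2 s) / ln 2)%C.

Lemma INR_2 : INR 2 = 2.
Proof. simpl; ring. Qed.

Lemma Cmod_npow_2 (s : C) : Cmod (npow_opp 2 s) = exp (- (Re s * ln 2)).
Proof. now rewrite Cmod_npow_opp, INR_2. Qed.

Lemma Cmod_npow_2_lt1 (s : C) : half_plane s -> Cmod (npow_opp 2 s) < 1.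
Proof.
  unfold half_plane; intros Hs; rewrite Cmod_npow_2, <- exp_0; apply exp_increasing.
  pose proof ln2_pos; nra.
Qed.

Lemma ex_series_R_geom (M x : R) : 0 <= x < 1 -> ex_series (fun n => M * x ^ n).
Proof. intros Hx; apply ex_series_R_scal, ex_series_geom; rewrite Rabs_pos_eq; lra. Qed.

Lemma logfun_cser (a : nat -> R) (z : C) :
  logfun a z = cser (fun n => RtoC (logcoef a n) * z ^ n)%C.
Proof.
  unfold logfun, cser; f_equal; apply Series_ext; intros n.
  - rewrite Re_Cmult; simpl; ring.
  - rewrite Im_Cmult; simpl; ring.
Qed.

Lemma logfun_abs_summable (a : nat -> R) (z : C) :
  log_convex_law a -> Cmod z < 1 -> ex_series (fun n => Cmod (RtoC (logcoef a n) * z ^ n)).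
Proof.
  intros Ha Hz; destruct (logcoef_bounded a Ha) as [M HM].
  assert (Hx : 0 <= Cmod z < 1) by (split; [apply Cmod_ge_0 | auto]).
  apply ex_series_R_le with (2 := ex_series_R_geom M (Cmod z) Hx); intros n.
  split; [apply Cmod_ge_0 | rewrite Cmod_mult, Cmod_R, Cmod_pow].
  apply Rmult_le_compat_r; auto; apply pow_le, Cmod_ge_0.
Qed.

(** From index 1 on the coefficients of [log A] are nonnegative, so the real part of [log A(z)] is
    at most [log A(|z|)], and [A] is at most 1 on [[0, 1)]. Hence the symbol never decreases the
    real part. *)
Lemma Re_logfun_le0 (a : nat -> R) (z : C) :
  log_convex_law a -> Cmod z < 1 -> Re (logfun a z) <= 0.
Proof.
  intros Ha Hz; set (x := Cmod z).
  assert (Hx : 0 <= x < 1) by (split; [apply Cmod_ge_0 | auto]).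
  assert (H1 : Re (logfun a (RtoC x)) <= 0).
  { destruct (powcoef_gf_real a 0 x Ha (Rle_refl 0) Hx) as [_ E].
    pose proof (gf_bounds a x Ha Hx) as [_ H1].
    apply Rnot_lt_le; intros L; apply exp_increasing in L; rewrite exp_0 in L; lra. }
  apply Rle_trans with (2 := H1).
  assert (Hlim : forall w, Cmod w < 1 ->
    is_lim_seq (rsum (fun n => Re (RtoC (logcoef a n) * w ^ n))) (Re (logfun a w))).
  { intros w Hw; rewrite logfun_cser; apply is_series_rsum.
    apply Series_correct, ex_series_Re; now apply logfun_abs_summable. }
  refine (is_lim_seq_le _ _ (Re (logfun a z)) (Re (logfun a (RtoC x))) _
            (Hlim z Hz) (Hlim _ (Cmod_RtoC_lt1 x Hx))).
  intros N; apply rsum_le; intros n _; rewrite !Re_Cmult, <- RtoC_pow; simpl.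
  rewrite !Rmult_0_l, !Rminus_0_r.
  destruct n as [ | n]; [simpl; lra | ].
  apply Rmult_le_compat_l.
  - cbn [logcoef]; apply Rmult_le_pos; [now apply logderiv_ge0 | ].
    apply Rlt_le, Rinv_0_lt_compat, INR_S_pos.
  - unfold x; rewrite <- Cmod_pow; eapply Rle_trans; [apply Rle_abs | apply Rabs_Re_le_Cmod].
Qed.

Lemma Re_div_R (z : C) (c : R) : c <> 0 -> Re (z / RtoC c)%C = Re z / c.
Proof. intros Hc; unfold Re; simpl; field; auto. Qed.

Lemma symbol_half_plane (a : nat -> R) (s : C) :
  log_convex_law a -> half_plane s -> half_plane (symbol a s).
Proof.
  intros Ha Hs; unfold half_plane, symbol in *.
  pose proof ln2_pos as H2.
  pose proof (Re_logfun_le0 a _ Ha (Cmod_npow_2_lt1 s Hs)) as H.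
  assert (E : Re (s - logfun a (npow_opp 2 s) / ln 2)%C =
              Re s - Re (logfun a (npow_opp 2 s)) / ln 2).
  { rewrite <- Re_div_R by lra; simpl; unfold Re; ring. }
  rewrite E; unfold Rdiv; pose proof (Rinv_0_lt_compat _ H2); nra.
Qed.

(** In the variable [v] with [z = exp v], the power [z ^ n] is [exp (n v)], so the second-order
    expansion of the exponential is applied term by term and summed; [l] is the sum of the termwise
    derivatives. *)
Lemma logfun_exp_derive (a : nat -> R) (v : C) :
  log_convex_law a -> Re v < 0 ->
  exists l C1 d, 0 <= C1 /\ 0 < d /\ forall u, Cmod u < d ->
    Cmod (logfun a (Cexp (v + u)) - logfun a (Cexp v) - u * l) <= C1 * Cmod u ^ 2.
Proof.
  intros Ha Hv; destruct (logcoef_bounded a Ha) as [M HM].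
  assert (HM0 : 0 <= M) by (eapply Rle_trans; [apply Rabs_pos | apply (HM O)]).
  set (x := Cmod (Cexp v)).
  assert (Ex : x = exp (Re v)) by apply Cmod_Cexp.
  assert (Hx : 0 < x < 1).
  { rewrite Ex; split; [apply exp_pos | rewrite <- exp_0; now apply exp_increasing]. }
  set (rho := exp (Re v / 2)).
  assert (Hrho : 0 < rho < 1).
  { unfold rho; split; [apply exp_pos | rewrite <- exp_0; apply exp_increasing; lra]. }
  set (S2 := Series (fun n => INR n ^ 2 * rho ^ n)).
  assert (HS2 : ex_series (fun n => INR n ^ 2 * rho ^ n)) by (apply ex_series_sq_geom; lra).
  assert (Hterm : forall n, 0 <= INR n ^ 2 * rho ^ n)
    by (intros; apply Rmult_le_pos; [apply pow2_ge_0 | apply pow_le; lra]).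
  set (t := fun n => (RtoC (logcoef a n) * Cexp v ^ n)%C).
  assert (Ht : forall n, Cmod (t n) <= M * x ^ n).
  { intros n; unfold t; rewrite Cmod_mult, Cmod_R, Cmod_pow.
    apply Rmult_le_compat_r; auto; apply pow_le; lra. }
  assert (Hxrho : forall n, x ^ n <= rho ^ n).
  { intros n; apply pow_incr; split; [lra | rewrite Ex; apply exp_le_compat; lra]. }
  assert (Hnt : ex_series (fun n => Cmod (RtoC (INR n) * t n))).
  { apply ex_series_R_le with (2 := ex_series_R_scal M _ HS2); intros n.
    split; [apply Cmod_ge_0 | rewrite Cmod_mult, Cmod_R, Rabs_pos_eq by apply pos_INR].
    apply Rle_trans with (INR n * (M * rho ^ n)).
    - apply Rmult_le_compat_l; [apply pos_INR | ].
      eapply Rle_trans; [apply Ht | apply Rmult_le_compat_l; auto].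
    - destruct n as [ | n]; [simpl; lra | ].
      assert (1 <= INR (S n)) by (rewrite S_INR; pose proof (pos_INR n); lra).
      assert (0 <= M * rho ^ S n) by (apply Rmult_le_pos; auto; apply pow_le; lra).
      replace (M * (INR (S n) ^ 2 * rho ^ S n)) with (INR (S n) * (INR (S n) * (M * rho ^ S n)))
        by ring.
      apply Rmult_le_compat_l; [lra | nra]. }
  (* Within the radius [- Re v / 2] the growth [exp (n * Cmod u)] uses up half of the decay
     [exp (n * Re v)] and leaves [rho ^ n]. The 10 is 5 from [Cexp_second_order] times 2 from
     [Cmod_cser_le]. *)
  exists (cser (fun n => RtoC (INR n) * t n)%C), (10 * M * S2), (- Re v / 2).
  assert (HS20 : 0 <= S2).
  { apply (Series_rsum_le _ S2 Hterm); intros N; apply rsum_le_series; auto.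
    now apply Series_correct. }
  split; [repeat apply Rmult_le_pos; auto; lra | split; [lra | ]].
  intros u Hu.
  assert (Hvu : Cmod (Cexp (v + u)) < 1).
  { rewrite Cmod_Cexp, <- exp_0; apply exp_increasing; simpl.
    pose proof (Rabs_Re_le_Cmod u); pose proof (Rle_abs (Re u)); unfold Re in *; lra. }
  assert (E : (logfun a (Cexp (v + u)) - logfun a (Cexp v) -
               u * cser (fun n => RtoC (INR n) * t n))%C =
              cser (fun n => t n * (Cexp (INR n * u) - 1 - INR n * u))%C).
  { rewrite !logfun_cser; fold t.
    transitivity (cser (fun n => RtoC (logcoef a n) * Cexp (v + u) ^ n)%C +
                  (- RtoC 1 * cser t + - u * cser (fun n => RtoC (INR n) * t n)%C))%C;
      [ring | ].
    assert (Ht' : ex_series (fun n => Cmod (t n)))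
      by (apply logfun_abs_summable; auto; fold x; lra).
    rewrite <- !cser_scal, <- !cser_plus; auto.
    - apply cser_ext; intros n; unfold t.
      rewrite !Cexp_pow, Cmult_plus_distr_l, Cexp_plus; ring.
    - now apply logfun_abs_summable.
    - apply ex_series_R_le with (2 := ex_series_R_plus _ _
        (ex_series_R_scal 1 _ Ht') (ex_series_R_scal (Cmod u) _ Hnt)); intros n.
      split; [apply Cmod_ge_0 | eapply Rle_trans; [apply Cmod_triangle | ]].
      rewrite (Cmod_mult (- RtoC 1)), (Cmod_mult (- u)), !Cmod_opp, Cmod_1; lra.
    - apply ex_series_R_ext with (fun n => 1 * Cmod (t n)).
      + intros n; now rewrite Cmod_mult, Cmod_opp, Cmod_1.
      + now apply ex_series_R_scal.
    - apply ex_series_R_ext with (fun n => Cmod (- u) * Cmod (RtoC (INR n) * t n)).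
      + intros n; now rewrite (Cmod_mult (- u)).
      + now apply ex_series_R_scal. }
  rewrite E.
  eapply Rle_trans; [apply (Cmod_cser_le _ (fun n => 5 * M * Cmod u ^ 2 * (INR n ^ 2 * rho ^ n))) | ].
  - intros n; rewrite Cmod_mult.
    pose proof (Cexp_second_order (INR n * u)) as H2.
    rewrite Cmod_mult, Cmod_R, Rabs_pos_eq in H2 by apply pos_INR.
    apply Rle_trans with (M * x ^ n * (5 * ((INR n * Cmod u) ^ 2 * exp (INR n * Cmod u)))).
    + apply Rmult_le_compat; auto using Cmod_ge_0.
    + assert (Hexp : x ^ n * exp (INR n * Cmod u) <= rho ^ n).
      { assert (Hpe : forall y, exp y ^ n = exp (INR n * y)).
        { intros y; clear; induction n as [ | n IH]; [simpl; now rewrite Rmult_0_l, exp_0 | ].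
          rewrite S_INR; simpl; rewrite IH, <- exp_plus; f_equal; ring. }
        rewrite Ex; unfold rho; rewrite !Hpe, <- exp_plus; apply exp_le_compat.
        pose proof (pos_INR n); nra. }
      replace (M * x ^ n * (5 * ((INR n * Cmod u) ^ 2 * exp (INR n * Cmod u))))
        with (5 * M * Cmod u ^ 2 * INR n ^ 2 * (x ^ n * exp (INR n * Cmod u))) by ring.
      rewrite <- (Rmult_assoc (5 * M * Cmod u ^ 2)).
      apply Rmult_le_compat_l; auto.
      repeat apply Rmult_le_pos; auto; try lra; apply Cmod_ge_0 || apply pos_INR.
  - now apply ex_series_R_scal.
  - rewrite Series_scal_l; fold S2; apply Req_le; ring.
Qed.

Lemma symbol_analytic (a : nat -> R) :
  log_convex_law a -> analytic_on_half_plane (symbol a).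
Proof.
  intros Ha s Hs; pose proof ln2_pos as H2.
  assert (Hv : Re (- s * ln 2)%C < 0).
  { unfold half_plane in Hs; rewrite Re_Cmult; simpl; unfold Re in *; nra. }
  destruct (logfun_exp_derive a (- s * ln 2)%C Ha Hv) as (l & C1 & d & HC1 & Hd & HB).
  (* An increment [h] of [s] is an increment [- h * ln 2] of [v], and its factor [ln 2] cancels the
     division in [symbol]. *)
  exists (1 + l)%C; apply is_derive_C_intro; intros eps Heps.
  assert (Hd1 : 0 < d / ln 2) by (apply Rdiv_lt_0_compat; auto).
  assert (Hd2 : 0 < eps / (C1 * ln 2 + 1)) by (apply Rdiv_lt_0_compat; nra).
  exists (Rmin (d / ln 2) (eps / (C1 * ln 2 + 1))); split; [now apply Rmin_glb_lt | ].
  intros y Hy; set (h := (y - s)%C) in *.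
  assert (Hy1 : Cmod h * ln 2 < d).
  { apply Rmult_lt_reg_r with (/ ln 2); [now apply Rinv_0_lt_compat | ].
    rewrite Rmult_assoc, Rinv_r, Rmult_1_r by lra.
    eapply Rlt_le_trans; [exact Hy | apply Rmin_l]. }
  assert (Hy2 : Cmod h * (C1 * ln 2 + 1) < eps).
  { apply Rmult_lt_reg_r with (/ (C1 * ln 2 + 1)); [apply Rinv_0_lt_compat; nra | ].
    rewrite Rmult_assoc, Rinv_r, Rmult_1_r by nra.
    eapply Rlt_le_trans; [exact Hy | apply Rmin_r]. }
  set (u := (- h * ln 2)%C).
  assert (Hu : Cmod u = Cmod h * ln 2).
  { unfold u; rewrite Cmod_mult, Cmod_opp, Cmod_R, Rabs_pos_eq; lra. }
  specialize (HB u ltac:(lra)).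
  assert (Hln : RtoC (ln 2) <> RtoC 0) by (intros Hc; apply RtoC_inj in Hc; lra).
  assert (E : (symbol a y - symbol a s - h * (1 + l))%C =
    (- (logfun a (Cexp (- s * ln 2 + u)) - logfun a (Cexp (- s * ln 2)) - u * l) / ln 2)%C).
  { unfold symbol; rewrite !npow_opp_Cexp, INR_2.
    replace (- y * ln 2)%C with (- s * ln 2 + u)%C by (unfold u, h; ring).
    unfold u at 3; unfold h at 1 2; field; auto. }
  rewrite E, Cmod_div, Cmod_opp, Cmod_R, (Rabs_pos_eq (ln 2)) by (auto; lra).
  rewrite Hu in HB; pose proof (Cmod_ge_0 h).
  apply Rmult_le_reg_r with (ln 2); auto.
  unfold Rdiv; rewrite Rmult_assoc, Rinv_l, Rmult_1_r by lra.
  apply Rle_trans with (1 := HB).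
  assert (Hx : Cmod h * (C1 * ln 2) <= eps) by nra.
  assert (Hhl : 0 <= Cmod h * ln 2) by (apply Rmult_le_pos; lra).
  apply (Rmult_le_compat_l (Cmod h * ln 2)) in Hx; auto.
  apply Rle_trans with (Cmod h * ln 2 * (Cmod h * (C1 * ln 2))); [apply Req_le; ring | lra].
Qed.

(** * The matrix realizes the composition operator *)

Lemma Re_csum (f : nat -> C) (n : nat) : Re (csum f n) = rsum (fun k => Re (f k)) n.
Proof. induction n as [ | n IH]; [reflexivity | simpl rsum; rewrite <- IH; reflexivity]. Qed.

Lemma Im_csum (f : nat -> C) (n : nat) : Im (csum f n) = rsum (fun k => Im (f k)) n.
Proof. induction n as [ | n IH]; [reflexivity | simpl rsum; rewrite <- IH; reflexivity]. Qed.

Lemma Cmod_csum (f : nat -> C) (n : nat) : Cmod (csum f n) <= rsum (fun k => Cmod (f k)) n.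
Proof.
  induction n as [ | n IH]; simpl; [rewrite Cmod_0; lra | ].
  eapply Rle_trans; [apply Cmod_triangle | lra].
Qed.

Lemma csum_minus (f g : nat -> C) (n : nat) :
  csum (fun k => f k - g k)%C n = (csum f n - csum g n)%C.
Proof. induction n as [ | n IH]; simpl; [ring | rewrite IH; ring]. Qed.

Lemma csum_scal (c : C) (f : nat -> C) (n : nat) :
  csum (fun k => c * f k)%C n = (c * csum f n)%C.
Proof. induction n as [ | n IH]; simpl; [ring | rewrite IH; ring]. Qed.

Lemma csum_switch (F : nat -> nat -> C) (n m : nat) :
  csum (fun i => csum (F i) m) n = csum (fun j => csum (fun i => F i j) n) m.
Proof.
  apply C_ext; rewrite ?Re_csum, ?Im_csum.
  - rewrite (rsum_ext _ (fun i => rsum (fun j => Re (F i j)) m)) by (intros; apply Re_csum).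
    rewrite rsum_switch; apply rsum_ext; intros; symmetry; apply Re_csum.
  - rewrite (rsum_ext _ (fun i => rsum (fun j => Im (F i j)) m)) by (intros; apply Im_csum).
    rewrite rsum_switch; apply rsum_ext; intros; symmetry; apply Im_csum.
Qed.

Lemma sparse_mult (b i : nat) (G X Y : nat -> R) :
  (forall k, (S i = S b * 2 ^ k)%nat -> X i = Y k) ->
  sparse b G i * X i = sparse b (fun k => G k * Y k) i.
Proof.
  intros H; destruct (sparse_cases b i) as [[k E] | Hoff].
  - rewrite !(sparse_at b _ i k E), (H k E); reflexivity.
  - rewrite !sparse_off by auto; ring.
Qed.

Lemma npow_opp_symbol (a : nat -> R) (j : nat) (s : C) :
  npow_opp (S j) (symbol a s) =
  (npow_opp (S j) s * Cexp (log2n j * logfun a (npow_opp 2 s)))%C.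
Proof.
  rewrite (npow_opp_Cexp (S j)), (npow_opp_Cexp (S j)), <- Cexp_plus; f_equal.
  unfold symbol, log2n; rewrite RtoC_div by (pose proof ln2_pos; lra).
  assert (Hln : RtoC (ln 2) <> RtoC 0)
    by (intros Hc; apply RtoC_inj in Hc; pose proof ln2_pos; lra).
  field; auto.
Qed.

Lemma npow_opp_mul (i j k : nat) (s : C) :
  (S i = S j * 2 ^ k)%nat -> npow_opp (S i) s = (npow_opp (S j) s * npow_opp 2 s ^ k)%C.
Proof.
  intros E; rewrite E, !npow_opp_Cexp, Cexp_pow, <- Cexp_plus, INR_2; f_equal.
  rewrite mult_INR, INR_pow2, ln_mult, ln_pow, RtoC_plus, RtoC_mult;
    [ring | lra | apply INR_S_pos | apply two_pow_pos].
Qed.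

Lemma is_lim_seq_Cmod_sq (u : nat -> C) (l : C) :
  is_lim_seq (fun k => Re (u k)) (Re l) -> is_lim_seq (fun k => Im (u k)) (Im l) ->
  is_lim_seq (fun k => Cmod (u k) ^ 2) (Cmod l ^ 2).
Proof.
  intros HR HI; rewrite Cmod_sq, <- !Rsqr_pow2.
  apply is_lim_seq_ext with (fun k => Re (u k) * Re (u k) + Im (u k) * Im (u k)).
  - intros k; rewrite Cmod_sq; ring.
  - apply is_lim_seq_plus'; now apply is_lim_seq_mult'.
Qed.

(** The coefficients are nonnegative with sum at most one, so the remainder is at most the first
    omitted power of [Cmod z]. The bound is free of [lam], hence uniform over the columns. *)
Lemma powcoef_gf_tail (a : nat -> R) (lam : R) (z : C) (m : nat) :
  log_convex_law a -> 0 <= lam -> Cmod z < 1 ->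
  Cmod (Cexp (lam * logfun a z) - csum (fun k => RtoC (powcoef a lam k) * z ^ k)%C m) <= Cmod z ^ m.
Proof.
  intros Ha Hl Hz; destruct (powcoef_gf a lam z Ha Hl Hz) as [HR HI].
  set (t := fun k => (RtoC (powcoef a lam k) * z ^ k)%C).
  assert (Hfin : forall M, Cmod (csum t (m + M) - csum t m) <= Cmod z ^ m).
  { intros M.
    assert (E : (csum t (m + M) - csum t m)%C = csum (fun k => t (m + k)%nat) M).
    { induction M as [ | M IH]; [rewrite Nat.add_0_r; simpl; ring | ].
      rewrite Nat.add_succ_r; simpl; rewrite <- IH; ring. }
    rewrite E; eapply Rle_trans; [apply Cmod_csum | ].
    apply Rle_trans with (rsum (fun k => Cmod z ^ m * powcoef a lam (m + k)) M).
    - apply rsum_le; intros k _; unfold t.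
      rewrite Cmod_mult, Cmod_R, Rabs_pos_eq, Cmod_pow, pow_add by (now apply powcoef_ge0).
      rewrite Rmult_comm, Rmult_assoc; apply Rmult_le_compat_l; [apply pow_le, Cmod_ge_0 | ].
      rewrite <- (Rmult_1_l (powcoef _ _ _)) at 2; apply Rmult_le_compat_r;
        [now apply powcoef_ge0 | ].
      rewrite <- (pow1 k); apply pow_incr; split; [apply Cmod_ge_0 | lra].
    - rewrite rsum_scal; apply Rle_trans with (Cmod z ^ m * 1); [ | lra].
      apply Rmult_le_compat_l; [apply pow_le, Cmod_ge_0 | ].
      pose proof (powcoef_sum_le1 a lam (m + M) Ha Hl) as H1; rewrite rsum_split in H1.
      assert (0 <= rsum (powcoef a lam) m)
        by (apply rsum_ge0; intros; now apply powcoef_ge0).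
      lra. }
  apply is_series_rsum in HR; apply is_series_rsum in HI.
  assert (HR' : is_lim_seq (fun M => Re (csum t (m + M) - csum t m))
                  (Re (Cexp (lam * logfun a z) - csum t m))).
  { apply (is_lim_seq_minus' (fun M => Re (csum t (m + M))) (fun _ => Re (csum t m)));
      [ | apply is_lim_seq_const].
    apply (is_lim_seq_incr_n _ m) in HR; revert HR; apply is_lim_seq_ext; intros M.
    rewrite Re_csum, Nat.add_comm; apply rsum_ext; intros k _; unfold t.
    rewrite Re_Cmult; simpl; ring. }
  assert (HI' : is_lim_seq (fun M => Im (csum t (m + M) - csum t m))
                  (Im (Cexp (lam * logfun a z) - csum t m))).
  { apply (is_lim_seq_minus' (fun M => Im (csum t (m + M))) (fun _ => Im (csum t m)));
      [ | apply is_lim_seq_const].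
    apply (is_lim_seq_incr_n _ m) in HI; revert HI; apply is_lim_seq_ext; intros M.
    rewrite Im_csum, Nat.add_comm; apply rsum_ext; intros k _; unfold t.
    rewrite Im_Cmult; simpl; ring. }
  apply pow2_le_inv; [apply pow_le, Cmod_ge_0 | ].
  refine (is_lim_seq_le _ (fun _ => (Cmod z ^ m) ^ 2) (Finite _) (Finite ((Cmod z ^ m) ^ 2)) _
            (is_lim_seq_Cmod_sq _ _ HR' HI') (is_lim_seq_const _)).
  intros M; apply pow_incr; split; [apply Cmod_ge_0 | apply Hfin].
Qed.

(** Cutting column [j] at row [n] omits the powers from [m] on, where [(j + 1) 2^m > n]. The
    remainder is at most the modulus of the monomial of [(j + 1) 2^m], whatever [j] is. *)
Lemma kernel_symbol (a : nat -> R) (j n : nat) (s : C) :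
  log_convex_law a -> half_plane s ->
  Cmod (npow_opp (S j) (symbol a s) - csum (fun i => RtoC (kernel a i j) * npow_opp (S i) s)%C n)
    <= exp (- (Re s * ln (INR (S n)))).
Proof.
  intros Ha Hs; destruct (rsum_sparse j n) as (m & Hm & _ & HG).
  set (z := npow_opp 2 s); set (e := npow_opp (S j) s).
  assert (E : csum (fun i => RtoC (kernel a i j) * npow_opp (S i) s)%C n =
              (e * csum (fun k => RtoC (powcoef a (log2n j) k) * z ^ k)%C m)%C).
  { rewrite <- csum_scal; apply C_ext; rewrite ?Re_csum, ?Im_csum.
    - rewrite (rsum_ext _ (sparse j (fun k => powcoef a (log2n j) k * Re (e * z ^ k)))).
      + rewrite HG; apply rsum_ext; intros k _; rewrite !Re_Cmult, !Im_Cmult; simpl; ring.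
      + intros i _.
        rewrite <- (sparse_mult j i _ (fun i => Re (npow_opp (S i) s))).
        * rewrite Re_Cmult; unfold kernel; simpl; ring.
        * intros k Ek; now rewrite (npow_opp_mul i j k s Ek).
    - rewrite (rsum_ext _ (sparse j (fun k => powcoef a (log2n j) k * Im (e * z ^ k)))).
      + rewrite HG; apply rsum_ext; intros k _; rewrite !Im_Cmult, !Re_Cmult; simpl; ring.
      + intros i _.
        rewrite <- (sparse_mult j i _ (fun i => Im (npow_opp (S i) s))).
        * rewrite Im_Cmult; unfold kernel; simpl; ring.
        * intros k Ek; now rewrite (npow_opp_mul i j k s Ek). }
  rewrite E, npow_opp_symbol; fold z e.
  replace (e * Cexp (log2n j * logfun a z) -
           e * csum (fun k => RtoC (powcoef a (log2n j) k) * z ^ k)%C m)%C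
    with (e * (Cexp (log2n j * logfun a z) -
               csum (fun k => RtoC (powcoef a (log2n j) k) * z ^ k)%C m))%C by ring.
  rewrite Cmod_mult.
  apply Rle_trans with (Cmod e * Cmod z ^ m).
  - apply Rmult_le_compat_l; [apply Cmod_ge_0 | ].
    apply powcoef_gf_tail; auto using log2n_ge0; now apply Cmod_npow_2_lt1.
  - rewrite <- Cmod_pow, <- Cmod_mult.
    assert (Hpos : (1 <= S j * 2 ^ m)%nat) by (pose proof (pow2_gt0 m); nia).
    assert (Ei : (S (pred (S j * 2 ^ m)) = S j * 2 ^ m)%nat) by lia.
    unfold e, z; rewrite <- (npow_opp_mul _ j m s Ei), Cmod_npow_opp, Ei.
    apply exp_le_compat, Ropp_le_contravar, Rmult_le_compat_l.
    + unfold half_plane in Hs; lra.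
    + apply ln_le; [apply INR_S_pos | apply le_INR; lia].
Qed.

(** Row sums are visits, which at any time are bounded by the supremum of the renewal sequence. *)
Lemma kernel_contractive (a : nat -> R) :
  log_convex_law a -> log_convex_tail a -> contractive_kernel (kernel a).
Proof.
  intros Ha Ht; split; [ | split].
  - intros; now apply kernel_ge0.
  - intros; now apply kernel_col.
  - intros i; destruct (kernel_row a 0 i) as [-> | (b & J & _ & ->)]; [lra | ].
    rewrite <- (Rplus_0_r (log2n b)); apply visits_add_le; auto using log2n_ge0; [lra | ].
    intros k; apply renewal_le1; auto; apply Ha.
Qed.

Lemma kernel_above_diag (a : nat -> R) (i j : nat) : (i < j)%nat -> kernel a i j = 0.
Proof.
  intros L; apply sparse_off; intros k E; pose proof (pow2_gt0 k); nia.
Qed.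

Lemma kop_coef_csum (a : nat -> R) (f : nat -> C) (i n : nat) :
  (i < n)%nat -> kop_coef (kernel a) f i = csum (fun j => RtoC (kernel a i j) * f j)%C n.
Proof.
  intros L.
  assert (Hext : forall x, rsum (fun j => kernel a i j * x j) n = apply_kernel (kernel a) x i).
  { intros x; unfold apply_kernel; replace n with (S i + (n - S i))%nat by lia.
    rewrite rsum_split, (rsum_eq0 (fun k => kernel a i (S i + k) * _)); [ring | ].
    intros k _; rewrite kernel_above_diag by lia; ring. }
  apply C_ext; rewrite ?Re_csum, ?Im_csum.
  - etransitivity; [symmetry; apply Hext | ].
    apply rsum_ext; intros; rewrite Re_Cmult; simpl; ring.
  - etransitivity; [symmetry; apply Hext | ].
    apply rsum_ext; intros; rewrite Im_Cmult; simpl; ring.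
Qed.

(** Comparing the two sides on square truncations avoids an exchange of infinite sums: a column
    costs [(n + 1)^(- Re s)], and Cauchy-Schwarz over [n] columns costs [sqrt n], so the error tends
    to 0 since [Re s > 1/2]. *)
Lemma kernel_eval_partial (a : nat -> R) (HK : contractive_kernel (kernel a)) (f : H2) (s : C)
    (n : nat) :
  log_convex_law a -> half_plane s ->
  Cmod (csum (h2_term f (symbol a s)) n - csum (h2_term (kop (kernel a) HK f) s) n) <=
  exp ((1 / 2 - Re s) * ln (INR (S n))) * h2_norm f.
Proof.
  intros Ha Hs.
  rewrite (csum_ext (h2_term (kop (kernel a) HK f) s)
    (fun i => csum (fun j => h2_coef f j * (RtoC (kernel a i j) * npow_opp (S i) s)) n)%C).
  2:{ intros i L; unfold h2_term; cbn [h2_coef kop]; rewrite (kop_coef_csum a _ i n L).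
      rewrite Cmult_comm, <- csum_scal; apply csum_ext; intros; ring. }
  rewrite csum_switch, <- csum_minus.
  eapply Rle_trans; [apply Cmod_csum | ].
  set (E := exp (- (Re s * ln (INR (S n))))).
  apply Rle_trans with (rsum (fun j => Cmod (h2_coef f j) * E) n).
  - apply rsum_le; intros j _; rewrite csum_scal; unfold h2_term.
    replace (h2_coef f j * npow_opp (S j) (symbol a s) -
             h2_coef f j * csum (fun i => RtoC (kernel a i j) * npow_opp (S i) s)%C n)%C
      with (h2_coef f j * (npow_opp (S j) (symbol a s) -
             csum (fun i => RtoC (kernel a i j) * npow_opp (S i) s)%C n))%C by ring.
    rewrite Cmod_mult; apply Rmult_le_compat_l; [apply Cmod_ge_0 | now apply kernel_symbol].
  - rewrite rsum_scal_r.
    assert (HS : rsum (fun j => Cmod (h2_coef f j)) n <=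
                 exp (1 / 2 * ln (INR (S n))) * h2_norm f).
    { apply pow2_le_inv;
        [apply Rmult_le_pos; [apply Rlt_le, exp_pos | apply h2_norm_ge_0] | ].
      rewrite (rsum_ext _ (fun j => 1 * Cmod (h2_coef f j))) by (intros; ring).
      eapply Rle_trans; [apply cauchy_schwarz_rsum | rewrite Rpow_mult_distr].
      apply Rmult_le_compat.
      - apply rsum_ge0; intros; apply pow2_ge_0.
      - apply rsum_ge0; intros; apply pow2_ge_0.
      - rewrite (rsum_ext _ (fun _ => 1)), rsum_const by (intros; ring).
        rewrite Rmult_1_r, <- Rsqr_pow2; unfold Rsqr; rewrite <- exp_plus.
        replace (1 / 2 * ln (INR (S n)) + 1 / 2 * ln (INR (S n))) with (ln (INR (S n))) by field.
        rewrite exp_ln by apply INR_S_pos; rewrite S_INR; lra.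
      - apply rsum_le_h2_norm_sq. }
    replace ((1 / 2 - Re s) * ln (INR (S n)))
      with (1 / 2 * ln (INR (S n)) + - (Re s * ln (INR (S n)))) by ring.
    rewrite exp_plus; fold E; pose proof (exp_pos (- (Re s * ln (INR (S n))))) as HE; fold E in HE.
    apply (Rmult_le_compat_r E) in HS; lra.
Qed.

Lemma is_lim_seq_unique_close (u v : nat -> R) (l m : R) (d : nat -> R) :
  is_lim_seq u l -> is_lim_seq v m -> (forall n, Rabs (u n - v n) <= d n) -> is_lim_seq d 0 ->
  l = m.
Proof.
  intros Hu Hv Hd Hd0.
  assert (H1 : is_lim_seq (fun n => u n - v n) (l - m)) by now apply is_lim_seq_minus'.
  assert (H2 : is_lim_seq (fun n => u n - v n) 0).
  { apply is_lim_seq_abs_0, (is_lim_seq_le_le (fun _ => 0) _ d); auto using is_lim_seq_const.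
    intros n; split; [apply Rabs_pos | auto]. }
  apply is_lim_seq_unique in H1; apply is_lim_seq_unique in H2; rewrite H1 in H2.
  injection H2; lra.
Qed.

Lemma is_lim_seq_npow_decay (e M : R) :
  0 < e -> is_lim_seq (fun n => exp (- e * ln (INR (S n))) * M) 0.
Proof.
  intros He; replace (Finite 0) with (Finite (0 * M)) by (f_equal; ring).
  apply (is_lim_seq_scal_r _ M 0).
  apply (is_lim_comp_seq exp _ m_infty); [apply is_lim_exp_m | now exists O | ].
  replace m_infty with (Rbar_mult (- e) p_infty).
  - apply is_lim_seq_scal_l.
    apply (is_lim_comp_seq ln _ p_infty); [apply is_lim_ln_p | now exists O | ].
    apply (is_lim_seq_incr_1 INR), is_lim_seq_INR.
  - simpl; destruct (Rle_dec 0 (- e)); [exfalso; lra | reflexivity].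
Qed.

Lemma kernel_eval (a : nat -> R) (HK : contractive_kernel (kernel a)) (f : H2) (s : C) :
  log_convex_law a -> half_plane s ->
  h2_eval (kop (kernel a) HK f) s = h2_eval f (symbol a s).
Proof.
  intros Ha Hs; pose proof (symbol_half_plane a s Ha Hs) as Hs'.
  pose proof (h2_term_abs_summable f _ Hs') as S1.
  pose proof (h2_term_abs_summable (kop (kernel a) HK f) s Hs) as S2.
  assert (Hd : is_lim_seq (fun n => exp (- (Re s - 1 / 2) * ln (INR (S n))) * h2_norm f) 0)
    by (apply is_lim_seq_npow_decay; unfold half_plane in Hs; lra).
  assert (Hb : forall n,
    Cmod (csum (h2_term f (symbol a s)) n - csum (h2_term (kop (kernel a) HK f) s) n) <=
    exp (- (Re s - 1 / 2) * ln (INR (S n))) * h2_norm f).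
  { intros n; replace (- (Re s - 1 / 2)) with (1 / 2 - Re s) by ring.
    now apply kernel_eval_partial. }
  symmetry; unfold h2_eval; f_equal.
  - apply (is_lim_seq_unique_close (rsum (fun n => Re (h2_term f (symbol a s) n)))
      (rsum (fun n => Re (h2_term (kop (kernel a) HK f) s n))) _ _ _) with (4 := Hd).
    + now apply is_series_rsum, Series_correct, ex_series_Re.
    + now apply is_series_rsum, Series_correct, ex_series_Re.
    + intros n; rewrite <- !Re_csum; eapply Rle_trans; [ | apply Hb].
      eapply Rle_trans; [ | apply Rabs_Re_le_Cmod]; now apply Req_le.
  - apply (is_lim_seq_unique_close (rsum (fun n => Im (h2_term f (symbol a s) n)))
      (rsum (fun n => Im (h2_term (kop (kernel a) HK f) s n))) _ _ _) with (4 := Hd).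
    + now apply is_series_rsum, Series_correct, ex_series_Im.
    + now apply is_series_rsum, Series_correct, ex_series_Im.
    + intros n; rewrite <- !Im_csum; eapply Rle_trans; [ | apply Hb].
      eapply Rle_trans; [ | apply Rabs_Im_le_Cmod]; now apply Req_le.
Qed.

Lemma kernel_composition_operator (a : nat -> R) (HK : contractive_kernel (kernel a)) :
  log_convex_law a -> composition_operator (symbol a) (kop (kernel a) HK).
Proof.
  intros Ha; split; [ | split; [ | split]].
  - intros s; now apply symbol_half_plane.
  - now apply symbol_analytic.
  - apply kop_linear.
  - intros f s; now apply kernel_eval.
Qed.

(** * Lower bound *)

Definition indic (M k : nat) : R := if (k <? M)%nat then 1 else 0.

Lemma rsum_indic (f : nat -> R) (M N : nat) :
  (M <= N)%nat -> rsum (fun k => f k * indic M k) N = rsum f M.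
Proof.
  intros L; replace N with (M + (N - M))%nat by lia; rewrite rsum_split.
  rewrite (rsum_eq0 (fun k => f (M + k)%nat * _)), Rplus_0_r.
  - apply rsum_ext; intros k Lk; unfold indic; apply Nat.ltb_lt in Lk; rewrite Lk; ring.
  - intros k _; unfold indic; destruct (Nat.ltb_spec (M + k) M); [lia | ring].
Qed.

Lemma indic_ge0 (M k : nat) : 0 <= indic M k.
Proof. unfold indic; destruct (_ <? _)%nat; lra. Qed.

Definition orbit_coef (b M i : nat) : C := RtoC (sparse b (indic M) i).

Lemma orbit_coef_sq (b M i : nat) : Cmod (orbit_coef b M i) ^ 2 = sparse b (indic M) i.
Proof.
  unfold orbit_coef; rewrite Cmod_R, pow2_abs.
  destruct (sparse_cases b i) as [[k E] | Hoff].
  - rewrite (sparse_at b _ i k E); unfold indic; destruct (_ <? _)%nat; ring.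
  - rewrite sparse_off by auto; ring.
Qed.

Lemma orbit_coef_sum (b M N : nat) : rsum (fun i => Cmod (orbit_coef b M i) ^ 2) N <= INR M.
Proof.
  rewrite (rsum_ext _ (sparse b (indic M))) by (intros; apply orbit_coef_sq).
  destruct (rsum_sparse b N) as (m & _ & _ & HG); rewrite HG.
  apply Rle_trans with (rsum (indic M) (m + M)).
  - apply rsum_le_len; [apply indic_ge0 | lia].
  - rewrite (rsum_ext _ (fun k => 1 * indic M k)), rsum_indic, rsum_const by (lia || intros; ring).
    lra.
Qed.

Lemma orbit_summable (b M : nat) : ex_series (fun i => Cmod (orbit_coef b M i) ^ 2).
Proof.
  apply (Series_rsum_le _ (INR M)); [intros; apply pow2_ge_0 | apply orbit_coef_sum].
Qed.

(* The sum of the Dirichlet monomials of [(b + 1) 2^k], [k < M]. *)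
Definition orbit_vec (b M : nat) : H2 := mkH2 (orbit_coef b M) (orbit_summable b M).

Lemma orbit_vec_norm_sq (b M : nat) : h2_norm (orbit_vec b M) ^ 2 <= INR M.
Proof. apply h2_norm_sq_le, orbit_coef_sum. Qed.

Lemma orbit_vec_norm_pos (b M : nat) : (0 < M)%nat -> 0 < h2_norm (orbit_vec b M).
Proof.
  intros HM; eapply Rlt_le_trans; [ | apply (h2_coef_le_norm (orbit_vec b M) b)].
  simpl; unfold orbit_coef; rewrite (sparse_at b _ b 0) by (simpl; lia).
  unfold indic; apply Nat.ltb_lt in HM; rewrite HM, Cmod_1; lra.
Qed.

Lemma kop_orbit_off (a : nat -> R) (b M i : nat) :
  (forall k, (S i <> S b * 2 ^ k)%nat) -> kop_coef (kernel a) (orbit_coef b M) i = RtoC 0.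
Proof.
  intros Hoff; apply C_ext; simpl; apply rsum_eq0; intros j _; [ | simpl; ring].
  destruct (sparse_cases b j) as [[t Et] | Hj]; [ | simpl; rewrite (sparse_off b) by auto; ring].
  destruct (classic (kernel a i j = 0)) as [-> | N]; [ring | ].
  apply kernel_support in N; destruct N as [k Ek]; exfalso; apply (Hoff (t + k)%nat).
  rewrite Ek, Et, Nat.pow_add_r; ring.
Qed.

(** Uniqueness of the odd part of an integer. *)
Lemma odd_orbit_inj (l l' k k' : nat) :
  (S (2 * l) * 2 ^ k = S (2 * l') * 2 ^ k' -> l = l')%nat.
Proof.
  assert (H : forall l l' k k', (k <= k' -> S (2 * l) * 2 ^ k = S (2 * l') * 2 ^ k' -> l = l')%nat).
  { clear; intros l l' k k' L E; replace k' with ((k' - k) + k)%nat in E by lia.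
    rewrite Nat.pow_add_r, Nat.mul_assoc in E.
    apply Nat.mul_cancel_r in E; [ | pose proof (pow2_gt0 k); lia].
    destruct (k' - k)%nat as [ | d]; [simpl in E; lia | ].
    rewrite Nat.pow_succ_r' in E; exfalso.
    assert (S (2 * l) = 2 * (S (2 * l') * 2 ^ d))%nat as E' by nia; lia. }
  intros E; destruct (Nat.le_ge_cases k k'); [eapply H; eauto | symmetry; eapply H; eauto].
Qed.

Lemma disjoint_of_orbits (f g : H2) (l l' : nat) :
  l <> l' ->
  (forall i, (forall k, (S i <> S (2 * l) * 2 ^ k)%nat) -> h2_coef f i = RtoC 0) ->
  (forall i, (forall k, (S i <> S (2 * l') * 2 ^ k)%nat) -> h2_coef g i = RtoC 0) ->
  disjoint_support f g.
Proof.
  intros N Hf Hg i; destruct (sparse_cases (2 * l) i) as [[k E] | Hoff]; [right | left; auto].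
  apply Hg; intros k' E'; apply N, (odd_orbit_inj l l' k k'); congruence.
Qed.

Lemma rsum_pow_sq_le (x : R) (N : nat) :
  0 < x < 1 -> rsum (fun J => (x ^ J) ^ 2) N <= / (1 - x ^ 2).
Proof.
  intros Hx; assert (Hx2 : 0 < 1 - x ^ 2) by nra.
  apply Rmult_le_reg_r with (1 - x ^ 2); auto; rewrite Rinv_l by lra.
  rewrite (rsum_ext _ (fun J => (x ^ 2) ^ J)), rsum_geom
    by (intros; rewrite <- !pow_mult; f_equal; lia).
  assert (0 <= (x ^ 2) ^ N) by (apply pow_le; nra); lra.
Qed.

(** On its orbit the image has generating function [sum_{t < M} z^t A^(log2n b + t)]. Pairing it
    with [x ^ J], a sequence of squared norm at most [/ (1 - x ^ 2)], evaluates this function at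
    [x]. *)
Lemma kop_orbit_lower (a : nat -> R) (HK : contractive_kernel (kernel a)) (b M : nat) (x : R) :
  log_convex_law a -> 0 < x < 1 ->
  (1 - x ^ 2) * rsum (fun t => x ^ t * exp ((log2n b + INR t) * ln (gf a x))) M ^ 2 <=
  h2_norm (kop (kernel a) HK (orbit_vec b M)) ^ 2.
Proof.
  intros Ha Hx; set (w := kop (kernel a) HK (orbit_vec b M)).
  assert (Hx2 : 0 < 1 - x ^ 2) by nra.
  set (q := fun t => powcoef a (log2n b + INR t)).
  assert (Hl : forall t, 0 <= log2n b + INR t)
    by (intros t; pose proof (log2n_ge0 b); pose proof (pos_INR t); lra).
  assert (Hq : forall t k, 0 <= q t k) by (intros; apply powcoef_ge0; auto).
  set (c := fun J => rsum (fun t => q t (J - t)%nat * indic M t) (S J)).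
  assert (Hc : forall i J, (S i = S b * 2 ^ J)%nat -> Cmod (h2_coef w i) ^ 2 = c J ^ 2).
  { intros i J E.
    assert (Hre : apply_kernel (kernel a) (fun j => Re (orbit_coef b M j)) i = c J).
    { unfold apply_kernel, c; rewrite <- (rsum_sparse_at b i J) by exact E.
      apply rsum_ext; intros j Lj; apply (kernel_sparse a b i j J); auto; lia. }
    assert (Him : apply_kernel (kernel a) (fun j => Im (orbit_coef b M j)) i = 0)
      by (apply rsum_eq0; intros; simpl; ring).
    simpl; unfold kop_coef; rewrite Hre, Him.
    rewrite <- (Rmult_1_r (Cmod _)) at 1; transitivity (Cmod (c J, 0) ^ 2); [simpl; ring | ].
    rewrite Cmod_sq; simpl; ring. }
  assert (Hsum : forall m, rsum (fun J => c J ^ 2) m <= h2_norm w ^ 2).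
  { intros m; eapply Rle_trans; [ | apply (rsum_le_h2_norm_sq w (S b * 2 ^ m))].
    destruct (rsum_sparse b (S b * 2 ^ m)) as (m' & Hm' & _ & HG).
    apply Rle_trans with (rsum (fun J => c J ^ 2) m').
    - apply rsum_le_len; [intros; apply pow2_ge_0 | ].
      apply Nat.nlt_ge; intros L.
      pose proof (Nat.pow_le_mono_r 2 m' m ltac:(lia) ltac:(lia)); nia.
    - rewrite <- HG; apply rsum_le; intros i _.
      destruct (sparse_cases b i) as [[J E] | Hoff].
      + rewrite (sparse_at b _ i J E), (Hc i J E); apply Rle_refl.
      + rewrite sparse_off by auto; apply pow2_ge_0. }
  set (B := sqrt (h2_norm w ^ 2 / (1 - x ^ 2))).
  assert (HB0 : 0 <= h2_norm w ^ 2 / (1 - x ^ 2)).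
  { apply Rmult_le_pos; [apply pow2_ge_0 | now apply Rlt_le, Rinv_0_lt_compat]. }
  (* Partial sums up to [n + M] leave at least [n] terms to the series of each [t < M]; afterwards
     [n] tends to infinity. *)
  assert (HY : forall n, rsum (fun t => x ^ t * rsum (fun k => q t k * x ^ k) n) M <= B).
  { intros n; set (N := (n + M)%nat).
    assert (HYN : rsum (fun J => x ^ J * c J) (S N) <= B).
    { apply pow2_le_inv; [apply sqrt_pos | ].
      unfold B; rewrite pow2_sqrt by exact HB0.
      eapply Rle_trans; [apply cauchy_schwarz_rsum | ].
      unfold Rdiv; rewrite Rmult_comm; apply Rmult_le_compat; auto.
      - apply rsum_ge0; intros; apply pow2_ge_0.
      - apply rsum_ge0; intros; apply pow2_ge_0.
      - now apply rsum_pow_sq_le. }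
    eapply Rle_trans; [ | exact HYN].
    rewrite (rsum_ext (fun J => x ^ J * c J) (fun J => rsum (fun t =>
      (fun t k => x ^ t * (q t k * x ^ k) * indic M t) t (J - t)%nat) (S J))).
    - rewrite (rsum_triangle (fun t k => x ^ t * (q t k * x ^ k) * indic M t)).
      rewrite (rsum_ext (fun t => rsum _ (S (N - t)))
        (fun t => x ^ t * rsum (fun k => q t k * x ^ k) (S (N - t)) * indic M t))
        by (intros; rewrite <- rsum_scal, <- rsum_scal_r; reflexivity).
      rewrite (rsum_indic (fun t => x ^ t * rsum (fun k => q t k * x ^ k) (S (N - t))))
        by (unfold N; lia).
      apply rsum_le; intros t Lt; apply Rmult_le_compat_l; [apply pow_le; lra | ].
      apply rsum_le_len; [ | unfold N; lia].
      intros; apply Rmult_le_pos; auto; apply pow_le; lra.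
    - intros J _; unfold c; rewrite <- rsum_scal; apply rsum_ext; intros t Lt.
      replace (x ^ J) with (x ^ t * x ^ (J - t)) by (rewrite <- pow_add; f_equal; lia); ring. }
  assert (Hlim : rsum (fun t => x ^ t * exp ((log2n b + INR t) * ln (gf a x))) M <= B).
  { refine (is_lim_seq_le _ (fun _ => B) (Finite _) (Finite B) HY _ (is_lim_seq_const _)).
    apply (is_lim_seq_rsum (fun t n => x ^ t * rsum (fun k => q t k * x ^ k) n)); intros t.
    apply (is_lim_seq_scal_l _ (x ^ t) (Finite _)), is_series_rsum.
    assert (Hx' : 0 <= x < 1) by lra.
    destruct (powcoef_gf_real a (log2n b + INR t) x Ha (Hl t) Hx') as [Hs Hg].
    rewrite <- Hg, ln_exp; exact Hs. }
  assert (Hy0 : 0 <= rsum (fun t => x ^ t * exp ((log2n b + INR t) * ln (gf a x))) M).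
  { apply rsum_ge0; intros; apply Rmult_le_pos; [apply pow_le; lra | apply Rlt_le, exp_pos]. }
  apply Rle_trans with ((1 - x ^ 2) * B ^ 2).
  - apply Rmult_le_compat_l; [lra | ]; apply pow_incr; lra.
  - unfold B; rewrite pow2_sqrt by exact HB0; apply Req_le; field; lra.
Qed.

(** At [x = 1 - node H j] one has [x A(x) >= exp (- (4 / 2 ^ j))], and the exponents are at most
    [5 * 2 ^ j], so each of the [2 ^ j] summands is at least [exp (-20)]. Squaring and multiplying
    by [1 - x ^ 2 >= node H j] gives [exp (-40) * H j * 2 ^ j], while the vector has squared norm at
    most [2 ^ j]. *)
Lemma law_orbit_lower (H : nat -> R) (kap : R) (HK : contractive_kernel (kernel (law H)))
    (b j : nat) :
  dyadic_scale H kap -> (2 <= j)%nat -> log2n b <= 4 * 2 ^ j ->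
  exp (-40) * H j * h2_norm (orbit_vec b (2 ^ j)) ^ 2 <=
  h2_norm (kop (kernel (law H)) HK (orbit_vec b (2 ^ j))) ^ 2.
Proof.
  intros HH Hj Hb; pose proof (law_is_log_convex_law H kap HH) as Ha.
  pose proof (node_pos H kap HH j) as Hs; pose proof (node_le_half H kap HH j) as Hs2.
  pose proof (scale_pos H kap HH j) as HHj; pose proof (two_pow_pos j) as H2j.
  set (x := 1 - node H j); assert (Hx : 0 < x < 1) by (unfold x; lra).
  eapply Rle_trans; [ | apply (kop_orbit_lower (law H) HK b (2 ^ j) x Ha Hx)].
  assert (Hx' : 0 <= x < 1) by lra.
  pose proof (gf_bounds (law H) x Ha Hx') as [Hg0 Hg1].
  pose proof (law_gf_ge H kap HH j) as Hge; fold x in Hge.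
  set (A := gf (law H) x) in *.
  assert (H4 : 4 <= 2 ^ j) by (replace 4 with (2 ^ 2) by ring; apply Rle_pow; [lra | auto]).
  (* [j >= 2] is used here, to stay in the range of [exp_le_one_minus]. *)
  assert (Hsm : 0 <= 2 / 2 ^ j <= 1 / 2).
  { split; [apply Rlt_le, Rdiv_lt_0_compat; lra | ].
    apply Rmult_le_reg_r with (2 ^ j); auto; unfold Rdiv at 1.
    rewrite Rmult_assoc, Rinv_l by lra; lra. }
  assert (Hln : - (4 / 2 ^ j) <= ln x + ln A).
  { rewrite <- ln_mult by lra; rewrite <- (ln_exp (- (4 / 2 ^ j))).
    apply ln_le; [apply exp_pos | apply Rle_trans with (2 := Hge)].
    replace (4 / 2 ^ j) with (2 * (2 / 2 ^ j)) by (field; lra).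
    apply exp_le_one_minus; lra. }
  assert (Hlx : ln x <= 0) by (rewrite <- ln_1; apply ln_le; lra).
  assert (Hterm : forall t, (t < 2 ^ j)%nat ->
    exp (-20) <= x ^ t * exp ((log2n b + INR t) * ln A)).
  { intros t Lt; rewrite <- (exp_ln x) at 1 by lra.
    assert (Hpe : exp (ln x) ^ t = exp (INR t * ln x)).
    { rewrite <- Rpower_pow by apply exp_pos; unfold Rpower; now rewrite ln_exp. }
    rewrite Hpe, <- exp_plus; apply exp_le_compat.
    assert (Ht : INR t <= 2 ^ j) by (rewrite <- INR_pow2; apply le_INR; lia).
    pose proof (pos_INR t); pose proof (log2n_ge0 b).
    assert (Hsum : (log2n b + INR t) * (4 / 2 ^ j) <= 20).
    { apply Rle_trans with (5 * 2 ^ j * (4 / 2 ^ j)); [ | apply Req_le; field; lra].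
      apply Rmult_le_compat_r; [apply Rlt_le, Rdiv_lt_0_compat; lra | lra]. }
    assert ((log2n b + INR t) * - (4 / 2 ^ j) <= (log2n b + INR t) * (ln x + ln A))
      by (apply Rmult_le_compat_l; lra).
    assert (log2n b * ln x <= 0) by nra.
    lra. }
  assert (HS : 2 ^ j * exp (-20) <=
    rsum (fun t => x ^ t * exp ((log2n b + INR t) * ln A)) (2 ^ j)).
  { rewrite <- INR_pow2, <- rsum_const; now apply rsum_le. }
  assert (He : exp (-40) = exp (-20) * exp (-20)) by (rewrite <- exp_plus; f_equal; ring).
  pose proof (exp_pos (-20)) as He0.
  apply Rle_trans with (exp (-40) * H j * 2 ^ j).
  - apply Rmult_le_compat_l; [rewrite He; repeat apply Rmult_le_pos; lra | ].
    rewrite <- INR_pow2; apply orbit_vec_norm_sq.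
  - apply Rle_trans with (node H j * (2 ^ j * exp (-20)) ^ 2).
    + rewrite He; unfold node; apply Req_le; field; lra.
    + apply Rmult_le_compat; [lra | apply pow2_ge_0 | unfold x in *; nra | ].
      apply pow_incr; split; auto; apply Rmult_le_pos; lra.
Qed.

Lemma law_approx_lower (H : nat -> R) (kap : R) (HK : contractive_kernel (kernel (law H)))
    (n j : nat) :
  dyadic_scale H kap -> (0 < n)%nat -> (2 <= j)%nat -> log2n (2 * n) <= 4 * 2 ^ j ->
  sqrt (exp (-40) * H j) <=
  approx_number (U := H2_NormedModule) (V := H2_NormedModule) n (kop (kernel (law H)) HK).
Proof.
  intros HH Hn Hj Hlog.
  (* Index [2 * l] carries the odd integer [2 l + 1], because indices are shifted by one. *)
  apply (approx_number_lower _ (fun l => orbit_vec (2 * l) (2 ^ j))).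
  - apply kop_linear.
  - auto.
  - apply Rmult_le_pos; apply Rlt_le; [apply exp_pos | apply (scale_pos H kap HH)].
  - intros l l' _ _ N; apply (disjoint_of_orbits _ _ l l' N); intros i Hoff;
      simpl; unfold orbit_coef; now rewrite sparse_off.
  - intros l l' _ _ N; apply (disjoint_of_orbits _ _ l l' N); intros i Hoff;
      now apply kop_orbit_off.
  - intros l _; apply orbit_vec_norm_pos, pow2_gt0.
  - intros l Ll; apply (law_orbit_lower H kap); auto.
    eapply Rle_trans; [apply log2n_le | exact Hlog]; lia.
Qed.

(** * Upper bound and compactness *)

Definition trunc_coef (n : nat) (f : H2) (i : nat) : C :=
  if (i <? n)%nat then h2_coef f i else RtoC 0.

Lemma trunc_summable (n : nat) (f : H2) : ex_series (fun i => Cmod (trunc_coef n f i) ^ 2).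
Proof.
  apply ex_series_R_le with (2 := h2_summable f); intros i; split; [apply pow2_ge_0 | ].
  unfold trunc_coef; destruct (_ <? _)%nat; [lra | rewrite Cmod_0; simpl; rewrite Rmult_0_l].
  apply (pow2_ge_0 (Cmod (h2_coef f i))).
Qed.

Definition trunc (n : nat) (f : H2) : H2 := mkH2 (trunc_coef n f) (trunc_summable n f).

Lemma trunc_plus (n : nat) (f g : H2) :
  trunc n (h2_plus f g) = h2_plus (trunc n f) (trunc n g).
Proof.
  apply H2_ext; intros i; simpl; unfold trunc_coef; destruct (_ <? _)%nat; simpl; [reflexivity | ring].
Qed.

Lemma trunc_scal (n : nat) (c : C) (f : H2) : trunc n (h2_scal c f) = h2_scal c (trunc n f).
Proof.
  apply H2_ext; intros i; simpl; unfold trunc_coef; destruct (_ <? _)%nat; simpl; [reflexivity | ring].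
Qed.

Lemma trunc_norm (n : nat) (f : H2) : h2_norm (trunc n f) <= h2_norm f.
Proof.
  apply pow2_le_inv; [apply h2_norm_ge_0 | ]; apply h2_norm_sq_le; intros N.
  eapply Rle_trans; [ | apply (rsum_le_h2_norm_sq f N)]; apply rsum_le; intros i _.
  simpl h2_coef; unfold trunc_coef; destruct (_ <? _)%nat; [lra | ].
  rewrite Cmod_0; simpl; rewrite Rmult_0_l; apply (pow2_ge_0 (Cmod (h2_coef f i))).
Qed.

Lemma trunc_norm_sq_le (n : nat) (f : H2) :
  h2_norm (trunc n f) ^ 2 <= rsum (fun i => Cmod (h2_coef f i) ^ 2) n.
Proof.
  apply h2_norm_sq_le; intros N.
  apply Rle_trans with (rsum (fun i => Cmod (h2_coef f i) ^ 2 * indic n i) (N + n)).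
  - apply Rle_trans with (rsum (fun i => Cmod (h2_coef f i) ^ 2 * indic n i) N).
    + apply rsum_le; intros i _; simpl h2_coef; unfold trunc_coef, indic.
      destruct (_ <? _)%nat; [lra | rewrite Cmod_0; simpl; lra].
    + apply rsum_le_len; [ | lia].
      intros; apply Rmult_le_pos; [apply pow2_ge_0 | apply indic_ge0].
  - rewrite rsum_indic by lia; apply Rle_refl.
Qed.

Lemma basis_summable (j : nat) :
  ex_series (fun i => Cmod (if (i =? j)%nat then RtoC 1 else RtoC 0) ^ 2).
Proof.
  apply (Series_rsum_le _ 1); [intros; apply pow2_ge_0 | intros N].
  eapply Rle_trans; [apply (rsum_le_len _ N (N + S j)); [intros; apply pow2_ge_0 | lia] | ].
  rewrite (rsum_single _ j); [ | lia | ].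
  - rewrite Nat.eqb_refl, Cmod_1; simpl; lra.
  - intros i _ Ni; apply Nat.eqb_neq in Ni; rewrite Ni, Cmod_0; simpl; ring.
Qed.

Definition h2_basis (j : nat) : H2 :=
  mkH2 (fun i => if (i =? j)%nat then RtoC 1 else RtoC 0) (basis_summable j).

Lemma trunc_S (n : nat) (f : H2) :
  trunc (S n) f = h2_plus (trunc n f) (h2_scal (h2_coef f n) (h2_basis n)).
Proof.
  apply H2_ext; intros i; simpl; unfold trunc_coef.
  destruct (Nat.ltb_spec i (S n)), (Nat.ltb_spec i n), (Nat.eqb_spec i n); subst; try lia; ring.
Qed.

Lemma kop_trunc_linear (K : nat -> nat -> R) (HK : contractive_kernel K) (n : nat) :
  is_linear (K := C_AbsRing) (U := H2_NormedModule) (V := H2_NormedModule)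
    (fun f => kop K HK (trunc n f)).
Proof.
  pose proof (kop_linear K HK) as HL; split.
  - intros f g; change (kop K HK (trunc n (h2_plus f g)) =
                        h2_plus (kop K HK (trunc n f)) (kop K HK (trunc n g))).
    now rewrite trunc_plus, kop_plus.
  - intros c f; change (kop K HK (trunc n (h2_scal c f)) = h2_scal c (kop K HK (trunc n f))).
    now rewrite trunc_scal, kop_scal.
  - destruct (linear_norm _ HL) as [M [HM HB]]; exists M; split; auto; intros f.
    eapply Rle_trans; [apply HB | ]; apply Rmult_le_compat_l; [lra | apply trunc_norm].
Qed.

Lemma kop_trunc_rank (K : nat -> nat -> R) (HK : contractive_kernel K) (n : nat) :
  rank_lt (U := H2_NormedModule) (V := H2_NormedModule) (S n) (fun f => kop K HK (trunc n f)).
Proof.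
  (* [rank_lt] numbers its vectors from 1, hence [pred]. *)
  exists n, (fun l => kop K HK (h2_basis (pred l))); split; [lia | intros f].
  exists (fun l => h2_coef f (pred l)).
  induction n as [ | n IH].
  - rewrite sum_n_m_zero by lia.
    etransitivity; [ | exact (linear_zero _ (kop_linear K HK))]; f_equal.
    apply H2_ext; intros i; reflexivity.
  - rewrite sum_n_Sm, <- IH by lia; rewrite trunc_S, kop_plus, kop_scal; reflexivity.
Qed.

Lemma minus_trunc_coef (n : nat) (f : H2) (i : nat) :
  (i < n)%nat -> h2_coef (h2_plus f (h2_opp (trunc n f))) i = RtoC 0.
Proof. intros L; simpl; unfold trunc_coef; apply Nat.ltb_lt in L; rewrite L; ring. Qed.

Lemma minus_trunc_norm (n : nat) (f : H2) : h2_norm (h2_plus f (h2_opp (trunc n f))) <= h2_norm f.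
Proof.
  apply pow2_le_inv; [apply h2_norm_ge_0 | ]; apply h2_norm_sq_le; intros N.
  eapply Rle_trans; [ | apply (rsum_le_h2_norm_sq f N)]; apply rsum_le; intros i _.
  simpl h2_coef; unfold trunc_coef; destruct (_ <? _)%nat.
  - replace (h2_coef f i + - h2_coef f i)%C with (RtoC 0) by ring.
    rewrite Cmod_0; simpl; rewrite Rmult_0_l; apply (pow2_ge_0 (Cmod (h2_coef f i))).
  - replace (h2_coef f i + - RtoC 0)%C with (h2_coef f i) by ring; apply Rle_refl.
Qed.

Lemma kop_minus_trunc (K : nat -> nat -> R) (HK : contractive_kernel K) (n : nat) (f : H2) :
  h2_plus (kop K HK f) (h2_opp (kop K HK (trunc n f))) =
  kop K HK (h2_plus f (h2_opp (trunc n f))).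
Proof.
  rewrite kop_plus; f_equal; symmetry.
  exact (linear_opp (U := H2_NormedModule) (V := H2_NormedModule) (kop K HK) (trunc n f)
           (kop_linear K HK)).
Qed.

Lemma kop_tail_le (K : nat -> nat -> R) (HK : contractive_kernel K) (n : nat) (rho : R) (f : H2) :
  0 <= rho -> row_bound K n rho ->
  h2_norm (kop K HK (h2_plus f (h2_opp (trunc n f)))) <= sqrt rho * h2_norm f.
Proof.
  intros Hr Hb; apply pow2_le_inv.
  - apply Rmult_le_pos; [apply sqrt_pos | apply h2_norm_ge_0].
  - rewrite Rpow_mult_distr, pow2_sqrt by auto.
    eapply Rle_trans; [apply (kop_tail_norm K HK n rho); auto using minus_trunc_coef | ].
    apply Rmult_le_compat_l; auto.
    apply pow_incr; split; [apply h2_norm_ge_0 | apply minus_trunc_norm].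
Qed.

(** Truncating the argument to [n] coefficients gives an operator of rank at most [n], and the
    remainder sees only the columns from [n] on. *)
Lemma kop_approx_upper (K : nat -> nat -> R) (HK : contractive_kernel K) (n : nat) (rho : R) :
  0 <= rho -> row_bound K n rho ->
  approx_number (U := H2_NormedModule) (V := H2_NormedModule) (S n) (kop K HK) <= sqrt rho.
Proof.
  intros Hr Hb.
  apply (approx_number_le _ (fun f => kop K HK (trunc n f))).
  - apply kop_trunc_linear.
  - apply kop_trunc_rank.
  - apply sqrt_pos.
  - intros f Hf.
    change (h2_norm (h2_plus (kop K HK f) (h2_opp (kop K HK (trunc n f)))) <= sqrt rho).
    rewrite kop_minus_trunc; eapply Rle_trans; [apply (kop_tail_le K HK n rho); auto | ].
    change (h2_norm f <= 1) in Hf; pose proof (sqrt_pos rho); nra.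
Qed.

(** * Diagonal extraction and compactness *)

Definition adherent_upto (u : nat -> nat -> R) (n : nat) (l : nat -> R) : Prop :=
  forall eps N, 0 < eps -> exists p, (N <= p)%nat /\
    forall i, (i < n)%nat -> Rabs (u i p - l i) < eps.

(** Along a subsequence that approaches [l] in the first [n] coordinates, coordinate [n] is bounded,
    and Bolzano-Weierstrass supplies the next value. *)
Lemma adherent_upto_extend (u : nat -> nat -> R) (M : R) (n : nat) (l : nat -> R) :
  (forall i p, Rabs (u i p) <= M) -> adherent_upto u n l ->
  exists v, adherent_upto u (S n) (fun i => if (i <? n)%nat then l i else v).
Proof.
  intros HM Hl.
  assert (Hp : forall m, exists p, (m <= p)%nat /\
            forall i, (i < n)%nat -> Rabs (u i p - l i) < / INR (S m))
    by (intros m; apply Hl, Rinv_0_lt_compat, INR_S_pos).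
  set (p := fun m => proj1_sig (constructive_indefinite_description _ (Hp m))).
  assert (Hp' : forall m, (m <= p m)%nat /\
            forall i, (i < n)%nat -> Rabs (u i (p m) - l i) < / INR (S m))
    by (intros m; unfold p; now destruct (constructive_indefinite_description _ _)).
  destruct (Bolzano_Weierstrass (fun m => u n (p m)) (fun x => - M <= x <= M)) as [v Hv].
  - apply compact_P3.
  - intros m; specialize (HM n (p m)); apply Rabs_le_between in HM; auto.
  - exists v; intros eps N He.
    destruct (ex_INR_ge (/ eps)) as [K0 HK0].
    destruct (Hv (fun x => Rabs (x - v) < eps) (N + K0)%nat) as [m [Lm Hm]].
    { exists (mkposreal eps He); intros x Hx; exact Hx. }
    destruct (Hp' m) as [Lp Hi]; exists (p m); split; [lia | ].
    intros i Li; destruct (Nat.ltb_spec i n) as [L | L].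
    + eapply Rlt_le_trans; [now apply Hi | ].
      rewrite <- (Rinv_inv eps); apply Rinv_le_contravar; [now apply Rinv_0_lt_compat | ].
      apply Rle_trans with (1 := HK0), le_INR; lia.
    + replace i with n by lia; exact Hm.
Qed.

Lemma adherent_upto_ext (u : nat -> nat -> R) (n : nat) (l l' : nat -> R) :
  (forall i, (i < n)%nat -> l i = l' i) -> adherent_upto u n l -> adherent_upto u n l'.
Proof.
  intros E H eps N He; destruct (H eps N He) as [p [Lp Hp]]; exists p; split; auto.
  intros i Li; rewrite <- E by auto; auto.
Qed.

(** No nested subsequences are kept: only the limit values are built by recursion, each chosen so
    that the values so far stay jointly adherent. One subsequence is extracted afterwards, its
    [k]-th term being within [/ (k + 1)] of the limit in the first [k] coordinates. *)
Lemma diagonal_extraction (u : nat -> nat -> R) (M : R) :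
  (forall i p, Rabs (u i p) <= M) ->
  exists (sigma : nat -> nat) (l : nat -> R),
    (forall j k, (j < k)%nat -> (sigma j < sigma k)%nat) /\
    forall i, is_lim_seq (fun k => u i (sigma k)) (l i).
Proof.
  intros HM.
  set (pick := fun n f =>
    epsilon (inhabits 0) (fun v => adherent_upto u (S n) (fun i => if (i <? n)%nat then f i else v))).
  set (l := rec_seq (pick O (fun _ => 0)) (fun f m => pick (S m) f)).
  assert (Hl0 : l O = pick O l).
  { unfold l at 1, rec_seq; simpl; unfold pick; reflexivity. }
  assert (HlS : forall n, l n = pick n l).
  { intros [ | n]; [exact Hl0 | ].
    unfold l at 1; rewrite rec_seq_S; [reflexivity | ].
    intros f f' E; unfold pick; f_equal.
    (* For [rec_seq_S] the choice must depend only on earlier values of [f], so the predicates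
       handed to [epsilon] are shown equal. *)
    apply functional_extensionality; intros v.
    apply propositional_extensionality; split; apply adherent_upto_ext;
      intros i Li; destruct (Nat.ltb_spec i (S n)); auto; [ | symmetry]; apply E; lia. }
  assert (Hadh : forall n, adherent_upto u n l).
  { induction n as [ | n IH].
    - intros eps N He; exists N; split; [lia | intros; lia].
    - destruct (adherent_upto_extend u M n l HM IH) as [v Hv].
      pose proof (epsilon_spec (inhabits 0)
        (fun v => adherent_upto u (S n) (fun i => if (i <? n)%nat then l i else v))
        (ex_intro _ v Hv)) as Hs.
      fold (pick n l) in Hs; rewrite <- HlS in Hs; revert Hs; apply adherent_upto_ext.
      intros i Li; destruct (Nat.ltb_spec i n); auto; f_equal; lia. }
  assert (Hf : forall k N, exists p, (N <= p)%nat /\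
            forall i, (i < k)%nat -> Rabs (u i p - l i) < / INR (S k))
    by (intros k N; apply Hadh, Rinv_0_lt_compat, INR_S_pos).
  set (f := fun k N => proj1_sig (constructive_indefinite_description _ (Hf k N))).
  assert (Hf' : forall k N, (N <= f k N)%nat /\
            forall i, (i < k)%nat -> Rabs (u i (f k N) - l i) < / INR (S k))
    by (intros k N; unfold f; now destruct (constructive_indefinite_description _ _)).
  set (sigma := fix sg k := match k with O => f O O | S k' => f k (S (sg k')) end).
  assert (Hstep : forall k, (sigma k < sigma (S k))%nat)
    by (intros k; simpl; destruct (Hf' (S k) (S (sigma k))); lia).
  exists sigma, l; split.
  - intros j k L; induction L as [ | k L IH]; [apply Hstep | ].
    eapply Nat.lt_trans; [exact IH | apply Hstep].
  - intros i; apply is_lim_seq_spec; intros eps.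
    destruct (ex_INR_ge (/ eps)) as [K0 HK0].
    exists (S (i + K0)); intros k Lk.
    assert (Hk : Rabs (u i (sigma k) - l i) < / INR (S k)).
    { destruct k as [ | k]; [lia | ]; simpl sigma.
      apply (proj2 (Hf' (S k) (S (sigma k)))); lia. }
    eapply Rlt_le_trans; [exact Hk | ].
    rewrite <- (Rinv_inv eps); apply Rinv_le_contravar.
    + apply Rinv_0_lt_compat, cond_pos.
    + apply Rle_trans with (1 := HK0), le_INR; lia.
Qed.

Lemma H2_weak_compact (x : nat -> H2) (M : R) :
  (forall k, h2_norm (x k) <= M) ->
  exists (sigma : nat -> nat) (y : H2),
    (forall j k, (j < k)%nat -> (sigma j < sigma k)%nat) /\ h2_norm y <= M /\
    forall i, is_lim_seq (fun k => Cmod (h2_coef (h2_plus (x (sigma k)) (h2_opp y)) i) ^ 2) 0.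
Proof.
  intros HM.
  assert (HM0 : 0 <= M) by (eapply Rle_trans; [apply h2_norm_ge_0 | apply (HM O)]).
  (* Real and imaginary parts are interleaved, so that one real extraction serves both. *)
  set (u := fun i k => if Nat.even i then Re (h2_coef (x k) (Nat.div2 i))
                       else Im (h2_coef (x k) (Nat.div2 i))).
  destruct (diagonal_extraction u M) as (sigma & l & Hs & Hl).
  { intros i k; unfold u; destruct (Nat.even i).
    - eapply Rle_trans; [apply Rabs_Re_le_Cmod | ].
      eapply Rle_trans; [apply h2_coef_le_norm | apply HM].
    - eapply Rle_trans; [apply Rabs_Im_le_Cmod | ].
      eapply Rle_trans; [apply h2_coef_le_norm | apply HM]. }
  set (c := fun i => (l (2 * i)%nat, l (S (2 * i))) : C).
  assert (HR : forall i, is_lim_seq (fun k => Re (h2_coef (x (sigma k)) i)) (Re (c i))).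
  { intros i; specialize (Hl (2 * i)%nat); unfold u in Hl.
    rewrite Nat.even_mul, Nat.div2_double in Hl; exact Hl. }
  assert (HI : forall i, is_lim_seq (fun k => Im (h2_coef (x (sigma k)) i)) (Im (c i))).
  { intros i; specialize (Hl (S (2 * i))); unfold u in Hl.
    rewrite Nat.even_succ, Nat.odd_mul, Nat.div2_succ_double in Hl; exact Hl. }
  assert (HB : forall N, rsum (fun i => Cmod (c i) ^ 2) N <= M ^ 2).
  { intros N.
    assert (H1 : is_lim_seq (fun k => rsum (fun i => Cmod (h2_coef (x (sigma k)) i) ^ 2) N)
                   (rsum (fun i => Cmod (c i) ^ 2) N)).
    { apply (is_lim_seq_rsum (fun i k => Cmod (h2_coef (x (sigma k)) i) ^ 2)); intros i.
      now apply is_lim_seq_Cmod_sq. }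
    refine (is_lim_seq_le _ (fun _ => M ^ 2) (Finite _) (Finite (M ^ 2)) _ H1
              (is_lim_seq_const _)).
    intros k; eapply Rle_trans; [apply rsum_le_h2_norm_sq | ].
    apply pow_incr; split; [apply h2_norm_ge_0 | apply HM]. }
  assert (Hsum : ex_series (fun i => Cmod (c i) ^ 2))
    by (apply (Series_rsum_le _ (M ^ 2)); auto; intros; apply pow2_ge_0).
  exists sigma, (mkH2 c Hsum); split; [exact Hs | split].
  - apply pow2_le_inv; auto; now apply h2_norm_sq_le.
  - intros i.
    replace (Finite 0) with (Finite (Cmod (c i + - c i) ^ 2))
      by (replace (c i + - c i)%C with (RtoC 0) by ring; rewrite Cmod_0; f_equal; ring).
    apply (is_lim_seq_Cmod_sq (fun k => h2_coef (x (sigma k)) i + - c i)%C).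
    + exact (is_lim_seq_minus' _ _ _ _ (HR i) (is_lim_seq_const _)).
    + exact (is_lim_seq_minus' _ _ _ _ (HI i) (is_lim_seq_const _)).
Qed.

(** The difference from the coordinatewise limit is cut at [n]: its head tends to 0 in norm, having
    finitely many coordinates, and the row bound makes the image of its tail uniformly small. *)
Lemma kop_compact (K : nat -> nat -> R) (HK : contractive_kernel K) :
  (forall eps, 0 < eps -> exists n, row_bound K n eps) ->
  compact_operator (U := H2_NormedModule) (V := H2_NormedModule) (kop K HK).
Proof.
  intros Hrow; split; [apply kop_linear | ].
  intros x [M0 HM0]; set (M := Rmax M0 1).
  assert (HM : forall k, h2_norm (x k) <= M)
    by (intros k; eapply Rle_trans; [apply HM0 | apply Rmax_l]).
  assert (HM1 : 1 <= M) by apply Rmax_r.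
  destruct (H2_weak_compact x M HM) as (sigma & y & Hs & Hy & Hc).
  exists sigma, (kop K HK y); split; [exact Hs | ].
  intros P [eps HP]; unfold filtermap.
  pose proof (cond_pos eps) as He.
  set (d := fun k => h2_plus (x (sigma k)) (h2_opp y)).
  assert (Hd : forall k, h2_norm (d k) <= 2 * M).
  { intros k; unfold d; eapply Rle_trans; [apply h2_norm_triangle | ].
    rewrite h2_norm_opp; specialize (HM (sigma k)); lra. }
  (* Chosen so that [sqrt eta] times the bound [2 * M] on the differences is [eps / 4]. *)
  set (eta := (eps / (8 * M)) ^ 2).
  assert (Heta : 0 < eta) by (apply pow_lt, Rdiv_lt_0_compat; lra).
  destruct (Hrow eta Heta) as [n Hn].
  assert (Hlim : is_lim_seq (fun k => rsum (fun i => Cmod (h2_coef (d k) i) ^ 2) n) 0).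
  { rewrite <- (rsum_eq0 (fun _ => 0) n) by reflexivity.
    apply (is_lim_seq_rsum (fun i k => Cmod (h2_coef (d k) i) ^ 2)); intros i; apply Hc. }
  apply is_lim_seq_spec in Hlim.
  assert (He4 : 0 < (eps / 4) ^ 2) by (apply pow_lt; lra).
  destruct (Hlim (mkposreal _ He4)) as [N HN]; exists N; intros k Lk.
  specialize (HN k Lk); simpl in HN; rewrite Rminus_0_r in HN.
  apply HP; change (h2_norm (h2_plus (kop K HK (x (sigma k))) (h2_opp (kop K HK y))) < eps).
  replace (h2_opp (kop K HK y)) with (kop K HK (h2_opp y)).
  2:{ exact (linear_opp (U := H2_NormedModule) (V := H2_NormedModule) (kop K HK) y
               (kop_linear K HK)). }
  rewrite <- kop_plus; fold (d k).
  assert (E : kop K HK (d k) =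
    h2_plus (kop K HK (trunc n (d k))) (kop K HK (h2_plus (d k) (h2_opp (trunc n (d k)))))).
  { rewrite <- kop_plus; f_equal; apply H2_ext; intros i; simpl; ring. }
  rewrite E; eapply Rle_lt_trans; [apply h2_norm_triangle | ].
  assert (H1 : h2_norm (kop K HK (trunc n (d k))) <= eps / 4).
  { apply pow2_le_inv; [lra | ].
    apply Rle_trans with (1 * h2_norm (trunc n (d k)) ^ 2).
    - apply (kop_tail_norm K HK 0 1); [apply HK | lia].
    - rewrite Rmult_1_l; eapply Rle_trans; [apply trunc_norm_sq_le | ].
      apply Rle_trans with (1 := Rle_abs _); apply Rlt_le; simpl in *; exact HN. }
  assert (H2' : h2_norm (kop K HK (h2_plus (d k) (h2_opp (trunc n (d k))))) <= eps / 4).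
  { eapply Rle_trans; [apply (kop_tail_le K HK n eta); auto; lra | ].
    unfold eta; rewrite sqrt_pow2 by (apply Rlt_le, Rdiv_lt_0_compat; lra).
    apply Rle_trans with (eps / (8 * M) * (2 * M)); [ | apply Req_le; field; lra].
    apply Rmult_le_compat_l; [apply Rlt_le, Rdiv_lt_0_compat; lra | apply Hd]. }
  lra.
Qed.

(** * From [g] to a dyadic scale *)

Definition dyadic_point (j : nat) : R := INR (2 ^ (2 ^ j)).

Lemma dyadic_point_pos (j : nat) : 0 < dyadic_point j.
Proof. apply lt_0_INR, pow2_gt0. Qed.

Lemma dyadic_point_S (j : nat) : dyadic_point (S j) = dyadic_point j ^ 2.
Proof.
  unfold dyadic_point; rewrite <- pow_INR, <- Nat.pow_mul_r; do 2 f_equal.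
  rewrite Nat.pow_succ_r'; ring.
Qed.

Lemma dyadic_point_ge (j : nat) : INR j <= dyadic_point j.
Proof.
  apply le_INR; pose proof (Nat.pow_gt_lin_r 2 j ltac:(lia)).
  pose proof (Nat.pow_gt_lin_r 2 (2 ^ j) ltac:(lia)); lia.
Qed.

(** With [kap = del ^ 2] the constant is the largest value that [dyadic_scale] admits at 0, and the
    quotient of values of [g] is normalized to 1 there. *)
Definition scale_of (g : R -> R) (del : R) (j : nat) : R :=
  del ^ 2 * exp (-2) / 8 * (g (dyadic_point j) / g (dyadic_point 0)) ^ 2.

Lemma scale_of_dyadic (g : R -> R) (del : R) :
  (forall x, 0 < x -> 0 < g x) -> (forall x y, 0 < x -> x <= y -> g y <= g x) ->
  0 < del -> (forall x, 0 < x -> del <= g (x ^ 2) / g x) ->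
  dyadic_scale (scale_of g del) (del ^ 2).
Proof.
  intros Hp Hd Hdel Hs.
  assert (Hg : forall j, 0 < g (dyadic_point j)) by (intros; apply Hp, dyadic_point_pos).
  set (e := del ^ 2 * exp (-2) / 8).
  assert (Hdel2 : 0 < del ^ 2) by now apply pow_lt.
  assert (He : 0 < e) by (unfold e; pose proof (exp_pos (-2)); nra).
  assert (Hq : forall j, 0 < g (dyadic_point j) / g (dyadic_point 0))
    by (intros; now apply Rdiv_lt_0_compat).
  unfold scale_of; fold e; repeat split.
  - exact Hdel2.
  - intros j; apply Rmult_lt_0_compat; [auto | now apply pow_lt].
  - intros j; apply Rmult_le_compat_l; [lra | apply pow_incr; split; [now apply Rlt_le | ]].
    apply Rmult_le_compat_r; [apply Rlt_le, Rinv_0_lt_compat, Hg | ].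
    apply Hd; [apply dyadic_point_pos | ].
    apply le_INR, Nat.pow_le_mono_r; [lia | apply Nat.pow_le_mono_r; lia].
  - intros j; replace (del ^ 2 * (e * (g (dyadic_point j) / g (dyadic_point 0)) ^ 2))
      with (e * (del * (g (dyadic_point j) / g (dyadic_point 0))) ^ 2) by ring.
    apply Rmult_le_compat_l; [lra | apply pow_incr; split].
    + apply Rlt_le, Rmult_lt_0_compat; auto.
    + unfold Rdiv; rewrite <- Rmult_assoc.
      apply Rmult_le_compat_r; [apply Rlt_le, Rinv_0_lt_compat, Hg | ].
      rewrite dyadic_point_S; specialize (Hs _ (dyadic_point_pos j)).
      apply Rmult_le_reg_r with (/ g (dyadic_point j)); [apply Rinv_0_lt_compat, Hg | ].
      rewrite Rmult_assoc, Rinv_r; [lra | apply Rgt_not_eq, Hg].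
  - replace (g (dyadic_point 0) / g (dyadic_point 0)) with 1 by (field; apply Rgt_not_eq, Hg).
    unfold e; lra.
Qed.

(** Every column [b >= n] has [log2n b >= 2 ^ j], and by [visits_add_le] the extra time does not
    raise the bound on visits. *)
Lemma law_row_bound (H : nat -> R) (kap C : R) (j n : nat) :
  dyadic_scale H kap -> 0 < C -> (forall j J, visits (law H) (2 ^ j) J <= C * H j) ->
  2 ^ j <= log2n n -> row_bound (kernel (law H)) n (C * H j).
Proof.
  intros HH HC Hv Hn i; destruct (kernel_row (law H) n i) as [-> | (b & J & Lb & ->)].
  - apply Rlt_le, Rmult_lt_0_compat; auto; apply (scale_pos H kap HH).
  - replace (log2n b) with ((log2n b - 2 ^ j) + 2 ^ j) by ring.
    apply visits_add_le; auto.
    + now apply (law_is_log_convex_law H kap).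
    + pose proof (log2n_le n b Lb); lra.
    + apply Rlt_le, two_pow_pos.
Qed.

Lemma log2n_ge (n k : nat) : (2 ^ k <= S n)%nat -> INR k <= log2n n.
Proof.
  intros L; unfold log2n; pose proof ln2_pos.
  apply Rmult_le_reg_r with (ln 2); auto.
  unfold Rdiv; rewrite Rmult_assoc, Rinv_l, Rmult_1_r by lra.
  rewrite <- ln_pow, <- INR_pow2 by lra; apply ln_le; [apply lt_0_INR, pow2_gt0 | now apply le_INR].
Qed.

Lemma log2n_le_INR (n k : nat) : (S n <= 2 ^ k)%nat -> log2n n <= INR k.
Proof.
  intros L; unfold log2n; pose proof ln2_pos.
  apply Rmult_le_reg_r with (ln 2); auto.
  unfold Rdiv; rewrite Rmult_assoc, Rinv_l, Rmult_1_r by lra.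
  rewrite <- ln_pow, <- INR_pow2 by lra; apply ln_le; [apply INR_S_pos | now apply le_INR].
Qed.

Lemma dyadic_bracket (n : nat) :
  (16 <= n)%nat -> exists j, (2 <= j)%nat /\ (2 ^ (2 ^ j) <= n < 2 ^ (2 ^ S j))%nat.
Proof.
  intros Hn; set (k := Nat.log2 n); exists (Nat.log2 k).
  assert (Hk : (4 <= k)%nat) by (change 4%nat with (Nat.log2 16); now apply Nat.log2_le_mono).
  destruct (Nat.log2_spec n) as [L1 L2]; [lia | ]; fold k in L1, L2.
  destruct (Nat.log2_spec k) as [L3 L4]; [lia | ].
  split; [change 2%nat with (Nat.log2 4); now apply Nat.log2_le_mono | split].
  - apply Nat.le_trans with (2 := L1), Nat.pow_le_mono_r; lia.
  - apply Nat.lt_le_trans with (1 := L2), Nat.pow_le_mono_r; lia.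
Qed.

Theorem theorem1p4 (g : R -> R)
  (g_pos : forall x, 0 < x -> 0 < g x)
  (g_decr : forall x y, 0 < x -> x <= y -> g y <= g x)
  (g_lim : is_lim g p_infty 0)
  (g_slow : exists delta : R, 0 < delta /\
     forall x, 0 < x -> delta <= g (x ^ 2) / g x) :
  exists (phi : C -> C) (T : H2 -> H2),
    composition_operator phi T /\
    compact_operator T /\
    exists c C0 : R, 0 < c /\ c <= C0 /\
      exists N : nat, forall n : nat, (N <= n)%nat ->
        c * g (INR n) <= approx_number n T /\
        approx_number n T <= C0 * g (INR n).
Proof.
  destruct g_slow as [del [Hdel Hslow]].
  set (H := scale_of g del).
  pose proof (scale_of_dyadic g del g_pos g_decr Hdel Hslow) as HH; fold H in HH.
  pose proof (law_is_log_convex_law H _ HH) as Ha.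
  pose proof (kernel_contractive (law H) Ha (law_log_convex_tail H _ HH)) as HK.
  destruct (visits_law_le H _ HH) as [C [HC Hv]].
  assert (Hg0 : 0 < g (dyadic_point 0)) by apply g_pos, dyadic_point_pos.
  set (e := del ^ 2 * exp (-2) / 8).
  assert (He : 0 < e).
  { unfold e; pose proof (exp_pos (-2)); pose proof (pow_lt del 2 Hdel); nra. }
  assert (HHj : forall j, H j = e * (g (dyadic_point j) / g (dyadic_point 0)) ^ 2)
    by reflexivity.
  exists (symbol (law H)), (kop (kernel (law H)) HK).
  split; [now apply kernel_composition_operator | split].
  - apply kop_compact; intros eps Heps.
    (* This is the value of [g (dyadic_point j)] at which [C * H j] would equal [eps]. *)
    assert (Hs : 0 < sqrt (eps / (C * e)) * g (dyadic_point 0)).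
    { apply Rmult_lt_0_compat; auto.
      apply sqrt_lt_R0, Rdiv_lt_0_compat; auto; now apply Rmult_lt_0_compat. }
    apply is_lim_spec in g_lim; destruct (g_lim (mkposreal _ Hs)) as [M HM]; simpl in HM.
    destruct (INR_unbounded M) as [j Hj].
    exists (2 ^ (2 ^ j))%nat; intros i.
    eapply Rle_trans; [apply (law_row_bound H _ C j _ HH HC Hv) | ].
    + rewrite <- INR_pow2; apply log2n_ge; lia.
    + specialize (HM (dyadic_point j) ltac:(pose proof (dyadic_point_ge j); lra)).
      rewrite Rminus_0_r in HM.
      pose proof (g_pos _ (dyadic_point_pos j)) as Hgj.
      rewrite Rabs_pos_eq in HM by lra.
      assert (Hq : (g (dyadic_point j) / g (dyadic_point 0)) ^ 2 <= eps / (C * e)).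
      { rewrite <- (pow2_sqrt (eps / (C * e))).
        - apply pow_incr; split; [apply Rlt_le, Rdiv_lt_0_compat; auto | ].
          apply Rmult_le_reg_r with (g (dyadic_point 0)); auto.
          unfold Rdiv at 1; rewrite Rmult_assoc, Rinv_l, Rmult_1_r by lra; lra.
        - apply Rlt_le, Rdiv_lt_0_compat; auto; now apply Rmult_lt_0_compat. }
      rewrite HHj; apply (Rmult_le_compat_l (C * e)) in Hq; [ | apply Rlt_le; nra].
      replace (C * e * (eps / (C * e))) with eps in Hq by (field; lra); lra.
  (* [c] comes from [sqrt (exp (-40) * H j)] and [C1] from [sqrt (C * H j)]; the latter is divided
     by [del] because [g (INR n)] may fall below [g (dyadic_point j)] by that factor. *)
  - set (c := exp (-20) * sqrt e / g (dyadic_point 0)).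
    set (C1 := sqrt (C * e) / g (dyadic_point 0) / del).
    assert (Hc : 0 < c).
    { apply Rdiv_lt_0_compat; auto.
      apply Rmult_lt_0_compat; [apply exp_pos | now apply sqrt_lt_R0]. }
    exists c, (Rmax c C1); split; [exact Hc | split; [apply Rmax_l | ]].
    exists 16%nat; intros n Hn.
    destruct (dyadic_bracket n Hn) as (j & Hj & L1 & L2).
    pose proof (g_pos _ (dyadic_point_pos j)) as Hgj.
    assert (Hgn : 0 < g (INR n)) by (apply g_pos, lt_0_INR; lia).
    assert (Hup : g (INR n) <= g (dyadic_point j))
      by (apply g_decr; [apply dyadic_point_pos | now apply le_INR]).
    assert (Hlow : del * g (dyadic_point j) <= g (INR n)).
    { apply Rle_trans with (g (dyadic_point (S j))).
      - rewrite dyadic_point_S; specialize (Hslow _ (dyadic_point_pos j)).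
        apply (Rmult_le_compat_r (g (dyadic_point j))) in Hslow; [ | lra].
        unfold Rdiv in Hslow; rewrite (Rmult_assoc (g _)), Rinv_l in Hslow by lra; lra.
      - apply g_decr; [apply lt_0_INR; lia | apply le_INR; lia]. }
    split.
    + eapply Rle_trans; [ | apply (law_approx_lower H _ HK n j HH); auto; [lia | ]].
      * replace (exp (-40) * H j)
          with ((exp (-20) * sqrt e * (g (dyadic_point j) / g (dyadic_point 0))) ^ 2).
        -- rewrite sqrt_pow2.
           ++ apply Rle_trans with (c * g (dyadic_point j));
                [apply Rmult_le_compat_l; lra | unfold c; apply Req_le; field; lra].
           ++ apply Rmult_le_pos; [ | apply Rlt_le, Rdiv_lt_0_compat; auto].
              apply Rmult_le_pos; [apply Rlt_le, exp_pos | apply sqrt_pos].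
        -- rewrite HHj, !Rpow_mult_distr, pow2_sqrt by lra.
           replace (exp (-40)) with (exp (-20) ^ 2);
             [ring | simpl; rewrite Rmult_1_r, <- exp_plus; f_equal; ring].
      * rewrite <- INR_pow2; replace 4 with (INR 4) by (simpl; ring); rewrite <- mult_INR.
        apply log2n_le_INR.
        (* The integer [2 n + 1] is below [4 * 2^(2^(j + 1))], and [2 + 2 * 2 ^ j <= 4 * 2 ^ j]. *)
        apply Nat.le_trans with (2 ^ (2 + 2 ^ S j))%nat.
        -- rewrite Nat.pow_add_r; simpl (2 ^ 2)%nat; lia.
        -- apply Nat.pow_le_mono_r; [lia | ]; rewrite Nat.pow_succ_r'.
           pose proof (pow2_gt0 j); lia.
    (* The approximation number of order [n + 1] allows the removal of [n] columns, and the first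
       remaining one carries the integer [n + 1], so no index is lost. *)
    + destruct n as [ | n]; [lia | ].
      assert (HCH : 0 <= C * H j)
        by (apply Rmult_le_pos; [lra | apply Rlt_le, (scale_pos H _ HH)]).
      eapply Rle_trans; [apply (kop_approx_upper _ HK n (C * H j) HCH) | ].
      * apply (law_row_bound H _ C j _ HH HC Hv).
        rewrite <- INR_pow2; now apply log2n_ge.
      * rewrite HHj, <- Rmult_assoc, sqrt_mult, sqrt_pow2;
          [ | apply Rlt_le, Rdiv_lt_0_compat; auto | nra | apply pow2_ge_0].
        apply Rle_trans with (C1 * g (INR (S n))).
        -- apply Rle_trans with (C1 * (del * g (dyadic_point j))).
           ++ unfold C1; apply Req_le; field; lra.
           ++ apply Rmult_le_compat_l; auto; unfold C1.
              apply Rmult_le_pos; [apply Rmult_le_pos; [apply sqrt_pos | ] | ];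
                apply Rlt_le, Rinv_0_lt_compat; auto.
        -- apply Rmult_le_compat_r; [lra | apply Rmax_r].
Qed.
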